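(* Let $q\in[1,\infty]$ and $\tau>0$. Assume the model and sampling setup (M), that the kernels satisfy (K1), (K2), (K4) and (K3) with $p=q$, $s=\tau$, and that (T-a) and (T-b) hold with these $q$ and $\tau$. If $R\in\mathrm W^\tau_q(\mathbb S^{d-1})$ and $$T_N\asymp\Big(\frac{N}{(\log N)^{\kappa_q}}\Big)^{\frac{1}{2\tau+d-1}},$$ then $$\|\hat R-R\|_q=O_p\Big(\Big(\frac{N}{(\log N)^{\kappa_q}}\Big)^{-\frac{\tau}{2\tau+d-1}}\Big).$$ Moreover, if $q=\infty$ and (T-a) and (T-c) hold (with $\tau$), then there is a constant $C$ such that, almost surely, $$\limsup_{N\to\infty}\Big(\frac{N}{(\log N)^{2r+1}}\Big)^{\frac{\tau}{2\tau+d-1}}\|\hat R-R\|_\infty\le C.$$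
   Context: Spherical harmonics: $\mathbb S^{d-1}$ ($d\ge2$) is the unit sphere in $\mathbb R^d$ with surface measure $\sigma$, $|\mathbb S^{d-1}|=2\pi^{d/2}/\Gamma(d/2)$, $\|\cdot\|_p$ the $\mathrm L^p(\sigma)$ norm. $H^{n,d}$: restrictions to $\mathbb S^{d-1}$ of homogeneous harmonic polynomials of degree $n$, dimension $h(n,d)=\frac{(2n+d-2)(n+d-2)!}{n!(d-2)!(n+d-2)}$ ($h(0,d)=1$, $h(n,2)=2$ for $n\ge1$); $Q_{n,d}$ the orthogonal projector onto $H^{n,d}$, with kernel $q_{n,d}(x,y)=\frac{h(n,d)C_n^{\nu(d)}(x'y)}{|\mathbb S^{d-1}|C_n^{\nu(d)}(1)}$, $\nu(d)=(d-2)/2$, $C_n^\nu$ Gegenbauer polynomials ($C_n^\nu(t)=\sum_{l=0}^{\lfloor n/2\rfloor}\frac{(-1)^l(\nu)_{n-l}}{l!(n-2l)!}(2t)^{n-2l}$ for $\nu>0$; $C_0^0=1$, $C_n^0(t)=\frac2n\cos(n\arccos t)$). $\zeta_{n,d}=n(n+d-2)$. $\mathrm W^s_p(\mathbb S^{d-1})$: $f\in\mathrm L^p$ with $(-\Delta^S)^{s/2}f:=\sum_n\zeta_{n,d}^{s/2}Q_{n,d}f\in\mathrm L^p$ (as a distribution), norm $\|f\|_{p,s}=\|f\|_p+\|(-\Delta^S)^{s/2}f\|_p$. Kernels: $K_T(x,y)=\sum_{n=0}^T\chi(n,T)q_{n,d}(x,y)$ with real weights; conditions: (K1) $\sup_T\|K_T(x,\cdot)\|_1<\infty$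 (independent of $x$); (K2) $\exists C,\alpha$: $|K_T(z,x)-K_T(z,y)|\le C\|x-y\|T^\alpha$ for all $x,y,z,T$; (K3) for given $p,s$: $\exists C$ $\forall f\in\mathrm W^s_p$, $\|f-\int K_T(\cdot,y)f(y)d\sigma(y)\|_p\le CT^{-s}\|f\|_{p,s}$; (K4) $\chi(n,T)\in[0,1]$ and $\exists c>0$: $\chi(n,T)\ge c$ for $0\le n\le\lfloor T/2\rfloor$. The odd part is $K_{2T}^-(x,y)=\sum_{p=0}^{T-1}\chi(2p+1,2T)q_{2p+1,d}(x,y)$. Setup (M): $\beta,X$ independent random vectors in $\mathbb S^{d-1}$, $\beta$ with probability density $f_\beta$ w.r.t. $\sigma$, $X$ with density $f_X$ w.r.t. $\sigma$, positive $\sigma$-a.e. on $H^+=\{x:x_1\ge0\}$ and zero outside; $Y=\mathbb I\{X'\beta\ge0\}$; $r(x)=\mathbb P(Y=1|X=x)$ on $H^+$; $R(x)=r(x)$ for $x_1\ge0$ and $R(x)=1-r(-x)$ for $x_1<0$. Data $(y_i,x_i)_{i=1}^N$ are i.i.d. copies of $(Y,X)$; $\hat f_X$ is an estimator of $f_X$ computed from the data; $r>0$ is a trimming constant; $T_N$ is a sequence of integers. Estimator: $\hat R(x)=\frac12+\frac1N\sum_{i=1}^N\frac{(2y_i-1)K_{2T_N}^-(x_i,x)}{\max(\hat f_X(x_i),(\log N)^{-r})}$. Trimming conditions, for given $q\in[1,\infty]$, $\tau>0$: let $\kappa_q=2r+(1-2/q)\mathbb I\{q\ge2\}$ ($\kappa_\infty=2r+1$)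 and $M_N=\max_{i\le N}\big|\frac{\max(f_X(x_i),(\log N)^{-r})}{\max(\hat f_X(x_i),(\log N)^{-r})}-1\big|$. (T-a) $\sup_{H^+}f_X<\infty$ and $\sigma(\{0<f_X<(\log N)^{-r}\})=o\big((N/(\log N)^{\kappa_q})^{-\frac{\tau+(d-1)(1-1/q)}{2\tau+d-1}}\big)$; (T-b) $(N/(\log N)^{\kappa_q})^{\frac{\tau}{2\tau+d-1}}(\log N)^rM_N=O_p(1)$; (T-c) for some constant $C$, $\limsup_N(N/(\log N)^{2r+1})^{\frac{\tau}{2\tau+d-1}}(\log N)^rM_N\le C$ a.s. *)

(* Defs.v *)
From HB Require Import structures.
From mathcomp Require Import all_boot all_order all_algebra.
From mathcomp Require Import all_classical all_reals all_analysis.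
Set Implicit Arguments. Unset Strict Implicit. Unset Printing Implicit Defensive.
Import Order.TTheory GRing.Theory Num.Theory.
Import numFieldNormedType.Exports.
Local Open Scope classical_set_scope.
Local Open Scope ring_scope.

Section Defs.
Variable R : realType.

Definition dimd (k : nat) : nat := k.+2.
Definition Vec (k : nat) := g_sigma_algebraType (@open 'rV[R]_(dimd k)).

Definition dotv k (x y : Vec k) : R := \sum_(i < dimd k) x ord0 i * y ord0 i.
Definition enorm k (x : Vec k) : R := Num.sqrt (dotv x x).
Definition sphere k : set (Vec k) := [set x | dotv x x = 1].
Arguments sphere : clear implicits.
Definition first k (x : Vec k) : R := x ord0 ord0.
Definition Hplus k : set (Vec k) := [set x | sphere k x /\ 0 <= first x].
Arguments Hplus : clear implicits.

(** Gamma(d/2) for an integer d >= 1 (Gamma(m) = (m-1)!,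
    Gamma(m+1/2) = (2m)! sqrt(pi) / (4^m m!)). *)
Definition gamma_half (d : nat) : R :=
  if odd d then (((d./2).*2)`!)%:R * Num.sqrt pi / ((4 ^ d./2)%:R * (d./2)`!%:R)
  else ((d./2).-1`!)%:R.
Definition surf_area (d : nat) : R := 2 * powR pi (d%:R / 2) / gamma_half d.

Definition orthogonal_mx n (U : 'M[R]_n) := U *m U^T = 1%:M.
Definition is_surface_measure k (sigma : {measure set Vec k -> \bar R}) : Prop :=
  [/\ sigma (~` sphere k) = 0%E,
      sigma (sphere k) = (surf_area (dimd k))%:E &
      forall (U : 'M[R]_(dimd k)), orthogonal_mx U ->
        forall A : set (Vec k), measurable A ->
          sigma ((fun x : Vec k => (x *m U : Vec k)) @^-1` A) = sigma A].

(** dimension of H^{n,d} *)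
Definition hdim (n d : nat) : R :=
  if n == 0%N then 1 else
  ((2 * n + d - 2)%N%:R * (n + d - 2)`!%:R) /
  (n`!%:R * (d - 2)`!%:R * (n + d - 2)%N%:R).

Definition poch (nu : R) (m : nat) : R := \prod_(j < m) (nu + j%:R).

Definition gegen (d n : nat) (t : R) : R :=
  if d == 2%N then
    (if n == 0%N then 1 else 2 / n%:R * cos (n%:R * acos t))
  else
    \sum_(l < (n./2).+1)
      (-1) ^+ l * poch ((d%:R - 2) / 2) (n - l) / (l`!%:R * (n - 2 * l)`!%:R)
      * (2 * t) ^+ (n - 2 * l).

(** reproducing kernel q_{n,d} of H^{n,d} *)
Definition qker k (n : nat) (x y : Vec k) : R :=
  hdim n (dimd k) * gegen (dimd k) n (dotv x y) /
  (surf_area (dimd k) * gegen (dimd k) n 1).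

Definition Qop k (sigma : {measure set Vec k -> \bar R}) (n : nat)
  (f : Vec k -> R) (x : Vec k) : R :=
  \int[sigma]_y (qker n x y * f y).

Definition zeta k (n : nat) : R := (n * (n + dimd k - 2))%N%:R.

Definition inLp k (sigma : {measure set Vec k -> \bar R}) (p : \bar R)
  (f : Vec k -> R) : Prop :=
  measurable_fun setT f /\ (Lnorm sigma p (fun x => (f x)%:E) < +oo)%E.

(** f in W^s_p and g in L^p represents the distribution (-Delta)^{s/2} f
    = sum_n zeta_n^{s/2} Q_n f, i.e. Q_n g = zeta_n^{s/2} Q_n f for all n. *)
Definition sobolev k (sigma : {measure set Vec k -> \bar R}) (p : \bar R) (s : R)
  (f g : Vec k -> R) : Prop :=
  [/\ inLp sigma p f, inLp sigma p g &
      forall n x, sphere k x -> Qop sigma n g x = powR (zeta k n) (s / 2) * Qop sigma n f x].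

(** Sobolev norm ||f||_{p,s} = ||f||_p + ||(-Delta)^{s/2} f||_p *)
Definition sobnorm k (sigma : {measure set Vec k -> \bar R}) (p : \bar R)
  (f g : Vec k -> R) : \bar R :=
  (Lnorm sigma p (fun x => (f x)%:E) + Lnorm sigma p (fun x => (g x)%:E))%E.

Definition Kker k (chi : nat -> nat -> R) (T : nat) (x y : Vec k) : R :=
  \sum_(n < T.+1) chi n T * qker n x y.
Definition Kminus k (chi : nat -> nat -> R) (T : nat) (x y : Vec k) : R :=
  \sum_(p < T) chi (2 * p + 1)%N (2 * T)%N * qker (2 * p + 1) x y.
Definition Kop k (sigma : {measure set Vec k -> \bar R}) (chi : nat -> nat -> R)
  (T : nat) (f : Vec k -> R) (x : Vec k) : R :=
  \int[sigma]_y (Kker chi T x y * f y).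

Definition K1 k (sigma : {measure set Vec k -> \bar R}) (chi : nat -> nat -> R) :=
  exists B : R, forall T x, sphere k x ->
    (\int[sigma]_y (`|Kker chi T x y|)%:E <= B%:E)%E.
Definition K2 k (chi : nat -> nat -> R) :=
  exists C alpha : R, forall x y z : Vec k, forall T : nat,
    sphere k x -> sphere k y -> sphere k z ->
    `|Kker chi T z x - Kker chi T z y| <= C * enorm (x - y) * powR T%:R alpha.
Definition K3 k (sigma : {measure set Vec k -> \bar R}) (chi : nat -> nat -> R)
  (p : \bar R) (s : R) :=
  exists C : R, forall T : nat, (0 < T)%N -> forall f g, sobolev sigma p s f g ->
    (Lnorm sigma p (fun x => (f x - Kop sigma chi T f x)%:E)
      <= (C * powR T%:R (- s))%:E * sobnorm sigma p f g)%E.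
Definition K4 (chi : nat -> nat -> R) :=
  (forall n T, 0 <= chi n T <= 1) /\
  exists c : R, 0 < c /\ forall n T, (n <= T./2)%N -> c <= chi n T.

Section Prob.
Context {dO} {Omega : measurableType dO}.
Variable P : probability Omega R.

Definition outer_le (A : set Omega) (e : R) :=
  exists E, [/\ measurable E, A `<=` E & (P E <= e%:E)%E].

Definition Op (Z : nat -> Omega -> \bar R) (a : nat -> R) :=
  forall eps : R, 0 < eps -> exists M : R, 0 < M /\ exists N0, forall N, (N0 <= N)%N ->
    outer_le [set w | ((M * a N)%:E < Z N w)%E] eps.

Definition mutually_independent {I : eqType} k (Z : I -> Omega -> Vec k) :=
  forall (s : seq I) (A : I -> set (Vec k)), uniq s -> (forall i, measurable (A i)) ->
    P (\bigcap_(i in [set` s]) (Z i @^-1` A i)) = (\prod_(i <- s) P (Z i @^-1` A i))%E.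
End Prob.

(** r(x) = P(X'beta >= 0) = P(Y = 1 | X = x), R(x) *)
Definition rfun k (sigma : {measure set Vec k -> \bar R}) (fbeta : Vec k -> R) (x : Vec k) : R :=
  \int[sigma]_(b in [set b | 0 <= dotv x b]) fbeta b.
Definition Rfun k (sigma : {measure set Vec k -> \bar R}) (fbeta : Vec k -> R) (x : Vec k) : R :=
  if 0 <= first x then rfun sigma fbeta x else 1 - rfun sigma fbeta (- x).

Definition trim (r : R) (N : nat) : R := powR (ln N%:R) (- r).
Definition base (kappa : R) (N : nat) : R := N%:R / powR (ln N%:R) kappa.
Definition inv_q (q : \bar R) : R := match q with (x%:E)%E => x^-1 | _ => 0 end.
Definition kappa (q : \bar R) (r : R) : R :=
  match q with
  | (x%:E)%E => 2 * r + (if 2 <= x then 1 - 2 / x else 0)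
  | _ => 2 * r + 1
  end.

Definition dm1 k : R := (dimd k)%:R - 1.

Section Model.
Context {dO} {Omega : measurableType dO}.
Variable P : probability Omega R.
Variable k : nat.
Variable sigma : {measure set Vec k -> \bar R}.
(** Z i true = beta_i, Z i false = X_i ; (beta_i, X_i), i in nat, are the latent
    i.i.d. copies of (beta, X). *)
Variable Z : nat -> bool -> Omega -> Vec k.
Variables fbeta fX : Vec k -> R.

(** Setup (M). Mutual independence of all beta_i, X_i with the given laws is
    equivalent to: (beta_i, X_i) i.i.d. copies of (beta, X) with beta independent of X. *)
Definition model_M : Prop :=
  [/\ (forall i b, measurable_fun setT (Z i b)) /\
      (forall i b w, sphere k (Z i b w)),
      mutually_independent P (fun ib : nat * bool => Z ib.1 ib.2),
      [/\ measurable_fun setT fbeta, measurable_fun setT fX,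
          (forall x, 0 <= fbeta x) & (forall x, 0 <= fX x)],
      (forall i A, measurable A ->
        P (Z i true @^-1` A) = (\int[sigma]_(x in A) (fbeta x)%:E)%E) /\
      (forall i A, measurable A ->
        P (Z i false @^-1` A) = (\int[sigma]_(x in A) (fX x)%:E)%E) &
      sigma [set x | Hplus k x /\ (fX x <= 0)%R] = 0%E
      /\ forall x, sphere k x -> first x < 0 -> fX x = 0].

Definition xdat (i : nat) (w : Omega) : Vec k := Z i false w.
Definition ydat (i : nat) (w : Omega) : bool := 0 <= dotv (Z i false w) (Z i true w).
Definition data (N : nat) (w : Omega) : seq (bool * Vec k) :=
  [seq (ydat i w, xdat i w) | i <- iota 0 N].

Variable fhat : nat -> seq (bool * Vec k) -> Vec k -> R.
Variable r : R.

Definition Rhat (chi : nat -> nat -> R) (TN : nat -> nat) (N : nat) (w : Omega)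
  (x : Vec k) : R :=
  1 / 2 + N%:R^-1 * \sum_(i < N)
    ((2 * (ydat i w)%:R - 1) * Kminus chi (TN N) (xdat i w) x
       / Num.max (fhat N (data N w) (xdat i w)) (trim r N)).

Definition MN (N : nat) (w : Omega) : R :=
  \big[Num.max/0]_(i < N)
    `|Num.max (fX (xdat i w)) (trim r N) / Num.max (fhat N (data N w) (xdat i w)) (trim r N) - 1|.

Definition T_a (q : \bar R) (tau : R) : Prop :=
  (exists B : R, forall x, Hplus k x -> fX x <= B) /\
  forall eps : R, 0 < eps -> exists N0 : nat, forall N : nat, (N0 <= N)%N ->
    (sigma [set x | sphere k x /\ (0 < fX x < trim r N)%R]
      <= (eps * powR (base (kappa q r) N)
                 (- ((tau + dm1 k * (1 - inv_q q)) / (2 * tau + dm1 k))))%:E)%E.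

Definition T_b (q : \bar R) (tau : R) : Prop :=
  Op P (fun N w => (powR (base (kappa q r) N) (tau / (2 * tau + dm1 k))
                    * powR (ln N%:R) r * MN N w)%:E) (fun _ => 1).

Definition T_c (tau : R) : Prop :=
  exists C : R, {ae P, forall w,
    (limn_esup (fun N => (powR (base (2 * r + 1) N) (tau / (2 * tau + dm1 k))
                          * powR (ln N%:R) r * MN N w)%:E) <= C%:E)%E}.
End Model.

Definition rate_T k (TN : nat -> nat) (kap tau : R) : Prop :=
  exists c1 c2 : R, [/\ 0 < c1, 0 < c2 & exists N0 : nat, forall N : nat, (N0 <= N)%N ->
    c1 * powR (base kap N) (1 / (2 * tau + dm1 k)) <= (TN N)%:R
    <= c2 * powR (base kap N) (1 / (2 * tau + dm1 k))].

End Defs.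

(* Main.v *)
(* With u = K f - f for f = R and K = K_2T, one has
     Rhat - R = (Rhat - Rbar) + (Rbar - E Rbar) + (trimming bias) + (u(x) - u(-x)) / 2,
   where Rbar uses max(fX, trim) instead of max(fhat, trim): since R(x) + R(-x) = 1 off the
   equator, the odd kernel K_2T^- recovers R from its values on H+ up to the smoothing bias u,
   which (K3) controls. The first term is at most M_N times the mean of the absolute values of the
   summands of Rbar, so both it and the second term reduce to deviations of means of i.i.d.
   summands that are bounded by T^(d-1) (log N)^r and have variance at most a constant times
   T^(d-1) (log N)^(2r). A Bernstein-type bound on a grid of mesh N^-e controls them uniformly
   over the sphere, and the exponential moment also gives their L^2 size; interpolation between L^2
   and L^oo produces the power (1 - 2/q) of log N in kappa_q. The trimming bias is interpolated
   between L^1 and L^oo in the same way. Borel-Cantelli gives the almost sure statement. *)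
Require Import Defs.
From HB Require Import structures.
From mathcomp Require Import all_boot all_order all_algebra.
From mathcomp Require Import all_classical all_reals all_analysis.
From mathcomp Require Import measurable_realfun ess_sup_inf hoelder.
From mathcomp Require Import ring lra zify.
Import Order.TTheory GRing.Theory Num.Theory.
Import numFieldNormedType.Exports.
Local Open Scope classical_set_scope.
Local Open Scope ring_scope.

(** * Gegenbauer polynomials *)

(** [fhat] is an arbitrary function of the whole sample, so the summands of [Rhat] are not
    independent and need not be measurable; comparing trimmed densities through their ratio confines
    [fhat] to [MN], and exceptional events are handled through measurable supersets. The mean of an
    oracle summand carries the weight [fX / max (fX, t) <= 1], so (K1) bounds its first absolute
    moment uniformly in T and [t]. In the second moment one kernel factor is bounded by its
    supremum, of order T^(d-1), and the other again by (K1); hence a variance growing like T^(d-1)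
    and not like its square. Taking T^(2 tau + d - 1) of order N / (log N)^kappa_q balances the
    squared bias T^(-2 tau) against T^(d-1) (log N)^kappa_q / N. The supremum of the kernel rests on
    |C_n(t)| <= |C_n(1)| and on the growth of the dimensions h(n,d), both proved here. The measure
    [sigma] is known only through its support, mass and rotation invariance, so the equator, where
    the definition of R does not provide the antisymmetry, has to be shown null from invariance. *)

Section Gegenbauer.
Variable R : realType.
Implicit Types (nu t th : R) (n l : nat).

Let pochS nu n : poch nu n.+1 = poch nu n * (nu + n%:R).
Proof. by rewrite /poch big_ord_recr. Qed.

Let factS_R n : (n.+1)`!%:R = n.+1%:R * n`!%:R :> R.
Proof. by rewrite factS natrM. Qed.

Let fact_neq0 n : n`!%:R != 0 :> R.
Proof. by rewrite pnatr_eq0 -lt0n fact_gt0. Qed.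

(** The coefficient is extended by zero past l = n/2, so that sums may run over all l <= n and the
    recurrence can be compared index by index; truncated subtraction would otherwise produce
    spurious terms. *)
Definition gegen_coef nu t n l : R := if (l.*2 <= n)%N then
  (-1) ^+ l * poch nu (n - l) / (l`!%:R * (n - 2 * l)`!%:R) * (2 * t) ^+ (n - 2 * l)
  else 0.

Definition gegen_sum nu n t : R := \sum_(l < n.+1) gegen_coef nu t n l.

Lemma gegen_coef_rec0 nu t n :
  n.+1%:R * gegen_coef nu t n.+1 0 = 2 * t * (n%:R + nu) * gegen_coef nu t n 0.
Proof.
rewrite /gegen_coef /= muln0 !subn0 pochS factS_R !fact0 exprS.
have h1 := fact_neq0 n; have h2 : n.+1%:R != 0 :> R by rewrite pnatr_eq0.
by field; rewrite nat1r h1 h2.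
Qed.

(** The three-term recurrence already holds coefficient by coefficient: lowering l by one in degree
    n matches the power of 2t in degree n + 2. *)
Lemma gegen_coef_recS nu t n l :
  n.+2%:R * gegen_coef nu t n.+2 l.+1 =
  2 * t * (n.+1%:R + nu) * gegen_coef nu t n.+1 l.+1
  - (n%:R + 2 * nu) * gegen_coef nu t n l.
Proof.
rewrite /gegen_coef doubleS !ltnS.
have [hl|hl] := leqP l.*2 n; last first.
  by rewrite ifF ?mulr0 ?subr0 //; apply/negbTE; rewrite -leqNgt ltnW.
have [m ->] : exists m, n = (l.*2 + m)%N by exists (n - l.*2)%N; rewrite subnKC.
have -> : ((l.*2 + m).+2 - l.+1 = (l + m).+1)%N by lia.
have -> : ((l.*2 + m).+2 - 2 * l.+1 = m)%N by lia.
have -> : (l.*2 + m - l = l + m)%N by lia.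
have -> : (l.*2 + m - 2 * l = m)%N by lia.
(* For n = 2l the coefficient of index l + 1 in degree n + 1 is past the cutoff and vanishes. *)
case: m => [|m].
  rewrite addn0 ltnn mulr0 fact0 expr0 pochS factS_R exprS.
  rewrite (_ : l.*2.+2%:R = 2 * l.+1%:R :> R); last by rewrite -doubleS -mul2n natrM.
  rewrite (_ : l.*2%:R = 2 * l%:R :> R); last by rewrite -mul2n natrM.
  rewrite natrD.
  have h1 := fact_neq0 l; have h2 : l.+1%:R != 0 :> R by rewrite pnatr_eq0.
  by field; rewrite nat1r h1 h2.
rewrite ifT; last by lia.
have -> : ((l.*2 + m.+1).+1 - l.+1 = (l + m).+1)%N by lia.
have -> : ((l.*2 + m.+1).+1 - 2 * l.+1 = m)%N by lia.
rewrite !addnS pochS !factS_R !exprS -!nat1r !natrD -mul2n natrM -!nat1r.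
have h1 := fact_neq0 l; have h2 : l.+1%:R != 0 :> R by rewrite pnatr_eq0.
have h3 := fact_neq0 m; have h4 : m.+1%:R != 0 :> R by rewrite pnatr_eq0.
by field; rewrite !nat1r h1 h3 h2 h4.
Qed.

Lemma gegen_sum_rec nu t n : n.+2%:R * gegen_sum nu n.+2 t =
  2 * t * (n.+1%:R + nu) * gegen_sum nu n.+1 t - (n%:R + 2 * nu) * gegen_sum nu n t.
Proof.
rewrite /gegen_sum big_ord_recl mulrDr [X in 2 * t * _ * X]big_ord_recl mulrDr.
rewrite gegen_coef_rec0 -addrA; congr (_ + _).
rewrite mulr_sumr (eq_bigr (fun i : 'I_n.+2 =>
  2 * t * (n.+1%:R + nu) * gegen_coef nu t n.+1 i.+1
  - (n%:R + 2 * nu) * gegen_coef nu t n i)); last first.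
  by move=> i _; rewrite -gegen_coef_recS.
rewrite big_split /= -mulr_sumr sumrN -mulr_sumr; congr (_ * _ - _ * _).
  rewrite big_ord_recr /= [X in _ + X]ifF ?addr0 //; lia.
rewrite big_ord_recr /= [X in _ + X]ifF ?addr0 //; lia.
Qed.

Lemma gegenE d n t : d != 2%N -> gegen d n t = gegen_sum ((d%:R - 2) / 2) n t.
Proof.
move=> /negbTE d2; rewrite /gegen d2 /gegen_sum.
rewrite (big_ord_widen n.+1 (fun l => (-1) ^+ l * poch ((d%:R - 2) / 2) (n - l) /
  (l`!%:R * (n - 2 * l)`!%:R) * (2 * t) ^+ (n - 2 * l))); last first.
  by lia.
rewrite big_mkcond; apply: eq_bigr => l _; rewrite /gegen_coef.
by rewrite ltnS geq_half_double.
Qed.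

Let pochfactS nu i : i.+1%:R * (poch nu i.+1 / i.+1`!%:R) = (nu + i%:R) * (poch nu i / i`!%:R).
Proof.
rewrite pochS factS_R.
have h1 := fact_neq0 i; have h2 : i.+1%:R != 0 :> R by rewrite pnatr_eq0.
by field; rewrite nat1r h1 h2.
Qed.

Let conv (F : nat -> nat -> R) n := \sum_(i < n.+1) F i (n - i)%N.

(** Weighting by an index kills its zero term and shifts it: this is the derivative of one factor in
    a product of power series. *)
Let conv_shiftl (F : nat -> nat -> R) n :
  conv (fun i j => i%:R * F i j) n.+1 = conv (fun i j => i.+1%:R * F i.+1 j) n.
Proof. by rewrite /conv big_ord_recl /= mul0r add0r. Qed.

Let conv_shiftr (F : nat -> nat -> R) n :
  conv (fun i j => j%:R * F i j) n.+1 = conv (fun i j => j.+1%:R * F i j.+1) n.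
Proof.
rewrite /conv big_ord_recr /= subnn mul0r addr0.
by apply: eq_bigr => i _; rewrite subSn // -ltnS.
Qed.

Let convD F G n : conv F n + conv G n = conv (fun i j => F i j + G i j) n.
Proof. by rewrite /conv big_split. Qed.
Let convZ c F n : c * conv F n = conv (fun i j => c * F i j) n.
Proof. by rewrite /conv mulr_sumr. Qed.
Let convE F G n : (forall i j, (i + j = n)%N -> F i j = G i j) -> conv F n = conv G n.
Proof. by move=> h; apply: eq_bigr => i _; apply: h; rewrite subnKC // -ltnS. Qed.

(** Coefficient of z^n in phi(z e^(i th)) phi(z e^(-i th)), where phi has coefficients [a]; for a_i
    = (nu)_i / i! this product is the Gegenbauer generating function (1 - 2 z cos th +
    z^2)^(-nu). *)
Definition cos_conv (a : nat -> R) n th : R :=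
  \sum_(i < n.+1) a i * a (n - i)%N * cos ((i%:R - (n - i)%:R) * th).

Let cos_shift th (x : R) : 2 * cos th * cos (x * th) = cos ((x + 1) * th) + cos ((x - 1) * th).
Proof. 
rewrite (_ : (x + 1) * th = x * th + th) 1?(_ : (x - 1) * th = x * th - th); try ring.
by rewrite cosD cosB; ring. Qed.

(** The hypothesis on [a] says (1 - z) phi' = nu phi, and the recurrence is the differential
    equation it implies for the product. Multiplying by 2 cos th shifts the frequency by +1 and by
    -1, recorded by [cp] and [cm]. *)
Lemma cos_conv_rec nu (a : nat -> R) th n :
  (forall i, i.+1%:R * a i.+1 = (nu + i%:R) * a i) -> n.+2%:R * cos_conv a n.+2 th =
  2 * cos th * (n.+1%:R + nu) * cos_conv a n.+1 th - (n%:R + 2 * nu) * cos_conv a n th.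
Proof.
move=> aS; pose A i j := a i * a j * cos ((i%:R - j%:R) * th).
have AE m : cos_conv a m th = conv A m by [].
pose cp i j := a i * a j * cos ((i%:R - j%:R + 1) * th).
pose cm i j := a i * a j * cos ((i%:R - j%:R - 1) * th).
have -> : n.+2%:R * cos_conv a n.+2 th =
    conv (fun i j => (nu + i%:R) * cp i j + (nu + j%:R) * cm i j) n.+1.
  rewrite AE convZ.
  rewrite (@convE _ (fun i j => i%:R * A i j + j%:R * A i j)); last first.
    by move=> i j <-; rewrite natrD mulrDl.
  rewrite -convD conv_shiftl conv_shiftr convD; apply: convE => i j _.
  rewrite /= /A /cp /cm !mulrA aS; congr (_ + _).
    by congr (_ * cos (_ * _)); rewrite -addn1 natrD; ring.
  rewrite (mulrAC j.+1%:R) aS.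
  rewrite (_ : i%:R - j.+1%:R = i%:R - j%:R - 1); first by ring.
  by rewrite -addn1 natrD; ring.
have -> : 2 * cos th * (n.+1%:R + nu) * cos_conv a n.+1 th =
    conv (fun i j => (n.+1%:R + nu) * (cp i j + cm i j)) n.+1.
  rewrite AE convZ; apply: convE => i j _; rewrite /A /cp /cm.
  by rewrite -mulrDr -cos_shift; ring.
(* Writing n + 1 = i + j splits the factor n + 1 + nu; the leftover [i * cm + j * cp] becomes, after
   shifting each index, the term of degree n. *)
have -> : conv (fun i j => (n.+1%:R + nu) * (cp i j + cm i j)) n.+1 =
   conv (fun i j => (nu + i%:R) * cp i j + (nu + j%:R) * cm i j) n.+1 +
   conv (fun i j => i%:R * cm i j + j%:R * cp i j) n.+1.
  by rewrite convD; apply: convE => i j <-; rewrite natrD; ring.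
rewrite -addrA [X in _ = _ + X](_ : _ = 0) ?addr0 //; apply/eqP; rewrite subr_eq0; apply/eqP.
rewrite -convD conv_shiftl conv_shiftr convD AE convZ.
apply: convE => i j <-; rewrite /cp /cm /A natrD !mulrA aS.
rewrite (_ : i.+1%:R - j%:R - 1 = i%:R - j%:R :> R); last by rewrite -addn1 natrD; ring.
rewrite (_ : i%:R - j.+1%:R + 1 = i%:R - j%:R :> R); last by rewrite -addn1 natrD; ring.
by rewrite (mulrAC j.+1%:R) aS; ring.
Qed.

Definition gegen_cos nu := cos_conv (fun i => poch nu i / i`!%:R).

(** Both sides obey the same three-term recurrence and agree in degrees 0 and 1; two consecutive
    degrees are carried through the induction. *)
Lemma gegen_sum_cos nu th n : gegen_sum nu n (cos th) = gegen_cos nu n th.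
Proof.
suff : gegen_sum nu n (cos th) = gegen_cos nu n th /\
       gegen_sum nu n.+1 (cos th) = gegen_cos nu n.+1 th by case.
elim: n => [|n [IH0 IH1]]; last first.
  split=> //; apply: (@mulfI _ n.+2%:R); first by rewrite pnatr_eq0.
  by rewrite gegen_sum_rec IH0 IH1 (cos_conv_rec _ _ _ _ (pochfactS nu)).
rewrite /gegen_sum /gegen_cos /cos_conv /gegen_coef /poch !big_ord_recl !big_ord0 /=.
rewrite /bump /=; split.
  by rewrite muln0 !subn0 !fact0 subr0 mul0r cos0 !expr0; field.
rewrite muln0 !subn0 addn0 subnn (_ : 1`! = 1)%N // !fact0 sub0r subr0 mulN1r !mul1r cosN expr1.
by field.
Qed.

(** All coefficients are nonnegative for nu >= 0, so every cosine may be replaced by its value 1 at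
    th = 0. *)
Lemma gegen_cos_le nu th n : 0 <= nu -> `|gegen_cos nu n th| <= gegen_cos nu n 0.
Proof.
move=> nu0; have pge i : 0 <= poch nu i / i`!%:R.
  by apply: divr_ge0 => //; apply: prodr_ge0 => j _; rewrite addr_ge0.
apply: le_trans (ler_norm_sum _ _ _) _; apply: ler_sum => i _.
rewrite mulr0 cos0 mulr1 normrM ger0_norm; last by rewrite mulr_ge0.
apply: ler_piMr; first by rewrite mulr_ge0.
by rewrite ler_norml cos_geN1 cos_le1.
Qed.

(** For d = 2 the parameter nu is 0 and the definition uses the separate cosine normalisation, hence
    the case split; otherwise the cosine expansion at th = acos t is largest at th = 0. *)
Lemma gegen_le d n t : (2 <= d)%N -> -1 <= t <= 1 -> `|gegen d n t| <= `|gegen d n 1|.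
Proof.
move=> d2 t1; have [->|dn2] := eqVneq d 2%N.
  rewrite /gegen /=; case: ifP => // _; rewrite acos1 mulr0 cos0 mulr1 normrM.
  by apply: ler_piMr => //; rewrite ler_norml cos_geN1 cos_le1.
have nu0 : 0 <= (d%:R - 2) / 2 :> R by rewrite divr_ge0 // subr_ge0 ler_nat.
have e1 nu : gegen_sum nu n 1 = gegen_cos nu n 0 by rewrite -gegen_sum_cos cos0.
rewrite !gegenE // e1 -{1}(acosK t1) gegen_sum_cos.
exact: le_trans (gegen_cos_le _ _ _ nu0) (ler_norm _).
Qed.

Lemma gegenN d n t : (2 <= d)%N -> -1 <= t <= 1 -> gegen d n (- t) = (-1) ^+ n * gegen d n t.
Proof.
move=> d2 t1; have [->|dn2] := eqVneq d 2%N.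
  rewrite /gegen /=; case: ifP => [/eqP ->|_]; first by rewrite expr0 mul1r.
  have cN : cos (n%:R * acos (- t)) = (-1) ^+ n * cos (n%:R * acos t).
    rewrite (_ : acos (- t) = pi - acos t); last first.
      rewrite -[RHS]cosK ?(cosB, cospi, sinpi, mul0r, addr0, mulN1r, acosK) //.
      by rewrite in_itv /= subr_ge0 acos_lepi //= gerBl acos_ge0.
    have [cpi spi] : cos (n%:R * pi) = (-1) ^+ n :> R /\ sin (n%:R * pi) = 0 :> R.
      elim: n => [|n [IH1 IH2]]; first by rewrite mul0r cos0 sin0.
      rewrite -addn1 natrD mulrDl mul1r (sinD (n%:R * pi)) (cosD (n%:R * pi)) IH1 IH2.
      by rewrite cospi sinpi !(mul0r, mulr0, subr0, addr0) exprD expr1.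
    by rewrite mulrBr (cosB (n%:R * pi)) cpi spi mul0r addr0.
  by rewrite cN; ring.
(* Every exponent n - 2l has the parity of n. *)
rewrite !gegenE // /gegen_sum mulr_sumr; apply: eq_bigr => l _; rewrite /gegen_coef.
case: ifP => [hl|]; last by rewrite mulr0.
rewrite mulrN (exprNn (2 * t)); have -> : (-1) ^+ (n - 2 * l) = (-1) ^+ n :> R.
  by rewrite -[LHS]signr_odd -[RHS]signr_odd oddB ?mul2n // odd_double addbF.
by rewrite mulrCA.
Qed.
End Gegenbauer.

Set Implicit Arguments.
Unset Strict Implicit.
Unset Printing Implicit Defensive.

(** * Kernels on the sphere *)

Section Geometry.
Variables (R : realType) (k : nat).
Notation V := (Vec R k).
Implicit Types x y z : V.

Lemma dotvC x y : dotv x y = dotv y x.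
Proof. by apply: eq_bigr => i _; rewrite mulrC. Qed.

Lemma dotvNr x y : dotv x (- y) = - dotv x y.
Proof. by rewrite /dotv -sumrN; apply: eq_bigr => i _; rewrite mxE mulrN. Qed.

Lemma dotvNl x y : dotv (- x) y = - dotv x y.
Proof. by rewrite dotvC dotvNr dotvC. Qed.

Lemma dotvDr x y z : dotv x (y + z) = dotv x y + dotv x z.
Proof. by rewrite /dotv -big_split; apply: eq_bigr => i _; rewrite mxE mulrDr. Qed.

Lemma dotvDl x y z : dotv (y + z) x = dotv y x + dotv z x.
Proof. by rewrite dotvC dotvDr !(dotvC x). Qed.

Lemma dotvZr (c : R) x y : dotv x (c *: y) = c * dotv x y.
Proof. by rewrite /dotv mulr_sumr; apply: eq_bigr => i _; rewrite mxE mulrCA. Qed.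

Lemma dotv_ge0 x : 0 <= dotv x x.
Proof. by apply: sumr_ge0 => i _; rewrite -expr2 sqr_ge0. Qed.

Lemma dotv_eq0 x : dotv x x = 0 -> x = 0.
Proof.
move=> x0; apply/rowP => i; rewrite mxE.
have := @psumr_eq0P _ _ xpredT (fun i : 'I_(dimd k) => x ord0 i * x ord0 i).
move=> /(_ (fun j _ => _) x0 i isT); rewrite -expr2 => h.
by apply/eqP; rewrite -sqrf_eq0; apply/eqP/h => j; rewrite -expr2 sqr_ge0.
Qed.

Lemma sphereN x : sphere x -> sphere (- x).
Proof. by rewrite /sphere /= dotvNl dotvNr opprK. Qed.

Lemma dotv_sphere x y : sphere x -> sphere y -> -1 <= dotv x y <= 1.
Proof.
rewrite /sphere /= => hx hy.
have := dotv_ge0 (x + y); rewrite dotvDl !dotvDr hx hy (dotvC y x) => h1.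
have := dotv_ge0 (x + - y); rewrite dotvDl !dotvDr !dotvNl !dotvNr hx hy (dotvC y x) => h2.
by apply/andP; split; lra.
Qed.

Lemma qkerC n x y : qker n x y = qker n y x.
Proof. by rewrite /qker dotvC. Qed.

Lemma qker_le n x y : sphere x -> sphere y ->
  `|qker n x y| <= hdim R n (dimd k) / `|surf_area R (dimd k)|.
Proof.
move=> hx hy; have h0 : 0 <= hdim R n (dimd k).
  by rewrite /hdim; case: ifP => // _; rewrite !(mulr_ge0, divr_ge0).
rewrite /qker normrM normrM ger0_norm // normfV normrM invfM -!mulrA ler_wpM2l //.
rewrite mulrCA ler_piMr ?invr_ge0 //.
have := @gegen_le R (dimd k) n _ isT (dotv_sphere hx hy).
(* If the value at 1 were 0, the convention 0^-1 = 0 would make the kernel vanish and the bound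
   trivial. *)
have [->|g0] := eqVneq (gegen (dimd k) n (1 : R)) 0; first by rewrite normr0 invr0 mulr0.
by move=> h; rewrite ler_pdivrMr ?mul1r // normr_gt0.
Qed.

Lemma qkerNr n x y : sphere x -> sphere y -> qker n x (- y) = (-1) ^+ n * qker n x y.
Proof.
by move=> hx hy; rewrite /qker dotvNr gegenN // ?dotv_sphere //; ring.
Qed.

(** Reflecting y multiplies the term of degree n by (-1)^n, so antisymmetrisation keeps exactly the
    odd degrees. Through this identity (K1), (K2) and (K3) for K_2T pass to its odd part. *)
Lemma Kminus_odd (chi : nat -> nat -> R) T x y : sphere x -> sphere y ->
  Kminus chi T x y = (Kker chi (2 * T) x y - Kker chi (2 * T) x (- y)) / 2.
Proof.
move=> hx hy; rewrite /Kminus /Kker.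
pose F n := chi n (2 * T)%N * qker n x y.
pose G n := chi n (2 * T)%N * qker n x (- y).
have GE n : G n = (-1) ^+ n * F n by rewrite /G /F qkerNr //; ring.
rewrite (eq_bigr (fun p : 'I_T => F (2 * p + 1)%N)) // -sumrB.
rewrite (eq_bigr (fun n : 'I_(2 * T).+1 => F n - G n)) //.
(* The weights depend on T through chi n (2T), so the terms are generalised to arbitrary F and G
   before the induction on T. *)
elim: T {F G GE} (F) (G) GE => [|T IH] F G GE.
  by rewrite big_ord0 muln0 big_ord1 GE expr0 mul1r subrr mul0r.
have -> : (2 * T.+1).+1 = (2 * T).+3 by lia.
rewrite big_ord_recr /= (IH F G GE) [in RHS]big_ord_recr [in RHS]big_ord_recr /=.
rewrite !GE -[(-1) ^+ (2 * T).+1]signr_odd -[(-1) ^+ (2 * T).+2]signr_odd /= oddM /= expr0 expr1 addn1.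
by field.
Qed.

Lemma Kminus_sym (chi : nat -> nat -> R) T x y : Kminus chi T x y = Kminus chi T y x.
Proof. by apply: eq_bigr => i _; rewrite qkerC. Qed.

Lemma KminusN (chi : nat -> nat -> R) T x y : sphere x -> sphere y ->
  Kminus chi T x (- y) = - Kminus chi T x y.
Proof.
move=> hx hy; rewrite (Kminus_odd _ _ hx (sphereN hy)) (Kminus_odd _ _ hx hy) opprK.
by rewrite -mulNr opprB.
Qed.

(** h(n,d) is the binomial coefficient times (2n + d - 2) / (n + d - 2), a ratio at most 2. *)
Lemma hdimS_le n : hdim R n.+1 (dimd k) <= 2 * ('C(n.+1 + k, k))%:R.
Proof.
rewrite /hdim /= /dimd; have -> : (2 * n.+1 + k.+2 - 2 = 2 * n.+1 + k)%N by lia.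
have -> : (n.+1 + k.+2 - 2 = n.+1 + k)%N by lia.
have -> : (k.+2 - 2 = k)%N by lia.
have h : ('C(n.+1 + k, k))%:R * (n.+1`! * k`!)%:R = (n.+1 + k)`!%:R :> R.
  by rewrite -natrM -{2}(addnK k n.+1) (mulnC _`! k`!) bin_fact // leq_addl.
have p1 : (0 < n.+1`!%:R :> R) by rewrite ltr0n fact_gt0.
have p2 : (0 < k`!%:R :> R) by rewrite ltr0n fact_gt0.
have p3 : (0 < (n.+1 + k)%:R :> R) by rewrite ltr0n.
rewrite ler_pdivrMr ?mulr_gt0 // -h natrM.
rewrite [leLHS](_ : _ = (('C(n.+1 + k, k))%:R * (n.+1`!%:R * k`!%:R)) * (2 * n.+1 + k)%:R); last by ring.
rewrite [leRHS](_ : _ = (('C(n.+1 + k, k))%:R * (n.+1`!%:R * k`!%:R)) * (2 * (n.+1 + k)%:R)); last by ring.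
apply: ler_wpM2l; first by rewrite !mulr_ge0.
by rewrite -natrM ler_nat; lia.
Qed.

(** Pascal's rule telescopes the binomial bounds. *)
Lemma sum_hdim_le T : \sum_(n < T.+1) hdim R n (dimd k) <= 2 * ('C(T + k.+1, k.+1))%:R.
Proof.
elim: T => [|T IH]; first by rewrite big_ord1 add0n binn /hdim eqxx mulr1 ler1n.
rewrite big_ord_recr /= addSn binS natrD mulrDr.
apply: lerD => //; apply: le_trans (hdimS_le _) _.
by rewrite addSnnS.
Qed.

Lemma bin_le_expn n m : ('C(n, m) <= n ^ m)%N.
Proof.
apply: (@leq_trans ('C(n, m) * m`!)%N); first by rewrite leq_pmulr // fact_gt0.
rewrite bin_ffact; elim: m => [//|m IH].
by rewrite ffactnSr expnSr leq_mul // leq_subr.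
Qed.

(** By [qker_le] the kernel is at most a constant times h(0,d) + ... + h(2T,d), a sum of order
    T^(d-1); here d - 1 is [k.+1]. *)
Lemma Kminus_le : exists2 A : R, 0 < A & forall (chi : nat -> nat -> R) T x y,
  (forall n T, 0 <= chi n T <= 1) -> (0 < T)%N -> sphere x -> sphere y ->
  `|Kminus chi T x y| <= A * T%:R ^+ k.+1.
Proof.
set s := `|surf_area R (dimd k)|.
(* [k.+3] comes from 2T + k + 1 <= (k + 3) T for T >= 1; the added 1 makes the constant positive. *)
exists (2 * (k.+3)%:R ^+ k.+1 / s + 1).
  by rewrite ltr_wpDl // mulr_ge0 ?invr_ge0 ?normr_ge0 // mulr_ge0 // exprn_ge0.
move=> chi T x y chi01 T0 hx hy.
have step1 : `|Kminus chi T x y| <= (\sum_(n < (2 * T).+1) hdim R n (dimd k)) / s.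
  have -> : Kminus chi T x y = \sum_(n < (2 * T).+1) (if odd n then chi n (2 * T)%N * qker n x y else 0).
    rewrite /Kminus; pose F n := chi n (2 * T)%N * qker n x y.
    rewrite [RHS](eq_bigr (fun n : 'I_(2 * T).+1 => if odd n then F n else 0)) //.
    rewrite (eq_bigr (fun p : 'I_T => F (2 * p + 1)%N)) //; elim: T {T0 F} (F) => [|T IH] F; first by rewrite big_ord0 muln0 big_ord1.
    have -> : (2 * T.+1).+1 = (2 * T).+3 by lia.
    rewrite big_ord_recr /= IH [in RHS]big_ord_recr [in RHS]big_ord_recr /=.
    by rewrite oddM /= addr0 addn1.
  rewrite mulr_suml; apply: le_trans (ler_norm_sum _ _ _) _; apply: ler_sum => n _.
  have h0 : 0 <= hdim R n (dimd k) / s.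
    by apply: le_trans (qker_le n hx hy); rewrite normr_ge0.
  case: ifP => _; last by rewrite normr0.
  have /andP[c0 c1] := chi01 n (2 * T)%N.
  rewrite normrM (ger0_norm c0) -[leRHS]mul1r ler_pM //.
  exact: qker_le.
apply: le_trans step1 _.
have s2 : (\sum_(n < (2 * T).+1) hdim R n (dimd k)) <= 2 * ((k.+3)%:R * T%:R) ^+ k.+1.
  apply: le_trans (sum_hdim_le _) _; rewrite ler_wpM2l // -natrM -natrX ler_nat.
  apply: (@leq_trans ((2 * T + k.+1) ^ k.+1)%N); last by rewrite leq_exp2r //; nia.
  exact: bin_le_expn.
rewrite exprMn mulrA in s2.
apply: (@le_trans _ _ (2 * k.+3%:R ^+ k.+1 / s * T%:R ^+ k.+1)).
  by rewrite (mulrAC _ s^-1) ler_wpM2r // invr_ge0 normr_ge0.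
by rewrite ler_wpM2r ?exprn_ge0 // lerDl.
Qed.

End Geometry.

(** * Measurability and the equator *)

Section Measurability.
Variables (R : realType) (k : nat).
Notation V := (Vec R k).

Lemma measurable_coord (i : 'I_(dimd k)) : measurable_fun setT (fun x : V => x ord0 i).
Proof.
apply: (@measurability _ _ V R setT _ _ (RGenOInfty.measurableE R)) => _ [_ [a ->] <-].
apply: sub_sigma_algebra; rewrite setTI.
apply: (@open_comp _ _ (fun x : 'rV[R]_(dimd k) => x ord0 i)).
- by move=> x _; apply: coord_continuous.
- exact: interval_open.
Qed.

Lemma measurable_oppv : measurable_fun setT (fun x : V => (- x : V)).
Proof.
apply: (@measurability _ _ V V setT _ _ erefl) => _ [A oA <-].
apply: sub_sigma_algebra; rewrite setTI.
apply: (@open_comp _ _ (fun x : 'rV[R]_(dimd k) => - x)) => // x _.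
exact: opp_continuous.
Qed.

Lemma measurable_first : measurable_fun setT (@first R k).
Proof. exact: measurable_coord. Qed.

(** Only d = 2 needs care: there the formula goes through [acos], and measurability is derived from
    the Chebyshev recurrence on [-1, 1] together with constancy outside. *)
Lemma measurable_gegen d n : measurable_fun setT (@gegen R d n).
Proof.
have mX : forall m c, measurable_fun setT (fun t : R => (c * t) ^+ m).
  by move=> m c; apply: measurable_funX; apply: measurable_funM.
rewrite /gegen; case: (d == 2%N); last first.
  apply: measurable_sum => l; apply: measurable_funM => //.
case: (n == 0%N) => //; apply: measurable_funM => //.
(* [acos] picks an element of a preimage set, which is empty outside [-1, 1]; all such arguments
   thus share the value chosen at 2. *)
have acos_out t : ~~ (-1 <= t <= 1) -> acos t = acos 2 :> R.
  move=> ht; rewrite acos.unlock; congr (get _); apply/seteqP; split=> y [_ hy].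
    by move: ht; rewrite -hy cos_geN1 cos_le1.
  by have := cos_le1 y; rewrite hy; lra.
pose u m (t : R) := cos (m%:R * acos t).
have uE m : u m.+2 = fun t => if -1 <= t <= 1 then 2 * t * u m.+1 t - u m t else u m.+2 2.
  apply/funext => t; case: ifPn => [ht|/acos_out]; last by rewrite /u => ->.
  rewrite /u -[X in 2 * X * _](acosK ht); move: (acos t) => th.
  have -> : m.+2%:R * th = m.+1%:R * th + th by rewrite -nat1r; ring.
  have -> : m%:R * th = m.+1%:R * th - th by rewrite -nat1r; ring.
  by rewrite (cosD (_ * _)) (cosB (_ * _)); ring.
suff : measurable_fun setT (u n) /\ measurable_fun setT (u n.+1) by case.
have mI : measurable_fun setT (fun t : R => -1 <= t <= 1).
  apply: (measurable_fun_bool true); rewrite setTI.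
  by rewrite (_ : _ @^-1` _ = `[-1, 1]%classic).
elim: n => [|n [IH0 IH1]]; last first.
  split=> //; rewrite uE; apply: measurable_fun_ifT => //.
  apply: measurable_funB => //; apply: measurable_funM => //.
split.
  by rewrite (_ : u 0%N = cst 1) //; apply/funext => t; rewrite /u mul0r cos0.
rewrite (_ : u 1%N = fun t => if -1 <= t <= 1 then t else u 1%N 2).
  exact: measurable_fun_ifT.
by apply/funext => t; rewrite /u !mul1r; case: ifPn => [/acosK//|/acos_out ->].
Qed.

Variables (d : measure_display) (T : measurableType d).

Lemma measurable_dotv (f g : T -> V) : measurable_fun setT f -> measurable_fun setT g ->
  measurable_fun setT (fun t => dotv (f t) (g t)).
Proof.
move=> mf mg; apply: measurable_sum => i; apply: measurable_funM.
  exact: (measurableT_comp (measurable_coord i)).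
exact: (measurableT_comp (measurable_coord i)).
Qed.

Lemma measurable_qker n (f g : T -> V) : measurable_fun setT f -> measurable_fun setT g ->
  measurable_fun setT (fun t => qker n (f t) (g t)).
Proof.
move=> mf mg; apply: measurable_funM => //; apply: measurable_funM => //.
exact: (measurableT_comp (measurable_gegen _ _) (measurable_dotv mf mg)).
Qed.

Lemma measurable_Kker chi n (f g : T -> V) : measurable_fun setT f -> measurable_fun setT g ->
  measurable_fun setT (fun t => Kker chi n (f t) (g t)).
Proof.
move=> mf mg; apply: measurable_sum => i; apply: measurable_funM => //.
exact: measurable_qker.
Qed.

Lemma measurable_Kminus chi n (f g : T -> V) : measurable_fun setT f -> measurable_fun setT g ->
  measurable_fun setT (fun t => Kminus chi n (f t) (g t)).
Proof.
move=> mf mg; apply: measurable_sum => i; apply: measurable_funM => //.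
exact: measurable_qker.
Qed.
End Measurability.

(** * Consequences of rotation invariance *)

Section SurfaceMeasure.
Variables (R : realType) (k : nat).
Notation V := (Vec R k).

Lemma measurable_sphere : measurable (@sphere R k).
Proof.
rewrite (_ : @sphere R k = (fun x : V => dotv x x) @^-1` [set 1]).
  by rewrite -[X in measurable X]setTI; apply: measurable_dotv.
by apply/seteqP; split.
Qed.

Lemma measurable_first_ge0 : measurable [set x : V | 0 <= first x].
Proof.
rewrite (_ : [set _ | _] = @first R k @^-1` `[0, +oo[%classic).
  by rewrite -[X in measurable X]setTI; apply: measurable_first.
by apply/seteqP; split => x /=; rewrite in_itv /= andbT.
Qed.

Lemma measurable_first_eq0 : measurable [set x : V | first x = 0].
Proof.
rewrite (_ : [set _ | _] = @first R k @^-1` [set 0]) //.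
by rewrite -[X in measurable X]setTI; apply: measurable_first.
Qed.

(* Householder reflection exchanging the first basis vector and [u]. *)
Lemma orthogonal_first (u : V) : sphere u ->
  exists2 U : 'M[R]_(dimd k), orthogonal_mx U & forall x : V, first (x *m U : V) = dotv x u.
Proof.
rewrite /sphere /= => hu; pose e : V := delta_mx ord0 ord0.
have dote x : dotv x e = first x.
  rewrite /dotv (bigD1 ord0) //= big1 ?addr0 ?mxE ?eqxx ?mulr1 // => i i0.
  by rewrite mxE (negbTE i0) andbF mulr0.
have fe : first e = 1 by rewrite /first mxE !eqxx.
have [v vE] : exists v : V, v = e + - u by exists (e + - u).
pose w := dotv v v.
have wE : w = 2 * (1 - first u).
  by rewrite /w vE dotvDl !dotvDr !dotvNl !dotvNr hu dote (dotvC e) dote fe; ring.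
have [w0|w0] := eqVneq w 0.
  exists 1%:M => [|x]; first by rewrite /orthogonal_mx trmx1 mulmx1.
  have /eqP := dotv_eq0 w0; rewrite vE subr_eq0 => /eqP eu.
  by rewrite mulmx1 -eu dote.
pose U : 'M[R]_(dimd k) := 1%:M - (2 / w) *: ((v : 'rV_(dimd k))^T *m v).
have UT : U^T = U by rewrite /U linearB linearZ /= trmx1 trmx_mul trmxK.
have vv : (v : 'rV_(dimd k)) *m v^T = w%:M.
  by apply/matrixP => i j; rewrite !ord1 !mxE mulr1n; apply: eq_bigr => l _; rewrite !mxE.
exists U => [|x].
  rewrite /orthogonal_mx UT /U mulmxBl mul1mx mulmxBr mulmx1.
  rewrite -scalemxAl -scalemxAr mulmxA -(mulmxA v^T) vv mul_mx_scalar -scalemxAl !scalerA.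
  rewrite opprB -scalerBl.
  by rewrite (_ : 2 / w * (2 / w * w) - 2 / w = 2 / w) ?subrK //; field.
have xv : x *m (v : 'rV_(dimd k))^T = (dotv x v)%:M.
  by apply/matrixP => i j; rewrite !ord1 !mxE mulr1n; apply: eq_bigr => l _; rewrite !mxE.
rewrite /first mulmxBr mulmx1 -scalemxAr mulmxA xv mul_scalar_mx scalerA !mxE.
have fv : first v = 1 - first u by rewrite vE /first !mxE !eqxx.
have dxv : dotv x v = first x - dotv x u by rewrite vE dotvDr dotvNr dote.
rewrite -[x ord0 ord0]/(first x) -[v ord0 ord0]/(first v) dxv fv.
by rewrite wE; field; move: w0; rewrite wE mulf_eq0 negb_or => /andP[].
Qed.

Variable sigma : {measure set V -> \bar R}.
Hypothesis hs : is_surface_measure sigma.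

Lemma surface_setT : sigma setT = (surf_area R (dimd k))%:E.
Proof.
case: hs => h0 h1 _; have mS := measurable_sphere.
have := measureU sigma mS (measurableC mS) (setICr _); rewrite setUv => ->.
by apply: etrans (congr2 (fun a b : \bar R => a + b)%E h1 h0) _; rewrite adde0.
Qed.

Lemma surface_lty : (sigma setT < +oo)%E.
Proof. by rewrite surface_setT ltry. Qed.

Lemma ae_sphere : {ae sigma, forall x, sphere x}.
Proof.
exists (~` @sphere R k); split => //; first by apply: measurableC; exact: measurable_sphere.
by case: hs.
Qed.

Lemma surface_opp (A : set V) : measurable A -> sigma [set x : V | A (- x)] = sigma A.
Proof.
case: hs => _ _ h mA; rewrite -(h (- 1%:M) _ A mA).
  by congr (sigma _); apply/seteqP; split=> x /=; rewrite mulmxN mulmx1.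
by rewrite /orthogonal_mx linearN /= trmx1 mulmxN mulNmx mul1mx opprK.
Qed.

Let vandermonde_vec (j : nat) : V := \row_(i < dimd k) j%:R ^+ i.

Let vandermonde_neq0 j : dotv (vandermonde_vec j) (vandermonde_vec j) != 0.
Proof.
apply/eqP => /dotv_eq0 /(congr1 (fun x : V => first x)).
by rewrite /first !mxE expr0 => /eqP; rewrite oner_eq0.
Qed.

(** The hyperplane is the preimage of the equator under an orthogonal map built from its unit
    normal, and such maps preserve [sigma]. *)
Let vandermonde_meas j :
  sigma [set x : V | dotv x (vandermonde_vec j) = 0] = sigma [set x : V | first x = 0].
Proof.
set c := dotv (vandermonde_vec j) (vandermonde_vec j).
have c0 : 0 < c by rewrite lt_neqAle eq_sym vandermonde_neq0 dotv_ge0.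
have c1 : Num.sqrt c != 0 by rewrite gt_eqF // sqrtr_gt0.
pose u : V := (Num.sqrt c)^-1 *: vandermonde_vec j.
have hu : sphere u.
  rewrite /sphere /= /u dotvZr dotvC dotvZr -/c mulrA -invfM -expr2 sqr_sqrtr ?ltW //.
  by rewrite mulVf // gt_eqF.
have [U oU hU] := orthogonal_first hu.
case: hs => _ _ h; rewrite -(h U oU _ measurable_first_eq0); congr (sigma _).
apply/seteqP; split=> x /=; rewrite hU /u dotvZr; first by move=> ->; rewrite mulr0.
by move=> /eqP; rewrite mulf_eq0 invr_eq0 (negbTE c1) /= => /eqP.
Qed.

(** Pairing x with (1, j, j^2, ...) evaluates at j the polynomial whose coefficients are the
    coordinates of x; it is nonzero of degree less than d, so it has fewer than d roots. *)
Let vandermonde_count m x : sphere x ->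
  \sum_(j < m) (\1_[set x : V | dotv x (vandermonde_vec j) = 0] x : R) <= (dimd k)%:R.
Proof.
move=> hx; pose p : {poly R} := \poly_(i < dimd k) x ord0 (inord i).
have p0 : p != 0.
  apply/eqP => p0; suff x0 : x = 0.
    move: hx; rewrite x0 /sphere /= /dotv big1 => [/esym/eqP|i _]; last by rewrite mxE mul0r.
    by rewrite oner_eq0.
  apply/rowP => i; have := congr1 (fun q : {poly R} => q`_i) p0.
  by rewrite coef_poly ltn_ord inord_val coef0 mxE.
have pE j : p.[j%:R] = dotv x (vandermonde_vec j).
  rewrite horner_poly; apply: eq_bigr => i _; rewrite !mxE inord_val //.
pose s := [seq (j : nat)%:R : R | j <- iota 0 m & root p j%:R].
have us : uniq s.
  rewrite map_inj_uniq ?filter_uniq ?iota_uniq // => a b /eqP.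
  by rewrite eqr_nat => /eqP.
have rs : all (root p) s by apply/allP => z /mapP[j]; rewrite mem_filter => /andP[hj _] ->.
have := max_poly_roots p0 rs us => /leq_trans/(_ (size_poly _ _)) sz.
apply: (@le_trans _ _ (size s)%:R); last by rewrite ler_nat ltnW.
rewrite size_map size_filter -sum1_count natr_sum [leRHS]big_mkcond /=.
rewrite -(big_mkord xpredT (fun j => \1_[set x : V | dotv x (vandermonde_vec j) = 0] x)).
rewrite /index_iota subn0; apply: ler_sum => j _.
rewrite indicE; case: ifPn => hj; first by case: (_ \in _).
rewrite memNset // => /=; rewrite -pE => h; move: hj; by rewrite /root h eqxx.
Qed.

(* The normals on the moment curve are in general position: a point of the
   sphere lies on fewer than [dimd k] of the corresponding hyperplanes. *)
Lemma surface_equator : sigma [set x : V | first x = 0] = 0%E.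
Proof.
set c := sigma _; have c0 : (0 <= c)%E by exact: measure_ge0.
have mj j : measurable [set x : V | dotv x (vandermonde_vec j) = 0].
  rewrite (_ : [set _ | _] = (fun x : V => dotv x (vandermonde_vec j)) @^-1` [set 0]) //.
  by rewrite -[X in measurable X]setTI; apply: measurable_dotv.
(* Integrates the number of hyperplanes through a point: m hyperplanes of equal measure c overlap at
   most d times, so m c stays bounded as m grows. *)
have key m : (m%:R%:E * c <= (dimd k)%:R%:E * (surf_area R (dimd k))%:E)%E.
  have -> : (m%:R%:E * c = \int[sigma]_x (\sum_(j < m) (\1_[set x : V | dotv x (vandermonde_vec j) = 0] x : R)%:E))%E.
    rewrite ge0_integral_sum //; last first.
      by move=> j; apply/measurable_EFinP; exact: measurable_indic.
    rewrite (eq_bigr (fun=> c)); last first.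
      by move=> j _; rewrite integral_indic // setIT vandermonde_meas.
    by rewrite sumr_const card_ord mule_natl.
  rewrite -surface_setT -integral_cst //; apply: ae_ge0_le_integral => //.
  - by move=> x _; apply: sume_ge0.
  - by apply: emeasurable_sum => j; apply/measurable_EFinP; exact: measurable_indic.
  - by move=> x _; rewrite lee_fin.
  - apply: filterS ae_sphere => x hx _; rewrite sumEFin lee_fin; exact: vandermonde_count.
have cfin : c \is a fin_num.
  rewrite ge0_fin_numE //; apply: le_lt_trans (le_measure _ _ _ (@subsetT _ _)) _; rewrite ?inE //.
    exact: measurable_first_eq0.
  exact: surface_lty.
move: key c0; rewrite -(fineK cfin); move: (fine c) => r key; rewrite lee_fin => r0.
apply/eqP; rewrite eqe eq_le r0 andbT leNgt; apply/negP => rp.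
set D := (dimd k)%:R * surf_area R (dimd k).
have [m hm] : exists m : nat, D / r < m%:R.
  by exists (Num.bound `|D / r|); exact: le_lt_trans (ler_norm _) (archi_boundP (normr_ge0 _)).
have := key m; rewrite -!EFinM lee_fin leNgt => /negP; apply.
by rewrite -ltr_pdivrMr.
Qed.

End SurfaceMeasure.

(** * Densities and independence *)

Section Density.
Import HBNNSimple.
Context d (T : measurableType d) (R : realType) (dO : measure_display) (Omega : measurableType dO).
Variables (mu : {measure set T -> \bar R}) (P : {measure set Omega -> \bar R}).
Variables (X : Omega -> T) (rho : T -> R).
Hypothesis mX : measurable_fun setT X.
Hypothesis mrho : measurable_fun setT rho.
Hypothesis rho0 : forall x, 0 <= rho x.
Hypothesis lawX : forall A, measurable A -> P (X @^-1` A) = (\int[mu]_(x in A) (rho x)%:E)%E.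

Let law_nnsfun (h : {nnsfun T >-> R}) :
  (\int[P]_w (h (X w))%:E = \int[mu]_x ((h x)%:E * (rho x)%:E))%E.
Proof.
have mrhoE : measurable_fun setT (fun x => (rho x)%:E) by exact/measurable_EFinP.
have hE x : (h x)%:E = (\sum_(y \in range h) (y * \1_(h @^-1` [set y]) x)%:E)%E.
  by rewrite fsumEFin //= -fimfunE.
under eq_integral do rewrite hE.
under [RHS]eq_integral.
  move=> x _; rewrite hE ge0_mule_fsuml; last first.
    by move=> y; rewrite EFinM; exact: nnfun_muleindic_ge0.
  over.
rewrite ge0_integral_fsum //; first last.
- move=> y w _; rewrite lee_fin.
  have := nnfun_muleindic_ge0 h y (X w); by rewrite -EFinM lee_fin.
- move=> y; apply/measurable_EFinP; apply: measurable_funM => //.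
  exact: (measurableT_comp (measurable_indic _)).
rewrite ge0_integral_fsum //; first last.
- move=> y x _; apply: mule_ge0; last by rewrite lee_fin.
  by have := nnfun_muleindic_ge0 h y x; rewrite -EFinM.
- move=> y; apply: emeasurable_funM => //; apply/measurable_EFinP; apply: measurable_funM => //.
apply: eq_fsbigr => y /set_mem [x0 _ <-]; have y0 : 0 <= h x0 by [].
move: (h x0) y0 => {x0}y y0.
rewrite (eq_integral (fun w => y%:E * (\1_(X @^-1` (h @^-1` [set y])) w)%:E)%E) //.
have mA : measurable (h @^-1` [set y]) by exact: measurable_sfunP.
have mB : measurable (X @^-1` (h @^-1` [set y])) by rewrite -[X in measurable X]setTI; exact: mX.
rewrite ge0_integralZl_EFin //; last exact/measurable_EFinP/measurable_indic.
rewrite integral_indic // setIT lawX //.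
rewrite [RHS](eq_integral (fun x => y%:E * ((\1_(h @^-1` [set y]) x)%:E * (rho x)%:E))%E); last first.
  by move=> x _; rewrite EFinM muleA.
rewrite ge0_integralZl_EFin //; first last.
- apply: emeasurable_funM => //; exact/measurable_EFinP/measurable_indic.
- by move=> x _; rewrite mule_ge0 // lee_fin.
congr (_ * _)%E; rewrite integral_mkcond; apply: eq_integral => x _.
by rewrite patchE indicE; case: (_ \in _); rewrite ?mul1e ?mul0e.
Qed.

(** The law of X is given only on events, so the change of variables passes from indicators to
    simple functions and then to monotone limits. *)
Lemma ge0_integral_density (f : T -> \bar R) : measurable_fun setT f -> (forall x, 0 <= f x)%E ->
  (\int[P]_w f (X w) = \int[mu]_x (f x * (rho x)%:E))%E.
Proof.
move=> mf f0; pose f_ := nnsfun_approx measurableT mf.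
have mrhoE : measurable_fun setT (fun x => (rho x)%:E) by exact/measurable_EFinP.
have nd x : {homo (fun n => f_ n x) : n m / (n <= m)%N >-> n <= m}.
  by move=> n m nm; exact/lefP/nd_nnsfun_approx.
have cv x : (f_ n x)%:E @[n --> \oo] --> f x by exact: cvg_nnsfun_approx.
transitivity (limn (fun n => \int[P]_w (f_ n (X w))%:E)%E).
  rewrite -monotone_convergence //=.
  - by apply: eq_integral => w _; apply/esym/cvg_lim => //; exact: cv.
  - by move=> n; apply/measurable_EFinP; exact: measurableT_comp.
  - by move=> n w _; rewrite lee_fin.
  - by move=> w _ n m nm; rewrite lee_fin nd.
under eq_fun do rewrite law_nnsfun.
rewrite -monotone_convergence //=.
- apply: eq_integral => x _; apply/cvg_lim => //; apply: cvgeZr => //; exact: cv.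
- by move=> n; apply: emeasurable_funM => //; exact/measurable_EFinP.
- by move=> n x _; rewrite mule_ge0 // lee_fin.
- by move=> x _ n m nm; rewrite lee_wpmul2r ?lee_fin // nd.
Qed.
End Density.

(** * Independence of generated sigma-algebras *)

Section Independence.
Context (R : realType) (dO : measure_display) (Omega : measurableType dO).
Variable P : probability Omega R.

(** One half of the pi-lambda argument, with the event of [H] held fixed; since [H] is any family of
    events, the step can be repeated with the roles exchanged. *)
Lemma indep_sigma_l (G H : set (set Omega)) : setI_closed G -> G `<=` measurable ->
  (forall B, H B -> measurable B) ->
  (forall A B, G A -> H B -> P (A `&` B) = P A * P B)%E ->
  forall A B, <<s G >> A -> H B -> P (A `&` B) = (P A * P B)%E.
Proof.
move=> GI Gm Hm GH A B sA HB; have mB := Hm _ HB.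
have sm : <<s G >> `<=` measurable by apply: smallest_sub => //; exact: sigma_algebra_measurable.
pose Q := [set A | P (A `&` B) = (P A * P B)%E].
have fin C : measurable C -> P C \is a fin_num by move=> ?; exact: fin_num_measure.
apply: (@dynkin_induction _ (g_sigma_algebraType G) G Q) sA => //.
- by rewrite /Q /= setTI probability_setT mul1e.
- by move=> C GC; exact: GH.
- move=> C /sm mC; rewrite /Q /= => hC.
  have -> : ~` C `&` B = B `\` C by rewrite setDE setIC.
  have mD := measureD mB mC.
  have -> : P (B `\` C) = (P B - P (B `&` C))%E.
    by rewrite measureD // ltey_eq fin.
  rewrite setIC hC probability_setC // muleBl ?mul1e // ?fin_num_adde_defr //.
  by rewrite fin // .
- move=> F mF tF hF; rewrite /Q /= setI_bigcupl.
  have mF' n : measurable (F n : set Omega) by exact: (sm (F n) (mF n)).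
  rewrite measure_bigcup //; last 2 first.
  + by move=> n _; apply: measurableI.
  + exact: trivIset_setIr.
  rewrite [in RHS]measure_bigcup // muleC -[P B]fineK ?fin // -nneseriesZl; last by move=> *; exact: measure_ge0.
  by apply: eq_eseriesr => n _; rewrite fineK ?fin // muleC; exact: hF.
Qed.

Lemma indep_sigma (G H : set (set Omega)) : setI_closed G -> G `<=` measurable ->
  setI_closed H -> H `<=` measurable ->
  (forall A B, G A -> H B -> P (A `&` B) = P A * P B)%E ->
  forall A B, <<s G >> A -> <<s H >> B -> P (A `&` B) = (P A * P B)%E.
Proof.
move=> GI Gm HI Hm GH A B sA sB.
have sm : <<s G >> `<=` measurable by apply: smallest_sub => //; exact: sigma_algebra_measurable.
rewrite setIC muleC; apply: (@indep_sigma_l H <<s G>>) => // {A B sA sB} B A HB sA.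
by rewrite setIC muleC; apply: (@indep_sigma_l G H).
Qed.

Section Pair.
Context d1 d2 (T1 : measurableType d1) (T2 : measurableType d2).
Variables (f : Omega -> T1) (g : Omega -> T2).
Hypotheses (mf : measurable_fun setT f) (mg : measurable_fun setT g).
Hypothesis fg : forall A B, measurable A -> measurable B ->
  P (f @^-1` A `&` g @^-1` B) = (P (f @^-1` A) * P (g @^-1` B))%E.

(** The joint law factors on rectangles, hence is the product of the marginals by uniqueness, and
    Tonelli applies. *)
Lemma indep_integral (h : T1 * T2 -> \bar R) : measurable_fun setT h -> (forall z, 0 <= h z)%E ->
  (\int[P]_w h (f w, g w) = \int[P]_w \int[P]_w' h (f w, g w'))%E.
Proof.
move=> mh h0.
pose mF : {mfun Omega >-> T1} := HB.pack f (isMeasurableFun.Build _ _ _ _ f mf).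
pose mG : {mfun Omega >-> T2} := HB.pack g (isMeasurableFun.Build _ _ _ _ g mg).
pose mFG : {mfun Omega >-> (T1 * T2)%type} :=
  HB.pack (fun w => (f w, g w)) (isMeasurableFun.Build _ _ _ _ _ (measurable_fun_pair mf mg)).
transitivity (\int[distribution P mFG]_z h z)%E.
  by rewrite ge0_integral_distribution.
transitivity (\int[(distribution P mF \x distribution P mG)%E]_z h z)%E.
  by apply: eq_measure_integral => A mA _; apply/esym; apply: product_measure_unique.
rewrite fubini_tonelli1 // ge0_integral_distribution //; last 2 first.
- by apply: measurable_fun_fubini_tonelli_F.
- by move=> x; apply: integral_ge0.
apply: eq_integral => w _; rewrite /= /fubini_F ge0_integral_distribution //.
exact: measurableT_comp.
Qed.
End Pair.

Lemma indep_integralM (X Y : Omega -> R) : measurable_fun setT X -> measurable_fun setT Y ->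
  (forall w, 0 <= X w) -> (forall w, 0 <= Y w) ->
  (forall A B, measurable A -> measurable B ->
    P (X @^-1` A `&` Y @^-1` B) = P (X @^-1` A) * P (Y @^-1` B))%E ->
  (\int[P]_w (X w * Y w)%:E = (\int[P]_w (X w)%:E) * (\int[P]_w (Y w)%:E))%E.
Proof.
move=> mX mY X0 Y0 XY.
(* Absolute values make the integrand nonnegative on the whole plane, as Tonelli requires, without
   changing it along (X, Y). *)
have := @indep_integral _ _ _ _ X Y mX mY XY (fun z => (`|z.1| * `|z.2|)%:E) _ _.
rewrite (eq_integral (fun w => (X w * Y w)%:E)); last first.
  by move=> w _ /=; rewrite !ger0_norm.
move=> -> //; last first.
  apply/measurable_EFinP; apply: measurable_funM; exact: measurableT_comp.
have YY : (\int[P]_w' (`|Y w'|)%:E)%E = (\int[P]_w (Y w)%:E)%E.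
  by apply: eq_integral => w _; rewrite ger0_norm.
rewrite (eq_integral (fun w => (X w)%:E * (\int[P]_w (Y w)%:E))%E); last first.
  move=> w _ /=; under eq_integral do rewrite EFinM.
  rewrite ge0_integralZl_EFin //; first by rewrite YY ger0_norm.
  by apply/measurable_EFinP; exact: measurableT_comp.
rewrite ge0_integralZr //; first exact/measurable_EFinP.
  by move=> w _; rewrite lee_fin.
by apply: integral_ge0 => w _; rewrite lee_fin.
Qed.
End Independence.

(** * Exponential moments of i.i.d. sums *)

Section MutualIndependence.
Context (R : realType) (k : nat) (dO : measure_display) (Omega : measurableType dO).
Variable P : probability Omega R.
Notation V := (Vec R k).
Variables (I : eqType) (Z : I -> Omega -> V).
Hypothesis mZ : forall i, measurable_fun setT (Z i).
Hypothesis hZ : mutually_independent P Z.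

(** Cylinder events on the coordinates in [s]. They form a pi-system, and measurability with respect
    to the sigma-algebra they generate expresses dependence on these coordinates only. *)
Definition rectangles (s : seq I) : set (set Omega) :=
  [set E | exists2 A : I -> set V, (forall i, measurable (A i)) &
           E = \bigcap_(i in [set` s]) (Z i @^-1` A i)].

Lemma rectangles_setI s : setI_closed (rectangles s).
Proof.
move=> _ _ [A mA ->] [B mB ->]; exists (fun i => A i `&` B i).
  by move=> i; apply: measurableI.
by rewrite -bigcapI; apply: eq_bigcapr => i _; rewrite preimage_setI.
Qed.

Lemma rectangles_measurable s : rectangles s `<=` measurable.
Proof.
move=> _ [A mA ->]; apply: fin_bigcap_measurable; first exact: finite_seq.
by move=> i _; rewrite -[X in measurable X]setTI; exact: mZ.
Qed.

Lemma measurable_rectangles s i : i \in s ->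
  measurable_fun setT (Z i : g_sigma_algebraType (rectangles s) -> V).
Proof.
move=> si _ A mA; rewrite setTI; apply: sub_sigma_algebra.
exists (fun j => if j == i then A else setT); first by move=> j; case: eqP.
apply/seteqP; split=> [w Aw j _ /=|w /(_ i si)]; last by rewrite /= eqxx.
by case: eqP => // ->.
Qed.

(** Disjointness of the index lists lets the two families of sets be glued into one, to which mutual
    independence applies. *)
Lemma rectangles_indep s1 s2 : uniq (s1 ++ s2) -> forall A B,
  rectangles s1 A -> rectangles s2 B -> P (A `&` B) = (P A * P B)%E.
Proof.
move=> us _ _ [A mA ->] [B mB ->].
move: (us); rewrite cat_uniq => /and3P[u1 /hasPn h12 u2].
pose C j := if j \in s1 then A j else B j.
have mC j : measurable (C j) by rewrite /C; case: ifP.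
have -> : \bigcap_(i in [set` s1]) (Z i @^-1` A i) `&` \bigcap_(i in [set` s2]) (Z i @^-1` B i) =
          \bigcap_(i in [set` s1 ++ s2]) (Z i @^-1` C i).
  apply/seteqP; split=> [w [h1 h2] j /= | w h].
    rewrite mem_cat /C; case: ifPn => [j1 _|j1 /= j2]; [exact: h1|exact: h2].
  split=> j js /=; have := h j; rewrite /= mem_cat js ?orbT /C => /(_ isT); first by rewrite ifT.
  by rewrite ifN //; exact: h12.
rewrite !hZ // big_cat /=; congr (_ * _)%E.
  by apply: eq_big_seq => j js; rewrite /C ifT.
by apply: eq_big_seq => j js; rewrite /C ifN //; exact: h12.
Qed.

Lemma mutual_indep_pair s1 s2 d1 d2 (T1 : measurableType d1) (T2 : measurableType d2)
   (f : Omega -> T1) (g : Omega -> T2) : uniq (s1 ++ s2) ->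
  measurable_fun setT (f : g_sigma_algebraType (rectangles s1) -> T1) ->
  measurable_fun setT (g : g_sigma_algebraType (rectangles s2) -> T2) ->
  forall A B, measurable A -> measurable B ->
  P (f @^-1` A `&` g @^-1` B) = (P (f @^-1` A) * P (g @^-1` B))%E.
Proof.
move=> us mf mg A B mA mB.
apply: (@indep_sigma _ _ _ P (rectangles s1) (rectangles s2)).
- exact: rectangles_setI.
- exact: rectangles_measurable.
- exact: rectangles_setI.
- exact: rectangles_measurable.
- exact: rectangles_indep.
- by have := mf measurableT _ mA; rewrite setTI.
- by have := mg measurableT _ mB; rewrite setTI.
Qed.

End MutualIndependence.

Section ExpInequalities.
Variable R : realType.
Implicit Types x y : R.

(** From (1 - y) e^y <= 1 and (1 - y)(1 + y + 2 y^2) = 1 + y^2 (1 - 2 y). *)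
Lemma expR_le_quad y : y <= 1 / 2 -> expR y <= 1 + y + 2 * y ^+ 2.
Proof.
move=> y2; have h : 0 < 1 - y by lra.
have h1 : 1 - y <= expR (- y) by have := expR_ge1Dx (- y).
rewrite expRN in h1; have e0 := expR_gt0 y.
have h2 : (1 - y) * expR y <= 1 by rewrite -ler_pdivlMr // mul1r.
rewrite -(ler_pM2l h); apply: le_trans h2 _.
rewrite -subr_ge0 [leRHS](_ : _ = y ^+ 2 * (1 - 2 * y)); last by ring.
by rewrite mulr_ge0 ?sqr_ge0 //; lra.
Qed.

(** Lets a second moment be read off the two-sided exponential moment; the factor 4 comes from y/2
    <= e^(y/2). *)
Lemma sqr_le_expR y : y ^+ 2 <= 4 * (expR y + expR (- y)).
Proof.
wlog y0 : y / 0 <= y.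
  move=> h; have [/h//|yn] := leP 0 y.
  by have := h (- y); rewrite sqrrN opprK addrC; apply; lra.
have h : y / 2 <= expR (y / 2) by have := expR_ge1Dx (y / 2); lra.
have h2 : (y / 2) ^+ 2 <= expR y.
  rewrite [in leRHS](_ : y = y / 2 + y / 2); last by field.
  by rewrite expRD -expr2 lerXn2r // nnegrE ?expR_ge0 //; lra.
have h3 := expR_gt0 (- y).
rewrite [leLHS](_ : _ = 4 * (y / 2) ^+ 2); last by field.
by rewrite ler_pM2l //; lra.
Qed.

Lemma expR_abs_le t y : t <= `|y| -> expR t <= expR y + expR (- y).
Proof.
move=> ty; apply: (@le_trans _ _ (expR `|y|)); first by rewrite ler_expR.
have h1 := expR_gt0 y; have h2 := expR_gt0 (- y).
by case: (leP 0 y) => h; rewrite ?(ger0_norm h) ?(ltr0_norm h); lra.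
Qed.
End ExpInequalities.

(** * Bernstein-type bounds for sums over the sample *)

Section Concentration.
Context (R : realType) (k : nat) (dO : measure_display) (Omega : measurableType dO).
Variable P : probability Omega R.
Notation V := (Vec R k).
Variable Z : nat -> bool -> Omega -> V.
Hypothesis mZ : forall i b, measurable_fun setT (Z i b).
Hypothesis hZ : mutually_independent P (fun ib : nat * bool => Z ib.1 ib.2).

Let idx n := [seq (i, b) | i <- iota 0 n, b <- [:: true; false]].
Let idx_uniq n : uniq (idx n ++ [:: (n, true); (n, false)]).
Proof.
have -> : idx n ++ [:: (n, true); (n, false)] = idx n.+1.
  by rewrite /idx -[in RHS]addn1 iotaD map_cat flatten_cat.
by apply: allpairs_uniq => //; [exact: iota_uniq|move=> [? ?] [? ?] _ _].
Qed.

Let mZ' (ib : nat * bool) : measurable_fun setT (Z ib.1 ib.2) := mZ ib.1 ib.2.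

Lemma integral_cst_prob (c : R) : (\int[P]_w c%:E = c%:E)%E.
Proof.
transitivity (c%:E * P setT)%E; first exact: integral_cst.
by rewrite probability_setT mule1.
Qed.

Lemma sample_indep i (A B : set V) : measurable A -> measurable B ->
  P (Z i false @^-1` A `&` Z i true @^-1` B) =
  (P (Z i false @^-1` A) * P (Z i true @^-1` B))%E.
Proof.
move=> mA mB; apply: (@mutual_indep_pair _ _ _ _ P _ _ mZ' hZ [:: (i, false)] [:: (i, true)]) => //.
- by rewrite /= inE xpair_eqE andbF.
- by apply: (@measurable_rectangles _ _ _ _ _ (fun ib : nat * bool => Z ib.1 ib.2) _ (i, false)); rewrite inE.
- by apply: (@measurable_rectangles _ _ _ _ _ (fun ib : nat * bool => Z ib.1 ib.2) _ (i, true)); rewrite inE.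
Qed.

Variable phi : V * V -> R.
Hypothesis mphi : measurable_fun setT phi.

Definition sample_sum n w := \sum_(i < n) phi (Z i false w, Z i true w).

Let mW i : measurable_fun setT (fun w => phi (Z i false w, Z i true w)).
Proof. by apply: (measurableT_comp mphi); apply: measurable_fun_pair. Qed.

Lemma measurable_sample_sum n : measurable_fun setT (sample_sum n).
Proof. by apply: measurable_sum => i; exact: mW. Qed.

(** The new factor depends on the pair of index n alone and the previous ones on [idx n]; these
    index lists are disjoint, so the expectation factorises at each step. *)
Lemma expR_sample_sum (l M : R) n : 
  (forall i, \int[P]_w (expR (l * phi (Z i false w, Z i true w)))%:E <= M%:E)%E ->
  (\int[P]_w (expR (l * sample_sum n w))%:E <= (M ^+ n)%:E)%E.
Proof.
move=> hM; have M0 : 0 <= M.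
  by rewrite -lee_fin; apply: le_trans (hM 0%N); apply: integral_ge0 => w _; rewrite lee_fin expR_ge0.
elim: n => [|n IH].
  rewrite (eq_integral (fun=> 1%:E)); first by rewrite integral_cst_prob.
  by move=> w _; rewrite /sample_sum big_ord0 mulr0 expR0.
rewrite (eq_integral (fun w => (expR (l * sample_sum n w) *
   expR (l * phi (Z n false w, Z n true w)))%:E)); last first.
  by move=> w _; rewrite /sample_sum big_ord_recr /= mulrDr expRD.
have mE d (T : measurableType d) (f : T -> R) : measurable_fun setT f ->
    measurable_fun setT (fun w => expR (l * f w)).
  by move=> mf; apply: (measurableT_comp (@measurable_expR R)); apply: measurable_funM.
rewrite (indep_integralM (P := P)).
- rewrite exprSr EFinM; apply: lee_pmul => //; apply: integral_ge0 => w _; rewrite lee_fin expR_ge0 //.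
- by apply: mE; exact: measurable_sample_sum.
- exact: mE.
- by move=> w; exact: expR_ge0.
- by move=> w; exact: expR_ge0.
apply: (mutual_indep_pair mZ' hZ (idx_uniq n)).
- apply: mE; apply: measurable_sum => i; apply: (measurableT_comp mphi).
  have hi b : (nat_of_ord i, b) \in idx n.
    by apply/allpairsP; exists (nat_of_ord i, b); rewrite mem_iota ltn_ord; case: b.
  apply: measurable_fun_pair.
    by apply: (@measurable_rectangles _ _ _ _ _ (fun ib : nat * bool => Z ib.1 ib.2) _ (nat_of_ord i, false)).
  by apply: (@measurable_rectangles _ _ _ _ _ (fun ib : nat * bool => Z ib.1 ib.2) _ (nat_of_ord i, true)).
- apply: mE; apply: (measurableT_comp mphi).
  apply: measurable_fun_pair.
    apply: (@measurable_rectangles _ _ _ _ _ (fun ib : nat * bool => Z ib.1 ib.2) _ (n, false)).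
    by rewrite !inE eqxx orbT.
  apply: (@measurable_rectangles _ _ _ _ _ (fun ib : nat * bool => Z ib.1 ib.2) _ (n, true)).
  by rewrite !inE eqxx.
Qed.

Variables b v : R.
Hypothesis phib : forall i w, `|phi (Z i false w, Z i true w)| <= b.
Hypothesis phi0 : forall i, (\int[P]_w (phi (Z i false w, Z i true w))%:E = 0)%E.
Hypothesis phiv : forall i, (\int[P]_w (phi (Z i false w, Z i true w) ^+ 2)%:E <= v%:E)%E.

Let bounded_integrable (Y : Omega -> R) (c : R) : measurable_fun setT Y -> (forall w, `|Y w| <= c) ->
  P.-integrable setT (EFin \o Y).
Proof.
move=> mY Yc; apply: measurable_bounded_integrable => //.
  exact: le_lt_trans (probability_le1 P measurableT) (ltry _).
exists c; split; first exact: num_real.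
by move=> x cx w _ /=; apply: le_trans (Yc w) (ltW _).
Qed.

(** Centring removes the linear term of the quadratic bound on exp, and 1 + x <= e^x turns the rest
    back into an exponential. The constraint on [l] keeps the argument of exp at most 1/2. *)
Lemma mgf_le (l : R) i : `|l| * b <= 1 / 2 ->
  (\int[P]_w (expR (l * phi (Z i false w, Z i true w)))%:E <= (expR (2 * l ^+ 2 * v))%:E)%E.
Proof.
move=> lb; pose Y w := phi (Z i false w, Z i true w).
have mY : measurable_fun setT Y := mW i.
have Yb w : `|Y w| <= b by exact: phib.
have b0 : 0 <= b by have := Yb point; exact: le_trans.
have iY : P.-integrable setT (EFin \o (fun w => l * Y w)).
  apply: (@bounded_integrable _ (`|l| * b)); first exact: measurable_funM.
  by move=> w; rewrite normrM ler_wpM2l.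
have iY2 : P.-integrable setT (EFin \o (fun w => 2 * l ^+ 2 * Y w ^+ 2)).
  apply: (@bounded_integrable _ (2 * l ^+ 2 * b ^+ 2)).
    by apply: measurable_funM => //; exact: measurable_funX.
  have c0 : 0 <= 2 * l ^+ 2 by rewrite mulr_ge0 ?sqr_ge0.
  move=> w; rewrite normrM (ger0_norm c0) ler_wpM2l //.
  by rewrite normrX lerXn2r // nnegrE.
have i1 : P.-integrable setT (EFin \o (fun w : Omega => 1 + l * Y w)).
  have h1 : P.-integrable setT (EFin \o (fun w : Omega => 1 : R)) by apply: (@bounded_integrable _ 1) => // w; rewrite normr1.
  by have := integrableD measurableT h1 iY; apply: eq_integrable.
have iYE : (\int[P]_w (l * Y w)%:E = 0)%E.
  under eq_integral do rewrite EFinM.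
  rewrite integralZl //; first by rewrite phi0 mule0.
  exact: (@bounded_integrable _ b).
apply: (@le_trans _ _ (\int[P]_w (1 + l * Y w + 2 * l ^+ 2 * Y w ^+ 2)%:E)%E).
  apply: ge0_le_integral => //.
  - apply/measurable_EFinP; apply: (measurableT_comp (@measurable_expR R)); exact: measurable_funM.
  - apply/measurable_EFinP; apply: measurable_funD; first by apply: measurable_funD => //; exact: measurable_funM.
    by apply: measurable_funM => //; exact: measurable_funX.
  - move=> w _; rewrite lee_fin [leRHS](_ : _ = 1 + l * Y w + 2 * (l * Y w) ^+ 2); last by ring.
    apply: expR_le_quad; apply: le_trans lb; apply: le_trans (ler_norm _) _.
    by rewrite normrM ler_wpM2l.
have -> : (\int[P]_w (1 + l * Y w + 2 * l ^+ 2 * Y w ^+ 2)%:E =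
   1 + (2 * l ^+ 2)%:E * \int[P]_w (Y w ^+ 2)%:E)%E.
  under eq_integral do rewrite EFinD.
  rewrite integralD_EFin //; congr (_ + _)%E.
    under eq_integral do rewrite /= EFinD.
    rewrite integralD_EFin //; last by apply: (@bounded_integrable _ 1) => // w; rewrite normr1.
    by rewrite iYE adde0 integral_cst_prob.
  under eq_integral do rewrite /= EFinM.
  rewrite ge0_integralZl_EFin //.
  - by move=> w _; rewrite lee_fin sqr_ge0.
  - by apply/measurable_EFinP; exact: measurable_funX.
  - by rewrite mulr_ge0 ?sqr_ge0.
apply: (@le_trans _ _ (1 + (2 * l ^+ 2)%:E * v%:E)%E).
  apply: leeD2l; apply: lee_wpmul2l; last exact: phiv.
  by rewrite lee_fin mulr_ge0 ?sqr_ge0.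
by rewrite -EFinM -EFinD lee_fin expR_ge1Dx.
Qed.

Let sum_expR (l : R) n : `|l| * b <= 1 / 2 ->
  (\int[P]_w (expR (l * sample_sum n w) + expR (- (l * sample_sum n w)))%:E
    <= (2 * expR (2 * l ^+ 2 * v * n%:R))%:E)%E.
Proof.
move=> lb; have mS := measurable_sample_sum n.
have mE c : measurable_fun setT (fun w => (expR (c * sample_sum n w))%:E).
  apply/measurable_EFinP; apply: (measurableT_comp (@measurable_expR R)); exact: measurable_funM.
rewrite (eq_integral (fun w => (expR (l * sample_sum n w))%:E + (expR (- l * sample_sum n w))%:E)%E); last first.
  by move=> w _; rewrite EFinD mulNr.
rewrite ge0_integralD //; try by move=> w _; rewrite lee_fin expR_ge0.
rewrite mulr_natl mulr2n EFinD; apply: leeD.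
  rewrite mulrC expRM_natl; apply: expR_sample_sum => i; exact: mgf_le.
rewrite mulrC expRM_natl -sqrrN; apply: expR_sample_sum => i; apply: mgf_le.
by rewrite normrN.
Qed.

(** Markov's inequality for e^(lS) + e^(-lS), which treats both tails at once; [l] stays free until
    the variance and the deviation are known. *)
Lemma sample_sum_tail (l t : R) n : 0 <= l -> l * b <= 1 / 2 ->
  (P [set w | (t <= `|sample_sum n w|)%R ] <= (2 * expR (2 * l ^+ 2 * v * n%:R - l * t))%:E)%E.
Proof.
move=> l0 lb; have mS := measurable_sample_sum n.
have mA : measurable [set w | t <= `|sample_sum n w| ].
  rewrite (_ : [set _ | _] = (fun w => `|sample_sum n w|) @^-1` `[t, +oo[%classic).
    by rewrite -[X in measurable X]setTI; apply: (measurableT_comp _ mS).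
  by apply/seteqP; split => w /=; rewrite in_itv /= andbT.
set A := [set w | _] in mA *.
have h : ((expR (l * t))%:E * P A <= (2 * expR (2 * l ^+ 2 * v * n%:R))%:E)%E.
  have lb' : `|l| * b <= 1 / 2 by rewrite ger0_norm.
  apply: le_trans (sum_expR n lb').
  rewrite -(setIT A) -integral_indic // -ge0_integralZl_EFin ?expR_ge0 //; last first.
    by apply/measurable_EFinP; exact: measurable_indic.
  apply: ge0_le_integral => //.
  - by apply: measurable_funeM; apply/measurable_EFinP; exact: measurable_indic.
  - apply/measurable_EFinP; apply: measurable_funD; apply: (measurableT_comp (@measurable_expR R)).
      exact: measurable_funM.
    by apply: measurableT_comp => //; exact: measurable_funM.
  - move=> w _; rewrite -EFinM lee_fin indicE; case: (boolP (w \in A)) => [|_].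
      rewrite inE /A /= => tw; rewrite mulr1; apply: expR_abs_le.
      by rewrite normrM ger0_norm // ler_wpM2l.
    by rewrite mulr0 addr_ge0 // expR_ge0.
have fA : P A \is a fin_num by exact: fin_num_measure.
rewrite -(fineK fA) -EFinM !lee_fin in h *.
by rewrite expRD expRN mulrA ler_pdivlMr ?expR_gt0 // mulrC.
Qed.

(** The same moment bounds S^2 through [sqr_le_expR], in place of an expansion into covariances; at
    [l] of order (v n)^(-1/2) the result is of order v n. *)
Lemma sample_sum_sqr (l : R) n : 0 < l -> l * b <= 1 / 2 ->
  (\int[P]_w (sample_sum n w ^+ 2)%:E <= (8 / l ^+ 2 * expR (2 * l ^+ 2 * v * n%:R))%:E)%E.
Proof.
move=> l0 lb; have mS := measurable_sample_sum n.
have lb' : `|l| * b <= 1 / 2 by rewrite gtr0_norm.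
have c0 : 0 <= 4 / l ^+ 2 by rewrite divr_ge0 // sqr_ge0.
have -> : (8 / l ^+ 2 * expR (2 * l ^+ 2 * v * n%:R))%:E =
   ((4 / l ^+ 2)%:E * (2 * expR (2 * l ^+ 2 * v * n%:R))%:E)%E.
  by rewrite -EFinM; congr EFin; rewrite [RHS]mulrA; congr (_ * _); field; rewrite gt_eqF.
apply: le_trans (lee_wpmul2l _ (sum_expR n lb')); last by rewrite lee_fin.
have mE : measurable_fun setT (fun w => (expR (l * sample_sum n w) + expR (- (l * sample_sum n w)))%:E).
  apply/measurable_EFinP; apply: measurable_funD; apply: (measurableT_comp (@measurable_expR R)).
    exact: measurable_funM.
  by apply: measurableT_comp => //; exact: measurable_funM.
rewrite -ge0_integralZl_EFin //.
apply: ge0_le_integral => //.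
- by move=> w _; rewrite lee_fin sqr_ge0.
- by apply/measurable_EFinP; exact: measurable_funX.
- exact: measurable_funeM.
move=> w _; rewrite -EFinM lee_fin.
have := sqr_le_expR (l * sample_sum n w); rewrite exprMn => h.
rewrite (mulrC 4) -mulrA mulrC ler_pdivlMr ?exprn_gt0 // mulrC //.
Qed.
End Concentration.

(** * Integrals and norms on the sphere *)

Section SphereIntegrals.
Variables (R : realType) (k : nat).
Notation V := (Vec R k).
Variable sigma : {measure set V -> \bar R}.
Hypothesis hs : is_surface_measure sigma.

(** The type of [sigma] carries no finiteness, which Tonelli needs; its total mass is finite, so it
    coincides with a packed finite measure. *)
Lemma surface_finite_measure :
  exists sF : {finite_measure set V -> \bar R}, forall A, sF A = sigma A.
Proof.
exists (mfrestr measurableT (surface_lty hs)) => A.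
by change (sigma (A `&` setT) = sigma A); rewrite setIT.
Qed.

(** The antisymmetry of R is available off the equator; by this lemma later comparisons of integrals
    and norms need checking only there. *)
Lemma ae_surface (Q : V -> Prop) : (forall x, sphere x -> first x != 0 -> Q x) ->
  {ae sigma, forall x, Q x}.
Proof.
move=> h; have h1 : {ae sigma, forall x, sphere x} := ae_sphere hs.
have h2 : {ae sigma, forall x, first x != 0}.
  exists [set x : V | first x = 0]; split; [exact: measurable_first_eq0|exact: surface_equator|].
  by move=> x /= /negP; rewrite negbK => /eqP.
by apply: filterS2 h1 h2 => x; exact: h.
Qed.

Lemma surface_ge0 : 0 <= surf_area R (dimd k).
Proof. by rewrite -lee_fin -(surface_setT hs). Qed.

Section Tonelli.
Context d1 (T1 : measurableType d1).

Lemma measurable_surface_integral (f : T1 * V -> \bar R) : measurable_fun setT f ->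
  (forall z, 0 <= f z)%E -> measurable_fun setT (fun x => \int[sigma]_y f (x, y))%E.
Proof.
move=> mf f0; have [sF sFE] := surface_finite_measure.
have E (h : V -> \bar R) : (\int[sF]_y h y = \int[sigma]_y h y)%E.
  by apply: eq_measure_integral => A _ _; exact: sFE.
have := @measurable_fun_fubini_tonelli_F _ _ _ _ _ sF f mf f0.
by apply: eq_measurable_fun => x _; exact: E.
Qed.

Lemma surface_tonelli (m1 : {sigma_finite_measure set T1 -> \bar R}) (f : T1 * V -> \bar R) :
  measurable_fun setT f -> (forall z, 0 <= f z)%E ->
  (\int[m1]_x \int[sigma]_y f (x, y) = \int[sigma]_y \int[m1]_x f (x, y))%E.
Proof.
move=> mf f0; have [sF sFE] := surface_finite_measure.
have E (h : V -> \bar R) : (\int[sF]_y h y = \int[sigma]_y h y)%E.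
  by apply: eq_measure_integral => A _ _; exact: sFE.
rewrite -E -(@fubini_tonelli _ _ _ _ _ m1 sF f mf f0); by apply: eq_integral => x _; rewrite E.
Qed.

(** The real-valued integral is [fine] of the difference of the integrals of the positive and
    negative parts, each measurable by Tonelli. *)
Lemma measurable_surface_Rintegral (f : T1 * V -> R) : measurable_fun setT f ->
  measurable_fun setT (fun x => \int[sigma]_y f (x, y)).
Proof.
move=> mf; rewrite /Rintegral.
have mp : measurable_fun setT (fun x => \int[sigma]_y ((EFin \o f)^\+ (x, y)))%E.
  apply: measurable_surface_integral; first by apply: measurable_funepos; exact/measurable_EFinP.
  by move=> z; exact: funepos_ge0.
have mn : measurable_fun setT (fun x => \int[sigma]_y ((EFin \o f)^\- (x, y)))%E.
  apply: measurable_surface_integral; first by apply: measurable_funeneg; exact/measurable_EFinP.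
  by move=> z; exact: funeneg_ge0.
apply: (measurableT_comp (@fine_measurable R setT measurableT)) => //.
rewrite (_ : (fun x => _) = (fun x => (\int[sigma]_y ((EFin \o f)^\+ (x, y))) -
   (\int[sigma]_y ((EFin \o f)^\- (x, y)))))%E; first exact: emeasurable_funB.
apply/funext => x; rewrite integralE; congr (_ - _)%E; apply: eq_integral => y _.
  by rewrite !funepos.unlock.
by rewrite !funeneg.unlock.
Qed.
End Tonelli.

Lemma surface_tonelli2 (f : V * V -> \bar R) :
  measurable_fun setT f -> (forall z, 0 <= f z)%E ->
  (\int[sigma]_x \int[sigma]_y f (x, y) = \int[sigma]_y \int[sigma]_x f (x, y))%E.
Proof.
move=> mf f0; have [sF sFE] := surface_finite_measure.
have E (h : V -> \bar R) : (\int[sF]_y h y = \int[sigma]_y h y)%E.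
  by apply: eq_measure_integral => A _ _; exact: sFE.
transitivity (\int[sF]_x \int[sigma]_y f (x, y))%E; first by rewrite E.
by rewrite (surface_tonelli sF) //; apply: eq_integral => x _; rewrite E.
Qed.

Lemma le_surface_integral (f g : V -> \bar R) : measurable_fun setT f -> measurable_fun setT g ->
  (forall x, 0 <= f x)%E -> (forall x, 0 <= g x)%E ->
  (forall x, sphere x -> first x != 0 -> (f x <= g x)%E) ->
  (\int[sigma]_x f x <= \int[sigma]_x g x)%E.
Proof.
move=> mf mg f0 g0 fg; apply: ae_ge0_le_integral => //.
by apply: ae_surface => x sx fx _; exact: fg.
Qed.

Lemma surface_integral_cst (c : R) : (\int[sigma]_x c%:E = (c * surf_area R (dimd k))%:E)%E.
Proof.
by transitivity (c%:E * sigma setT)%E; [exact: integral_cst|rewrite (surface_setT hs)].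
Qed.

Lemma surface_integrable (f : V -> R) (c : R) : measurable_fun setT f ->
  (forall x, sphere x -> `|f x| <= c) -> sigma.-integrable setT (EFin \o f).
Proof.
move=> mf fc; apply/integrableP; split; first exact/measurable_EFinP.
apply: (@le_lt_trans _ _ (\int[sigma]_x (`|c|)%:E)%E); last by rewrite surface_integral_cst ltry.
apply: le_surface_integral => //.
- by apply: measurableT_comp => //; exact/measurable_EFinP.
- by move=> x sx _; rewrite lee_fin (le_trans (fc _ sx)) // ler_norm.
Qed.

Lemma eq_surface_Rintegral (f g : V -> R) : measurable_fun setT f -> measurable_fun setT g ->
  (forall x, sphere x -> first x != 0 -> f x = g x) ->
  \int[sigma]_x f x = \int[sigma]_x g x.
Proof.
move=> mf mg fg; congr fine; apply: ae_eq_integral => //; [exact/measurable_EFinP|exact/measurable_EFinP|].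
by apply: ae_surface => x sx fx _; rewrite fg.
Qed.

Lemma surface_integral_opp (f : V -> \bar R) : measurable_fun setT f -> (forall x, 0 <= f x)%E ->
  (\int[sigma]_x f (- x)%R = \int[sigma]_x f x)%E.
Proof.
move=> mf f0; have mo := @measurable_oppv R k.
transitivity (\int[pushforward sigma (fun x : V => ((- x)%R : V))]_x f x)%E.
  have := ge0_integral_pushforward mo sigma measurableT mf (fun y _ => f0 y).
  by rewrite preimage_setT => ->.
apply: eq_measure_integral => A mA _; exact: (surface_opp hs mA).
Qed.

Lemma surface_Rintegral_opp (f : V -> R) : measurable_fun setT f ->
  \int[sigma]_x f (- x) = \int[sigma]_x f x.
Proof.
move=> mf; rewrite /Rintegral.
have mE : measurable_fun setT (EFin \o f) by exact/measurable_EFinP.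
have hp := surface_integral_opp (measurable_funepos mE) (funepos_ge0 _).
have hn := surface_integral_opp (measurable_funeneg mE) (funeneg_ge0 _).
congr fine; rewrite integralE [RHS]integralE -hp -hn.
by apply: (congr2 (fun a b : \bar R => a - b)%E); apply: eq_integral => x _; rewrite ?funepos.unlock ?funeneg.unlock.
Qed.

Lemma le_normr_surface_Rintegral (f g : V -> R) (c : R) : measurable_fun setT f -> measurable_fun setT g ->
  (forall x, sphere x -> `|f x| <= c) -> (forall x, 0 <= g x) ->
  (forall x, sphere x -> first x != 0 -> `|f x| <= g x) ->
  ((`|\int[sigma]_x f x|)%:E <= \int[sigma]_x (g x)%:E)%E.
Proof.
move=> mf mg fc g0 fg.
have fint := surface_integrable mf fc.
apply: (@le_trans _ _ (\int[sigma]_x (`|f x|)%:E)%E).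
  rewrite EFin_normr_Rintegral //; apply: le_abse_integral => //; exact/measurable_EFinP.
apply: le_surface_integral => //.
- by apply/measurable_EFinP; exact: measurableT_comp.
- exact/measurable_EFinP.
Qed.

Section LnormOnSphere.
Variable q : \bar R.
Hypothesis q1 : (1 <= q)%E.
Implicit Types f g : V -> R.

Lemma surface_Lnorm_le f g : measurable_fun setT f -> measurable_fun setT g ->
  (forall x, sphere x -> first x != 0 -> `|f x| <= `|g x|) ->
  (Lnorm sigma q (fun x => (f x)%:E) <= Lnorm sigma q (fun x => (g x)%:E))%E.
Proof.
move=> mf mg fg; rewrite Lnorm.unlock; case: q q1 => [p p1| |]; [|move=> _|by []]; last first.
  case: ifP => // _; apply: le_ess_sup; apply: ae_surface => x sx fx /=.
  by rewrite lee_fin fg.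
rewrite lee_fin in p1; have p0 : 0 < p by exact: lt_le_trans p1.
have mpow (h : V -> R) : measurable_fun setT h -> measurable_fun setT (fun x => (`|(h x)%:E| `^ p)%E).
  move=> mh; apply: (measurableT_comp (measurable_poweR _)) => //.
  by apply: measurableT_comp => //; exact/measurable_EFinP.
apply: gt0_ler_poweR; rewrite ?in_itv /= ?andbT ?leey ?invr_ge0 ?(ltW p0) //.
- by rewrite integral_ge0 // => x _; exact: poweR_ge0.
- by rewrite integral_ge0 // => x _; exact: poweR_ge0.
apply: le_surface_integral; [exact: mpow|exact: mpow| | |].
- by move=> x; rewrite lee_fin powR_ge0.
- by move=> x; rewrite lee_fin powR_ge0.
by move=> x sx fx; rewrite lee_fin ge0_ler_powR ?nnegrE ?(ltW p0) ?fg.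
Qed.

Lemma surface_Lnorm_opp f : measurable_fun setT f ->
  (Lnorm sigma q (fun x => (f (- x))%:E) <= Lnorm sigma q (fun x => (f x)%:E))%E.
Proof.
move=> mf; rewrite Lnorm.unlock; case: q q1 => [p p1| |]; [|move=> _|by []]; last first.
  case: ifP => // _; apply/ess_supP.
  have [N [mN N0 hN]] := ess_sup_ge sigma (abse \o (fun x => (f x)%:E)).
  exists [set x : V | N (- x)]; split.
  - by rewrite -[X in measurable X]setTI; apply: measurable_oppv.
  - by rewrite (surface_opp hs).
  - by move=> x /= hx; apply: hN.
rewrite (@surface_integral_opp (fun x => `|(f x)%:E| `^ p)%E) //.
  move=> *; apply: (measurableT_comp (measurable_poweR _)) => //.
  by apply: measurableT_comp => //; exact/measurable_EFinP.
by move=> x; exact: poweR_ge0.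
Qed.

Lemma surface_LnormD f g : measurable_fun setT f -> measurable_fun setT g ->
  (Lnorm sigma q (fun x => (f x + g x)%:E) <=
   Lnorm sigma q (fun x => (f x)%:E) + Lnorm sigma q (fun x => (g x)%:E))%E.
Proof. by move=> mf mg; have := eminkowski sigma mf mg q1. Qed.

(** 1 + |S| dominates both |S|^(1/p) for every p >= 1 and the constant 1 needed for p = oo, so one
    constant serves all q. *)
Lemma surface_Lnorm_sup f c : measurable_fun setT f -> 0 <= c ->
  (forall x, sphere x -> first x != 0 -> `|f x| <= c) ->
  (Lnorm sigma q (fun x => (f x)%:E) <= (c * (1 + surf_area R (dimd k)))%:E)%E.
Proof.
move=> mf c0 fc; have S0 := surface_ge0.
apply: (@le_trans _ _ (Lnorm sigma q (fun x => c%:E))).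
  by apply: surface_Lnorm_le => // x sx fx; rewrite (ger0_norm c0) fc.
rewrite Lnorm.unlock; case: q q1 => [p p1| |]; [|move=> _|by []]; last first.
  case: ifP => _; last by rewrite lee_fin mulr_ge0 // addr_ge0.
  apply/ess_supP; apply: nearW => x /=; rewrite lee_fin ger0_norm // ler_peMr // lerDl //.
rewrite lee_fin in p1; have p0 : 0 < p by exact: lt_le_trans p1.
rewrite (eq_integral (fun=> (c `^ p)%:E)); last first.
  by move=> x _; rewrite /= ger0_norm.
rewrite surface_integral_cst poweR_EFin lee_fin powRM ?powR_ge0 // -powRrM divff ?gt_eqF // powRr1 //.
rewrite ler_wpM2l //; have [S1|S1] := leP 1 (surf_area R (dimd k)).
  apply: (@le_trans _ _ (surf_area R (dimd k))); last by rewrite lerDr.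
  by rewrite -[leRHS]powRr1 // ler_powR // invf_le1.
apply: (@le_trans _ _ 1); last by rewrite lerDl.
have e1 : 1 = 1 `^ p^-1 :> R by rewrite powR1.
by rewrite [leRHS]e1; apply: ge0_ler_powR; rewrite ?nnegrE ?invr_ge0 //; exact: ltW.
Qed.
End LnormOnSphere.

(** Pointwise |f|^p <= s^(p-a) |f|^a. The exponent [a] is 2 for the fluctuations and 1 for the
    trimming bias. *)
Lemma surface_Lnorm_interp (p : R) (a : nat) (f : V -> R) (s e : R) : measurable_fun setT f ->
  1 <= p -> a%:R <= p -> 0 <= s -> 0 <= e -> (forall x, sphere x -> `|f x| <= s) ->
  (\int[sigma]_x (`|f x| ^+ a)%:E <= e%:E)%E ->
  (Lnorm sigma p%:E (fun x => (f x)%:E) <= ((s `^ (p - a%:R) * e) `^ p^-1)%:E)%E.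
Proof.
move=> mf p1 ap s0 e0 fs fe; have p0 : 0 < p by exact: lt_le_trans p1.
rewrite Lnorm.unlock -poweR_EFin.
apply: gt0_ler_poweR; rewrite ?in_itv /= ?andbT ?leey ?invr_ge0 ?(ltW p0) //.
- by rewrite integral_ge0 // => x _; exact: poweR_ge0.
- by rewrite lee_fin mulr_ge0 // powR_ge0.
rewrite EFinM; apply: le_trans (lee_wpmul2l _ fe); last by rewrite lee_fin powR_ge0.
rewrite -ge0_integralZl_EFin //; last 2 first.
- by apply/measurable_EFinP; apply: measurable_funX; exact: measurableT_comp.
- exact: powR_ge0.
apply: le_surface_integral.
- by apply/measurable_EFinP; apply: (measurableT_comp (measurable_powR p)); exact: measurableT_comp.
- apply: measurable_funeM; apply/measurable_EFinP; apply: measurable_funX; exact: measurableT_comp.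
- by move=> x; rewrite lee_fin powR_ge0.
- by move=> x; rewrite mule_ge0 // lee_fin ?powR_ge0 ?exprn_ge0.
move=> x sx _; rewrite /= lee_fin -(powR_mulrn a (normr_ge0 _)).
have [->|fx0] := eqVneq (f x) 0.
  by rewrite normr0 powR0 ?gt_eqF // mulr_ge0 // powR_ge0.
have fp : 0 < `|f x| by rewrite normr_gt0.
rewrite -[in leLHS](subrK a%:R p) [in leLHS]powRD; last by apply/implyP => _; rewrite gt_eqF.
by rewrite ler_wpM2r ?powR_ge0 // ge0_ler_powR ?nnegrE ?subr_ge0 // fs.
Qed.

(** Pointwise |f|^p <= rho^p + rho^(p-2) f^2, according to whether |f| is below or above the target
    scale [rho]; this replaces Hoelder's inequality. *)
Lemma surface_Lnorm_lt2 (p : R) (f : V -> R) (rho A : R) : measurable_fun setT f ->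
  1 <= p -> p <= 2 -> 0 < rho -> 0 <= A ->
  (\int[sigma]_x (f x ^+ 2)%:E <= (A * rho ^+ 2)%:E)%E ->
  (Lnorm sigma p%:E (fun x => (f x)%:E) <= (rho * (1 + surf_area R (dimd k) + A))%:E)%E.
Proof.
move=> mf p1 p2 rho0 A0 fA; have S0 := surface_ge0; have p0 : 0 < p by exact: lt_le_trans p1.
have rho1 := ltW rho0.
have pt x : `|f x| `^ p <= rho `^ p + rho `^ (p - 2) * f x ^+ 2.
  have [h|h] := leP `|f x| rho.
    apply: ler_wpDr; first by rewrite mulr_ge0 ?powR_ge0 ?sqr_ge0.
    by rewrite ge0_ler_powR ?nnegrE // ltW.
  apply: ler_wpDl; first exact: powR_ge0.
  have fp : 0 < `|f x| by exact: lt_trans h.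
  rewrite -[in leLHS](subrK 2 p) [in leLHS]powRD; last by apply/implyP => _; rewrite gt_eqF.
  rewrite (powR_mulrn 2) // real_normK ?num_real // ler_wpM2r ?sqr_ge0 //.
  rewrite -opprB !powRN lef_pV2 ?posrE ?powR_gt0 //.
  by rewrite ge0_ler_powR ?nnegrE ?subr_ge0 // ltW.
have key : (\int[sigma]_x (`|(f x)%:E| `^ p) <= (rho `^ p * (surf_area R (dimd k) + A))%:E)%E.
  apply: (@le_trans _ _ (\int[sigma]_x ((rho `^ p)%:E + (rho `^ (p - 2))%:E * (f x ^+ 2)%:E))%E).
    apply: le_surface_integral.
    - by apply/measurable_EFinP; apply: (measurableT_comp (measurable_powR p)); exact: measurableT_comp.
    - apply: emeasurable_funD => //; apply: measurable_funeM; apply/measurable_EFinP; exact: measurable_funX.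
    - by move=> x; rewrite lee_fin powR_ge0.
    - by move=> x; rewrite -EFinM -EFinD lee_fin addr_ge0 ?powR_ge0 // mulr_ge0 ?powR_ge0 ?sqr_ge0.
    - by move=> x _ _; rewrite /= -EFinM -EFinD lee_fin.
  rewrite ge0_integralD //; last 3 first.
  - by move=> x _; rewrite lee_fin powR_ge0.
  - by move=> x _; rewrite -EFinM lee_fin mulr_ge0 ?powR_ge0 ?sqr_ge0.
  - by apply: measurable_funeM; apply/measurable_EFinP; exact: measurable_funX.
  rewrite surface_integral_cst ge0_integralZl_EFin //; last 3 first.
  - by move=> x _; rewrite lee_fin sqr_ge0.
  - by apply/measurable_EFinP; exact: measurable_funX.
  - exact: powR_ge0.
  rewrite mulrDr EFinD; apply: leeD => //.
  apply: le_trans (lee_wpmul2l _ fA) _; first by rewrite lee_fin powR_ge0.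
  rewrite -EFinM lee_fin mulrCA mulrC ler_wpM2r // -(powR_mulrn 2 (ltW rho0)) -powRD ?subrK //.
  by apply/implyP => _; rewrite gt_eqF.
rewrite Lnorm.unlock.
apply: (@le_trans _ _ (((rho `^ p * (surf_area R (dimd k) + A)) `^ p^-1)%:E)).
  rewrite -poweR_EFin.
  apply: gt0_ler_poweR; rewrite ?in_itv /= ?andbT ?leey ?invr_ge0 ?(ltW p0) //.
  - by rewrite integral_ge0 // => x _; exact: poweR_ge0.
  - by rewrite lee_fin mulr_ge0 ?powR_ge0 ?addr_ge0.
rewrite lee_fin powRM ?powR_ge0 ?addr_ge0 // -powRrM divff ?gt_eqF // powRr1 // ler_wpM2l //.
set B := surf_area R (dimd k) + A; have B0 : 0 <= B by rewrite addr_ge0.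
rewrite -addrA -/B; have [B1|B1] := leP 1 B.
  apply: (@le_trans _ _ B); last by rewrite lerDr.
  by rewrite -[leRHS]powRr1 // ler_powR // invf_le1.
apply: (@le_trans _ _ 1); last by rewrite lerDl.
have e1 : 1 = 1 `^ p^-1 :> R by rewrite powR1.
by rewrite [leRHS]e1; apply: ge0_ler_powR; rewrite ?nnegrE ?invr_ge0 //; exact: ltW.
Qed.

End SphereIntegrals.

(** * The sampling model *)

Lemma measurable_dotv_ge0 (R : realType) k d (T : measurableType d) (f g : T -> Vec R k) :
  measurable_fun setT f -> measurable_fun setT g ->
  measurable_fun setT (fun t => (0 <= dotv (f t) (g t))%R%:R : R).
Proof.
move=> mf mg; rewrite (_ : (fun _ => _) = fun t => if 0 <= dotv (f t) (g t) then 1 else 0).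
  apply: measurable_fun_ifT => //; apply: measurable_fun_ler => //.
  exact: measurable_dotv.
by apply/funext => p; case: ifP.
Qed.

Section ModelMoments.
Variables (R : realType) (k : nat).
Notation V := (Vec R k).
Variable sigma : {measure set V -> \bar R}.
Hypothesis hs : is_surface_measure sigma.
Context (dO : measure_display) (Omega : measurableType dO).
Variable P : probability Omega R.
Variable Z : nat -> bool -> Omega -> V.
Variables fbeta fX : V -> R.
Hypothesis hM : model_M P sigma Z fbeta fX.

Lemma sample_measurable i b : measurable_fun setT (Z i b).
Proof. by case: hM => [[h _] _ _ _ _]; exact: h. Qed.

Lemma sample_sphere i b w : sphere (Z i b w).
Proof. by case: hM => [[_ h] _ _ _ _]; exact: h. Qed.

Let mZ := sample_measurable.

Let mfb : measurable_fun setT fbeta. Proof. by case: hM => [_ _ [? _ _ _]]. Qed.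
Let mfX : measurable_fun setT fX. Proof. by case: hM => [_ _ [_ ? _ _]]. Qed.
Let fb0 x : 0 <= fbeta x. Proof. by case: hM => [_ _ [_ _ h _] _ _]; exact: h. Qed.
Let fX0 x : 0 <= fX x. Proof. by case: hM => [_ _ [_ _ _ h] _ _]; exact: h. Qed.

Let int_beta i (f : V -> \bar R) : measurable_fun setT f -> (forall x, 0 <= f x)%E ->
  (\int[P]_w f (Z i true w) = \int[sigma]_x (f x * (fbeta x)%:E))%E.
Proof.
move=> mf f0; apply: (ge0_integral_density (mZ i true) mfb fb0) => // A mA.
by case: hM => [_ _ _ [h _] _]; exact: h.
Qed.

Let int_X i (f : V -> \bar R) : measurable_fun setT f -> (forall x, 0 <= f x)%E ->
  (\int[P]_w f (Z i false w) = \int[sigma]_x (f x * (fX x)%:E))%E.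
Proof.
move=> mf f0; apply: (ge0_integral_density (mZ i false) mfX fX0) => // A mA.
by case: hM => [_ _ _ [_ h] _]; exact: h.
Qed.

Lemma integral_sample i (h : V * V -> \bar R) : measurable_fun setT h -> (forall z, 0 <= h z)%E ->
  (\int[P]_w h (Z i false w, Z i true w) =
   \int[sigma]_z ((\int[sigma]_b (h (z, b) * (fbeta b)%:E)) * (fX z)%:E))%E.
Proof.
move=> mh h0; have ind : mutually_independent P (fun ib : nat * bool => Z ib.1 ib.2) by case: hM.
rewrite (indep_integral (mZ i false) (mZ i true)) //; last first.
  by move=> A B; exact: sample_indep.
have mfbE : measurable_fun setT (fun b => (fbeta b)%:E) by exact/measurable_EFinP.
have mg : measurable_fun setT (fun z => \int[sigma]_b (h (z, b) * (fbeta b)%:E))%E.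
  apply: (measurable_surface_integral hs (f := fun zb : V * V => (h zb * (fbeta zb.2)%:E)%E)).
    apply: emeasurable_funM => //; exact: (measurableT_comp mfbE).
  by move=> z; rewrite mule_ge0 // lee_fin.
rewrite -(int_X i mg); last first.
  by move=> z; apply: integral_ge0 => b _; rewrite mule_ge0 // lee_fin.
apply: eq_integral => w _; rewrite (@int_beta i (fun b => h (Z i false w, b))) //.
by apply: (measurableT_comp mh); exact: measurable_pair1.
Qed.

Lemma integral_fbeta : (\int[sigma]_b (fbeta b)%:E = 1)%E.
Proof.
have := int_beta 0 (measurable_cst (1%:E : \bar R)) (fun=> @lee01 R).
rewrite integral_cst_prob => ->; by apply: eq_integral => b _; rewrite mul1e.
Qed.

Lemma rfunE x : ((rfun sigma fbeta x)%:E =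
  \int[sigma]_b (((0 <= dotv x b)%R%:R)%:E * (fbeta b)%:E))%E.
Proof.
rewrite /rfun /Rintegral integral_mkcond fineK.
  apply: eq_integral => b _; rewrite patchE; case: ifPn.
    by rewrite inE /= => ->; rewrite mul1e.
  by rewrite notin_setE /= => /negP/negbTE ->; rewrite mul0e.
rewrite ge0_fin_numE; last first.
  by apply: integral_ge0 => b _; rewrite patchE; case: ifP => _ //; rewrite lee_fin.
apply: (@le_lt_trans _ _ (\int[sigma]_b (fbeta b)%:E)%E); last by rewrite integral_fbeta ltry.
rewrite -integral_mkcond; apply: ge0_subset_integral => //.
- rewrite (_ : [set _ | _] = (fun b => dotv x b) @^-1` `[0, +oo[%classic).
    by rewrite -[X in measurable X]setTI; apply: measurable_dotv.
  by apply/seteqP; split => b /=; rewrite in_itv /= andbT.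
- exact/measurable_EFinP.
- by move=> b _; rewrite lee_fin.
Qed.

Let mind : measurable_fun setT (fun p : V * V => (0 <= dotv p.1 p.2)%R%:R : R).
Proof. by apply: measurable_dotv_ge0. Qed.

Lemma measurable_rfun : measurable_fun setT (rfun sigma fbeta).
Proof.
apply/measurable_EFinP; rewrite (_ : EFin \o _ = fun x => (\int[sigma]_b (((0 <= dotv x b)%R%:R)%:E * (fbeta b)%:E))%E).
  apply: (measurable_surface_integral hs (f := fun zb : V * V => (((0 <= dotv zb.1 zb.2)%R%:R)%:E * (fbeta zb.2)%:E)%E)).
    apply: emeasurable_funM; first exact/measurable_EFinP.
    by apply/measurable_EFinP; exact: (measurableT_comp mfb).
  by move=> z; rewrite mule_ge0 // lee_fin.
by apply/funext => x; rewrite /= rfunE.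
Qed.

Lemma rfun_ge0_le1 x : 0 <= rfun sigma fbeta x <= 1.
Proof.
rewrite -!lee_fin rfunE; apply/andP; split.
  by apply: integral_ge0 => b _; rewrite mule_ge0 // lee_fin.
rewrite -integral_fbeta; apply: ge0_le_integral => //.
- by move=> b _; rewrite mule_ge0 // lee_fin.
- apply: emeasurable_funM; last exact/measurable_EFinP.
  by apply/measurable_EFinP; exact: measurable_dotv_ge0.
- exact/measurable_EFinP.
- by move=> b _; case: (0 <= dotv x b); rewrite ?mul1e ?mul0e // lee_fin.
Qed.

Lemma Rfun_ge0_le1 x : 0 <= Rfun sigma fbeta x <= 1.
Proof.
rewrite /Rfun; case: ifP => _; first exact: rfun_ge0_le1.
by have /andP[? ?] := rfun_ge0_le1 (- x); apply/andP; split; lra.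
Qed.

(** On the equator x and -x both fall under [0 <= first], so the reflection built into the
    definition is available only off it. *)
Lemma RfunN x : first x != 0 -> Rfun sigma fbeta (- x) = 1 - Rfun sigma fbeta x.
Proof.
move=> x0; have fN : first (- x) = - first x by rewrite /first mxE.
rewrite /Rfun fN opprK oppr_ge0; case: ltgtP x0 => //= h _.
by rewrite opprB addrC subrK.
Qed.

(** Integrating out beta replaces the indicator of Y = 1 by r(z). The flag [b] covers the integrand
    with and without that indicator, which together give the sign 2Y - 1. *)
Let integral_sample_ge0 i (b : bool) (u : V -> R) : measurable_fun setT u -> (forall z, 0 <= u z) ->
  (\int[P]_w ((if b then (0 <= dotv (Z i false w) (Z i true w))%R%:R else 1) * u (Z i false w))%:E =
   \int[sigma]_z ((if b then rfun sigma fbeta z else 1) * u z * fX z)%:E)%E.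
Proof.
move=> mu u0.
rewrite (integral_sample i (h := fun p : V * V => ((if b then (0 <= dotv p.1 p.2)%R%:R else 1) * u p.1)%:E)).
- apply: eq_integral => z _.
  rewrite EFinM; congr (_ * _)%E; rewrite mulrC EFinM.
  under eq_integral => b' _ do rewrite /= mulrC EFinM -muleA.
  rewrite ge0_integralZl_EFin //.
  + congr (_ * _)%E; case: b; first by rewrite rfunE.
    by under eq_integral do rewrite mul1e; rewrite integral_fbeta.
  + by move=> b' _; rewrite mule_ge0 // lee_fin //; case: b.
  + apply: emeasurable_funM; last exact/measurable_EFinP.
    case: b => //; apply/measurable_EFinP; exact: measurable_dotv_ge0.
- apply/measurable_EFinP; apply: measurable_funM; first by case: b.
  exact: (measurableT_comp mu).
- by move=> z; rewrite lee_fin mulr_ge0 //; case: b.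
Qed.

Variable Bf : R.
Hypothesis fXB : forall x, sphere x -> fX x <= Bf.

Let P_integrable (Y : Omega -> R) (c : R) : measurable_fun setT Y -> (forall w, `|Y w| <= c) ->
  P.-integrable setT (EFin \o Y).
Proof.
move=> mY Yc; apply: measurable_bounded_integrable => //.
  exact: le_lt_trans (probability_le1 P measurableT) (ltry _).
exists c; split; first exact: num_real.
by move=> x cx w _ /=; apply: le_trans (Yc w) (ltW _).
Qed.

Lemma Rintegral_sample i (b : bool) (u : V -> R) (c : R) : measurable_fun setT u ->
  (forall z, sphere z -> `|u z| <= c) ->
  \int[P]_w ((if b then (0 <= dotv (Z i false w) (Z i true w))%R%:R else 1) * u (Z i false w)) =
  \int[sigma]_z ((if b then rfun sigma fbeta z else 1) * u z * fX z).
Proof.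
move=> mu uc; pose up z : R := Num.max (u z) 0; pose un z : R := Num.max (- u z) 0.
have mp : measurable_fun setT up by apply: measurable_maxr.
have mn : measurable_fun setT un by apply: measurable_maxr => //; exact: measurableT_comp.
have up0 z : 0 <= up z by rewrite le_max lexx orbT.
have un0 z : 0 <= un z by rewrite le_max lexx orbT.
have uE z : u z = up z - un z.
  rewrite /up /un; have [h|h] := leP 0 (u z).
    by rewrite max_r ?subr0 // oppr_le0.
  by rewrite max_l ?sub0r ?opprK // oppr_ge0 ltW.
have upc z : sphere z -> `|up z| <= c.
  move=> sz; have h := uc z sz; rewrite ger0_norm // /up ge_max.
  by rewrite (le_trans (ler_norm _) h) (le_trans (normr_ge0 _) h).
have unc z : sphere z -> `|un z| <= c.
  move=> sz; have h := uc z sz; rewrite -normrN in h; rewrite ger0_norm // /un ge_max.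
  by rewrite (le_trans (ler_norm _) h) (le_trans (normr_ge0 _) h).
pose s (w : Omega) : R := if b then (0 <= dotv (Z i false w) (Z i true w))%R%:R else 1.
have s01 w : 0 <= s w <= 1 by rewrite /s; case: (b) => /=; [case: (0 <= dotv _ _) => /=|]; rewrite ?ler01 ?lexx.
pose rr z : R := if b then rfun sigma fbeta z else 1.
have r01 z : 0 <= rr z <= 1 by rewrite /rr; case: (b) => /=; [exact: rfun_ge0_le1|rewrite ler01 lexx].
have mrr : measurable_fun setT rr by rewrite /rr; case: (b) => //; exact: measurable_rfun.
have mW : measurable_fun setT (fun w => (Z i false w, Z i true w)) by exact: measurable_fun_pair.
have ms : measurable_fun setT s by rewrite /s; case: (b) => //; exact: (measurableT_comp mind mW).
have intP (v : V -> R) : measurable_fun setT v -> (forall z, sphere z -> `|v z| <= c) ->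
    P.-integrable setT (EFin \o (fun w => s w * v (Z i false w))).
  move=> mv vc; apply: (@P_integrable _ c).
    by apply: measurable_funM => //; exact: (measurableT_comp mv).
  move=> w; have /andP[s0 s1] := s01 w; rewrite normrM (ger0_norm s0).
  by apply: le_trans (vc _ (sample_sphere i false w)); rewrite ler_piMl.
have intS (v : V -> R) : measurable_fun setT v -> (forall z, sphere z -> `|v z| <= c) ->
    sigma.-integrable setT (EFin \o (fun z => rr z * v z * fX z)).
  move=> mv vc; apply: (surface_integrable hs (c := c * Bf)).
    by apply: measurable_funM => //; exact: measurable_funM.
  move=> z sz; have /andP[r0 r1] := r01 z.
  rewrite normrM (ger0_norm (fX0 z)) ler_pM // ?fXB //.
  by rewrite normrM (ger0_norm r0); apply: le_trans (vc z sz); rewrite ler_piMl.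
rewrite -/(s _) -/(rr _).
transitivity (\int[P]_w (s w * up (Z i false w)) - \int[P]_w (s w * un (Z i false w))).
  rewrite -RintegralB //; [|exact: intP|exact: intP].
  by apply: eq_Rintegral => w _; rewrite uE mulrBr.
transitivity (\int[sigma]_z (rr z * up z * fX z) - \int[sigma]_z (rr z * un z * fX z)); last first.
  rewrite -RintegralB //; [|exact: intS|exact: intS].
  by apply: eq_Rintegral => z _; rewrite uE mulrBr mulrBl.
by congr (_ - _); congr fine; exact: integral_sample_ge0.
Qed.

Lemma integral_sample_X i (u : V -> R) : measurable_fun setT u -> (forall z, 0 <= u z) ->
  (\int[P]_w (u (Z i false w))%:E = \int[sigma]_z (u z * fX z)%:E)%E.
Proof.
move=> mu u0; have := integral_sample_ge0 i false mu u0.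
under eq_integral do rewrite mul1r.
by move=> ->; apply: eq_integral => z _; rewrite mul1r.
Qed.

End ModelMoments.

(** * The trimmed summand and its bias *)

Section TrimmedKernel.
Variables (R : realType) (k : nat).
Notation V := (Vec R k).
Variable sigma : {measure set V -> \bar R}.
Hypothesis hs : is_surface_measure sigma.
Context (dO : measure_display) (Omega : measurableType dO).
Variable P : probability Omega R.
Variable Z : nat -> bool -> Omega -> V.
Variables fbeta fX : V -> R.
Hypothesis hM : model_M P sigma Z fbeta fX.
Variables (chi : nat -> nat -> R).
Hypothesis chi01 : forall n T, 0 <= chi n T <= 1.
Variables Bf B A : R.
Hypothesis fXB : forall x, sphere x -> fX x <= Bf.
Hypothesis hK1 : forall T (x : V), sphere x -> (\int[sigma]_y (`|Kker chi T x y|)%:E <= B%:E)%E.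
Hypothesis hA : forall T (x y : V), (0 < T)%N -> sphere x -> sphere y ->
  `|Kminus chi T x y| <= A * T%:R ^+ k.+1.
Variable T : nat.
Hypothesis T0 : (0 < T)%N.
Variable t : R.
Hypothesis t0 : 0 < t.

Let mfX : measurable_fun setT fX. Proof. by case: hM => [_ _ [_ ? _ _]]. Qed.
Let fX0 x : 0 <= fX x. Proof. by case: hM => [_ _ [_ _ _ h] _ _]; exact: h. Qed.

Definition trim_max (z : V) : R := Num.max (fX z) t.

Lemma trim_max_gt0 z : 0 < trim_max z.
Proof. by rewrite lt_max t0 orbT. Qed.

Lemma trim_maxV_ge0 z : 0 <= (trim_max z)^-1.
Proof. by rewrite invr_ge0 ltW // trim_max_gt0. Qed.

Lemma trim_maxV_le z : (trim_max z)^-1 <= t^-1.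
Proof. by rewrite lef_pV2 ?posrE ?trim_max_gt0 // le_max lexx orbT. Qed.

Lemma measurable_trim_maxV : measurable_fun setT (fun z => (trim_max z)^-1).
Proof.
rewrite (_ : (fun _ => _) = fun z => trim_max z `^ (-1)).
  by apply: (measurableT_comp (measurable_powR _)); apply: measurable_maxr.
by apply/funext => z; rewrite powR_inv1 // ltW // trim_max_gt0.
Qed.

Lemma fX_trim_max z : fX z / trim_max z <= 1.
Proof. by rewrite ler_pdivrMr ?trim_max_gt0 // mul1r le_max lexx. Qed.

(** Summand of the oracle version of the estimator as a function of p = (X, beta), from which Y is
    recovered; [t] is the trimming level. *)
Definition psi (x : V) (p : V * V) : R :=
  (2 * (0 <= dotv p.1 p.2)%R%:R - 1) * Kminus chi T p.1 x / trim_max p.1.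

Let m1 (x : V) : measurable_fun setT (fun z : V => Kminus chi T z x).
Proof. by apply: measurable_Kminus. Qed.

Lemma measurable_psi : measurable_fun setT (fun xp : V * (V * V) => psi xp.1 xp.2).
Proof.
have m2 : measurable_fun setT (fun xp : V * (V * V) => xp.2.1) by exact: measurableT_comp.
apply: measurable_funM; last exact: (measurableT_comp measurable_trim_maxV m2).
apply: measurable_funM; last exact: measurable_Kminus.
apply: measurable_funB => //; apply: measurable_funM => //.
by apply: measurable_dotv_ge0 => //; exact: measurableT_comp.
Qed.

Lemma psi_abs x p : `|psi x p| = `|Kminus chi T p.1 x| / trim_max p.1.
Proof.
rewrite /psi !normrM normfV (gtr0_norm (trim_max_gt0 _)); congr (_ * _).
rewrite (_ : `|2 * _ - 1| = 1) ?mul1r //.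
case: (0 <= _); rewrite ?mulr1 ?mulr0 ?sub0r ?normrN ?normr1 //.
by rewrite (_ : 2 - 1 = 1 :> R) ?normr1 //; ring.
Qed.

Lemma psi_le x p : sphere x -> sphere p.1 -> `|psi x p| <= A * T%:R ^+ k.+1 / t.
Proof.
move=> sx sp; rewrite psi_abs; have h := hA T0 sp sx.
apply: ler_pM => //; [exact: trim_maxV_ge0|exact: trim_maxV_le].
Qed.

(** The odd kernel is half the difference of K_2T(x, .) and its reflection, and reflection preserves
    [sigma]. *)
Lemma Kminus_L1 x : sphere x -> (\int[sigma]_z (`|Kminus chi T z x|)%:E <= B%:E)%E.
Proof.
move=> sx; have mK : measurable_fun setT (fun z => (`|Kker chi (2 * T) x z|)%:E).
  apply/measurable_EFinP; apply: measurableT_comp => //; exact: measurable_Kker.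
have mKN : measurable_fun setT (fun z : V => (`|Kker chi (2 * T) x (- z)|)%:E).
  exact: (measurableT_comp mK (@measurable_oppv R k)).
apply: (@le_trans _ _ (\int[sigma]_z ((2^-1)%:E * ((`|Kker chi (2 * T) x z|)%:E + (`|Kker chi (2 * T) x (- z)|)%:E)))%E).
  apply: (le_surface_integral hs).
  - by apply/measurable_EFinP; apply: measurableT_comp.
  - by apply: measurable_funeM; exact: emeasurable_funD.
  - by move=> z; rewrite lee_fin.
  - by move=> z; rewrite mule_ge0 // ?adde_ge0 // lee_fin invr_ge0.
  - move=> z sz _; rewrite -EFinD -EFinM lee_fin Kminus_sym Kminus_odd // normrM mulrC.
    by rewrite ger0_norm ?invr_ge0 // ler_wpM2l ?invr_ge0 // ler_normB.
rewrite ge0_integralZl_EFin ?invr_ge0 //; last exact: emeasurable_funD.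
rewrite ge0_integralD //.
have -> : (\int[sigma]_z (`|Kker chi (2 * T) x (- z)|)%:E = \int[sigma]_z (`|Kker chi (2 * T) x z|)%:E)%E.
  exact: (surface_integral_opp hs mK).
rewrite (_ : B%:E = ((2^-1)%:E * (B%:E + B%:E))%E); last first.
  by rewrite -EFinD -EFinM; congr EFin; field.
apply: lee_wpmul2l; first by rewrite lee_fin invr_ge0.
  by apply: leeD; exact: hK1.
by move=> z _; rewrite adde_ge0 // lee_fin.
Qed.

(** The density of X cancels the division, as [fX / max (fX, t) <= 1]; the bound is therefore free
    of T and [t]. *)
Lemma psi_mean_abs i x : sphere x -> (\int[P]_w (`|psi x (Z i false w, Z i true w)|)%:E <= B%:E)%E.
Proof.
move=> sx; have mu : measurable_fun setT (fun z => `|Kminus chi T z x| / trim_max z).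
  by apply: measurable_funM; [exact: measurableT_comp|exact: measurable_trim_maxV].
under eq_integral do rewrite psi_abs.
rewrite (integral_sample_X hs hM i mu); last first.
  by move=> z; rewrite divr_ge0 // ltW // trim_max_gt0.
apply: le_trans (Kminus_L1 sx); apply: (le_surface_integral hs).
- by apply/measurable_EFinP; exact: measurable_funM.
- by apply/measurable_EFinP; exact: measurableT_comp.
- by move=> z; rewrite lee_fin mulr_ge0 // divr_ge0 // ltW // trim_max_gt0.
- by move=> z; rewrite lee_fin.
- move=> z _ _; rewrite lee_fin -mulrA ler_piMr // mulrC; exact: fX_trim_max.
Qed.

(** One factor |K| is bounded by its supremum and the other kept for (K1), so only one power T^(d-1)
    appears; the two trimmed denominators cost t^(-2). *)
Lemma psi_var i x : sphere x ->
  (\int[P]_w (psi x (Z i false w, Z i true w) ^+ 2)%:E <= (A * T%:R ^+ k.+1 * Bf * B / t ^+ 2)%:E)%E.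
Proof.
move=> sx; have mV := measurable_trim_maxV.
have mu : measurable_fun setT (fun z => (`|Kminus chi T z x| / trim_max z) ^+ 2).
  by apply: measurable_funX; apply: measurable_funM => //; exact: measurableT_comp.
under eq_integral do rewrite -real_normK ?num_real // psi_abs.
rewrite (integral_sample_X hs hM i mu); last by move=> z; exact: sqr_ge0.
have Bf0 : 0 <= Bf by apply: le_trans (fX0 x) (fXB sx).
have AT0 : 0 <= A * T%:R ^+ k.+1 by apply: le_trans (hA T0 sx sx).
have c0 : 0 <= A * T%:R ^+ k.+1 * Bf / t ^+ 2 by rewrite divr_ge0 ?sqr_ge0 // mulr_ge0.
apply: (@le_trans _ _ (\int[sigma]_z ((A * T%:R ^+ k.+1 * Bf / t ^+ 2)%:E * (`|Kminus chi T z x|)%:E)))%E; last first.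
  rewrite ge0_integralZl_EFin //; last by apply/measurable_EFinP; exact: measurableT_comp.
  apply: le_trans (lee_wpmul2l _ (Kminus_L1 sx)) _; first by rewrite lee_fin.
  by rewrite -EFinM lee_fin mulrAC.
apply: (le_surface_integral hs).
- by apply/measurable_EFinP; exact: measurable_funM.
- by apply: measurable_funeM; apply/measurable_EFinP; exact: measurableT_comp.
- by move=> z; rewrite lee_fin mulr_ge0 // sqr_ge0.
- by move=> z; rewrite mule_ge0 // lee_fin.
move=> z sz _; rewrite -EFinM lee_fin.
have h1 := hA T0 sz sx; have h2 := fXB sz.
have h3 : (trim_max z)^-1 ^+ 2 <= (t ^+ 2)^-1.
  by rewrite -exprVn lerXn2r ?nnegrE ?trim_maxV_ge0 ?trim_maxV_le // invr_ge0 ltW.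
rewrite exprMn expr2.
rewrite [leLHS](_ : _ = `|Kminus chi T z x| * fX z * (trim_max z)^-1 ^+ 2 * `|Kminus chi T z x|); last by ring.
apply: ler_wpM2r => //; apply: ler_pM => //.
- by rewrite mulr_ge0.
- by rewrite exprn_ge0 // invr_ge0 ltW // trim_max_gt0.
- exact: ler_pM.
Qed.

(** Zeros of [fX] are included, so that elsewhere on H+ the weight [fX / max (fX, t)] is exactly 1.
    They form a null set by (M), whence the comparison with the set of (T-a). *)
Definition trim_set : set V := [set z | sphere z /\ 0 <= first z /\ fX z < t].

Lemma measurable_trim_set : measurable trim_set.
Proof.
have -> : trim_set = @sphere R k `&` ([set x | 0 <= first x] `&` [set x | fX x < t]) by [].
apply: measurableI; first exact: measurable_sphere.
apply: measurableI; first exact: measurable_first_ge0.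
rewrite (_ : [set x | _] = fX @^-1` `]-oo, t[%classic).
  by rewrite -[X in measurable X]setTI; exact: mfX.
by apply/seteqP; split => x /=; rewrite in_itv.
Qed.

Lemma trim_set_measure : (sigma trim_set <= sigma [set x | sphere x /\ (0 < fX x < t)%R])%E.
Proof.
have mfXlt c : measurable [set x | fX x < c].
  rewrite (_ : [set x | _] = fX @^-1` `]-oo, c[%classic).
    by rewrite -[X in measurable X]setTI; exact: mfX.
  by apply/seteqP; split => x /=; rewrite in_itv.
have mfXle : measurable [set x | fX x <= 0].
  rewrite (_ : [set x | _] = fX @^-1` `]-oo, 0]%classic).
    by rewrite -[X in measurable X]setTI; exact: mfX.
  by apply/seteqP; split => x /=; rewrite in_itv.
have mD : measurable [set x | sphere x /\ 0 < fX x < t].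
  have -> : [set x | sphere x /\ 0 < fX x < t] = @sphere R k `&` ([set x | fX x < t] `\` [set x | fX x <= 0]).
    apply/seteqP; split => x /= [sx].
      by move=> /andP[h1 h2]; split => //; split => //; apply/negP; rewrite -ltNge.
    by move=> [h1 /negP]; rewrite -ltNge => h2; split => //; rewrite h2.
  apply: measurableI; first exact: measurable_sphere.
  exact: measurableD.
have mN : measurable [set x | Hplus x /\ fX x <= 0].
  have -> : [set x | Hplus x /\ fX x <= 0] = (@sphere R k `&` [set x | 0 <= first x]) `&` [set x | fX x <= 0] by [].
  apply: measurableI => //; apply: measurableI; [exact: measurable_sphere|exact: measurable_first_ge0].
apply: (@le_trans _ _ (sigma ([set x | sphere x /\ 0 < fX x < t] `|` [set x | Hplus x /\ fX x <= 0]))).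
  apply: le_measure; rewrite ?inE //; [exact: measurable_trim_set|exact: measurableU|].
  move=> z /= [sz [z1 zt]]; have [h|h] := leP (fX z) 0; first by right.
  by left; split => //; rewrite zt.
apply: le_trans (measureU2 _ _ _) _ => //.
by case: hM => _ _ _ _ [N0 _]; rewrite [X in (_ + X)%E]N0 adde0.
Qed.

Definition trim_bias (x : V) : R := \int[sigma]_z (\1_trim_set z * `|Kminus chi T z x|).

Let mtb : measurable_fun setT (fun p : V * V => \1_trim_set p.2 * `|Kminus chi T p.2 p.1| : R).
Proof.
apply: measurable_funM.
  apply: (measurableT_comp (measurable_indic measurable_trim_set)) => //.
by apply: measurableT_comp => //; exact: measurable_Kminus.
Qed.

Lemma measurable_trim_bias : measurable_fun setT trim_bias.
Proof. exact: (measurable_surface_Rintegral hs mtb). Qed.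

Let trim_biasE x : sphere x -> ((trim_bias x)%:E = \int[sigma]_z (\1_trim_set z * `|Kminus chi T z x|)%:E)%E.
Proof.
move=> sx; rewrite /trim_bias /Rintegral fineK // ge0_fin_numE; last first.
  by apply: integral_ge0 => z _; rewrite lee_fin mulr_ge0.
apply: le_lt_trans (ltry B); apply: le_trans (Kminus_L1 sx).
apply: (le_surface_integral hs).
- by apply/measurable_EFinP; exact: (measurableT_comp mtb (measurable_pair1 x)).
- by apply/measurable_EFinP; exact: measurableT_comp.
- by move=> z; rewrite lee_fin mulr_ge0.
- by move=> z; rewrite lee_fin.
- by move=> z _ _; rewrite lee_fin indicE; case: (_ \in _); rewrite ?mul1r // mul0r.
Qed.

Lemma trim_bias_sup x (D : R) : sphere x -> (sigma trim_set <= D%:E)%E ->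
  `|trim_bias x| <= D * (A * T%:R ^+ k.+1).
Proof.
move=> sx hD; rewrite ger0_norm; last by apply: Rintegral_ge0 => z _; rewrite mulr_ge0.
have AT0 : 0 <= A * T%:R ^+ k.+1 by apply: le_trans (hA T0 sx sx).
rewrite -lee_fin trim_biasE // mulrC EFinM.
apply: le_trans (lee_wpmul2l _ hD); last by rewrite lee_fin.
rewrite -(setIT trim_set) -(integral_indic _ measurableT measurable_trim_set) -ge0_integralZl_EFin //; last first.
  by apply/measurable_EFinP; exact: measurable_indic measurable_trim_set.
apply: (le_surface_integral hs).
- by apply/measurable_EFinP; rewrite setIT; exact: (measurableT_comp mtb (measurable_pair1 x)).
- by apply: measurable_funeM; apply/measurable_EFinP; exact: measurable_indic measurable_trim_set.
- by move=> z; rewrite lee_fin mulr_ge0.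
- by move=> z; rewrite mule_ge0 // lee_fin.
by move=> z sz _; rewrite -EFinM lee_fin setIT mulrC ler_wpM2r // hA.
Qed.

(** Tonelli puts the integral over x inside, where (K1) applies because the odd kernel is symmetric.
    With [trim_bias_sup] this gives the two end points of the interpolation. *)
Lemma trim_bias_L1 (D : R) : (sigma trim_set <= D%:E)%E -> 0 <= B ->
  (\int[sigma]_x (`|trim_bias x| ^+ 1)%:E <= (D * B)%:E)%E.
Proof.
move=> hD B0; have mg : measurable_fun setT (fun p : V * V => (\1_trim_set p.2 * `|Kminus chi T p.2 p.1|)%:E).
  exact/measurable_EFinP.
apply: (@le_trans _ _ (\int[sigma]_x \int[sigma]_z (\1_trim_set z * `|Kminus chi T z x|)%:E)%E).
  apply: (le_surface_integral hs).
  - by apply/measurable_EFinP; apply: measurable_funX; apply: measurableT_comp => //; exact: measurable_trim_bias.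
  - apply: (measurable_surface_integral hs mg) => z; by rewrite lee_fin mulr_ge0.
  - by move=> x; rewrite lee_fin.
  - by move=> x; apply: integral_ge0 => z _; rewrite lee_fin mulr_ge0.
  - move=> x sx _; rewrite expr1 -trim_biasE // lee_fin ger0_norm //.
    by apply: Rintegral_ge0 => z _; rewrite mulr_ge0.
rewrite (surface_tonelli2 hs mg); last by move=> z; rewrite lee_fin mulr_ge0.
rewrite /= mulrC EFinM; apply: le_trans (lee_wpmul2l _ hD); last by rewrite lee_fin.
rewrite -(setIT trim_set) -(integral_indic _ measurableT measurable_trim_set) -ge0_integralZl_EFin //; last first.
  by apply/measurable_EFinP; exact: measurable_indic measurable_trim_set.
rewrite setIT; apply: (le_surface_integral hs).
- apply: (measurable_surface_integral hs (f := fun p => (\1_trim_set p.1 * `|Kminus chi T p.1 p.2|)%:E)).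
    apply/measurable_EFinP; apply: measurable_funM.
      exact: (measurableT_comp (measurable_indic measurable_trim_set)).
    by apply: measurableT_comp => //; exact: measurable_Kminus.
  by move=> z; rewrite lee_fin mulr_ge0.
- by apply: measurable_funeM; apply/measurable_EFinP; exact: measurable_indic measurable_trim_set.
- by move=> z; apply: integral_ge0 => x _; rewrite lee_fin mulr_ge0.
- by move=> z; rewrite mule_ge0 // lee_fin.
move=> z sz _; under eq_integral do rewrite EFinM.
rewrite ge0_integralZl_EFin //; last by apply/measurable_EFinP; apply: measurableT_comp => //; exact: measurable_Kminus.
rewrite muleC lee_wpmul2r ?lee_fin //.
by under eq_integral do rewrite Kminus_sym; exact: Kminus_L1.
Qed.

Hypothesis mR : measurable_fun setT (Rfun sigma fbeta).

Let mu_ x : measurable_fun setT (fun z => Kminus chi T z x / trim_max z).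
Proof. by apply: measurable_funM => //; exact: measurable_trim_maxV. Qed.

Let u_le x : sphere x -> forall z, sphere z -> `|Kminus chi T z x / trim_max z| <= A * T%:R ^+ k.+1 / t.
Proof.
move=> sx z sz; rewrite normrM (ger0_norm (trim_maxV_ge0 _)).
by apply: ler_pM => //; [exact: trim_maxV_ge0|exact: hA|exact: trim_maxV_le].
Qed.

Let P_integrable (Y : Omega -> R) (c : R) : measurable_fun setT Y -> (forall w, `|Y w| <= c) ->
  P.-integrable setT (EFin \o Y).
Proof.
move=> mY Yc; apply: measurable_bounded_integrable => //.
  exact: le_lt_trans (probability_le1 P measurableT) (ltry _).
exists c; split; first exact: num_real.
by move=> x cx w _ /=; apply: le_trans (Yc w) (ltW _).
Qed.

Lemma psi_mean i x : sphere x -> \int[P]_w psi x (Z i false w, Z i true w) =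
  \int[sigma]_z ((2 * rfun sigma fbeta z - 1) * (Kminus chi T z x / trim_max z) * fX z).
Proof.
move=> sx; pose u z := Kminus chi T z x / trim_max z.
have mX := sample_measurable hM i false; have mb := sample_measurable hM i true.
have muX : measurable_fun setT (fun w => u (Z i false w)) by exact: (measurableT_comp (mu_ x) mX).
have mi : measurable_fun setT (fun w => (0 <= dotv (Z i false w) (Z i true w))%R%:R : R).
  exact: measurable_dotv_ge0.
have uX w : `|u (Z i false w)| <= A * T%:R ^+ k.+1 / t by apply: u_le => //; exact: (sample_sphere hM).
have h1 := Rintegral_sample hs hM fXB i true (mu_ x) (u_le sx).
have h2 := Rintegral_sample hs hM fXB i false (mu_ x) (u_le sx).
have mr := measurable_rfun hs hM.
transitivity (2 * \int[P]_w ((0 <= dotv (Z i false w) (Z i true w))%R%:R * u (Z i false w)) -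
   \int[P]_w (1 * u (Z i false w))).
  have i1 : P.-integrable setT (EFin \o (fun w => (0 <= dotv (Z i false w) (Z i true w))%R%:R * u (Z i false w))).
    apply: (@P_integrable _ (A * T%:R ^+ k.+1 / t)); first exact: measurable_funM.
    by move=> w; apply: le_trans (uX w); rewrite normrM; case: (0 <= dotv _ _); rewrite ?normr1 ?mul1r ?normr0 ?mul0r.
  rewrite -RintegralZl // -RintegralB //.
  - by apply: eq_Rintegral => w _; rewrite /psi /u /=; ring.
  - apply: (@P_integrable _ (2 * (A * T%:R ^+ k.+1 / t))); first by apply: measurable_funM => //; exact: measurable_funM.
    move=> w; rewrite normrM ger0_norm // ler_wpM2l //.
    by apply: le_trans (uX w); rewrite normrM; case: (0 <= dotv _ _); rewrite ?normr1 ?mul1r ?normr0 ?mul0r.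
  - apply: (@P_integrable _ (A * T%:R ^+ k.+1 / t)); first exact: measurable_funM.
    by move=> w; rewrite mul1r.
rewrite h1 h2.
have c0 : 0 <= A * T%:R ^+ k.+1 / t := le_trans (normr_ge0 _) (u_le sx sx).
have i1 (r1 : V -> R) : measurable_fun setT r1 -> (forall z, 0 <= r1 z <= 1) ->
    sigma.-integrable setT (EFin \o (fun z => r1 z * u z * fX z)).
  move=> mr1 hr1; apply: (surface_integrable hs (c := A * T%:R ^+ k.+1 / t * Bf)).
    by apply: measurable_funM => //; apply: measurable_funM => //; exact: mu_.
  move=> z sz; have /andP[r0 r11] := hr1 z.
  rewrite normrM (ger0_norm (fX0 z)) ler_pM // ?fXB // normrM (ger0_norm r0).
  by apply: le_trans (u_le sx sz); rewrite ler_piMl.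
have i2 := i1 _ mr (rfun_ge0_le1 hM).
have i3 : sigma.-integrable setT (EFin \o (fun z => 1 * u z * fX z)).
  by apply: (i1 (fun=> 1)) => // z; rewrite ler01 lexx.
rewrite -RintegralZl // -RintegralB //; last first.
  have := integrableZl measurableT 2 i2; apply: eq_integrable => // z _.
by apply: eq_Rintegral => z _; rewrite /u /=; ring.
Qed.

Definition sphere_bias (x : V) : R :=
  Kop sigma chi (2 * T) (Rfun sigma fbeta) x - Rfun sigma fbeta x.

Let Kker_bounded (x : V) : sphere x -> exists c : R, forall y : V, sphere y -> `|Kker chi (2 * T) x y| <= c.
Proof.
move=> sx; exists (\sum_(n < (2 * T).+1) hdim R n (dimd k) / `|surf_area R (dimd k)|) => y sy.
apply: le_trans (ler_norm_sum _ _ _) _; apply: ler_sum => n _.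
have /andP[c0 c1] := chi01 n (2 * T)%N; have := qker_le n sx sy.
by apply: le_trans; rewrite normrM (ger0_norm c0) ler_piMl.
Qed.

Let KkerNl n (x y : V) : Kker chi n (- x) y = Kker chi n x (- y).
Proof. by apply: eq_bigr => i _; rewrite /qker dotvNl dotvNr. Qed.

(** The odd kernel is half of K_2T(x, .) - K_2T(-x, .), so the integral is half the difference of
    K_2T R at x and at -x. *)
Let Kminus_smooth x : sphere x ->
  \int[sigma]_z (Rfun sigma fbeta z * Kminus chi T z x) =
  (sphere_bias x - sphere_bias (- x)) / 2 + (Rfun sigma fbeta x - Rfun sigma fbeta (- x)) / 2.
Proof.
move=> sx; set f := Rfun sigma fbeta.
have f1 z : `|f z| <= 1.
  by have /andP[h1 h2] := Rfun_ge0_le1 hM z; rewrite ger0_norm.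
have mK : measurable_fun setT (fun y : V => Kker chi (2 * T) x y) by exact: measurable_Kker.
have mKN : measurable_fun setT (fun y : V => Kker chi (2 * T) x (- y)).
  exact: (measurableT_comp mK (@measurable_oppv R k)).
have [c hc] := Kker_bounded sx.
have iK : sigma.-integrable setT (EFin \o (fun y => Kker chi (2 * T) x y * f y)).
  apply: (surface_integrable hs (c := c)); first exact: measurable_funM.
  by move=> y sy; apply: le_trans (hc y sy); rewrite normrM ler_piMr.
have iKN : sigma.-integrable setT (EFin \o (fun y => Kker chi (2 * T) x (- y) * f y)).
  apply: (surface_integrable hs (c := c)); first exact: measurable_funM.
  by move=> y sy; apply: le_trans (hc _ (sphereN sy)); rewrite normrM ler_piMr.
have -> : (sphere_bias x - sphere_bias (- x)) / 2 + (f x - f (- x)) / 2 =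
    2^-1 * (Kop sigma chi (2 * T) f x - Kop sigma chi (2 * T) f (- x)).
  by rewrite /sphere_bias -/f; ring.
rewrite /Kop -RintegralB //; last first.
  by apply: eq_integrable iKN => // y _ /=; rewrite KkerNl.
rewrite -RintegralZl //; last first.
  have := integrableB measurableT iK iKN; apply: eq_integrable => // y _ /=.
  by rewrite KkerNl.
apply: (eq_surface_Rintegral hs).
- by apply: measurable_funM.
- apply: measurable_funM => //; apply: measurable_funB; apply: measurable_funM => //.
  exact: measurable_Kker.
move=> y sy _; rewrite KkerNl Kminus_sym Kminus_odd //; ring.
Qed.

(** Adding an integrand to its reflection folds H+ over the sphere: off the equator 2R - 1 and the
    odd kernel both change sign under z -> -z. The constant in 2R - 1 integrates to 0 against the
    odd kernel. *)
Let half_sphere x : sphere x ->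
  \int[sigma]_z ((if 0 <= first z then 2 * Rfun sigma fbeta z - 1 else 0) * Kminus chi T z x) =
  \int[sigma]_z (Rfun sigma fbeta z * Kminus chi T z x).
Proof.
move=> sx; set f := Rfun sigma fbeta; set G := fun z => if 0 <= first z then 2 * f z - 1 else 0.
have f01 z : 0 <= f z <= 1 := Rfun_ge0_le1 hM z.
have mG : measurable_fun setT G.
  apply: measurable_fun_ifT => //; first by apply: measurable_fun_ler => //; exact: measurable_first.
  by apply: measurable_funB => //; exact: measurable_funM.
have G1 z : `|G z| <= 1.
  by rewrite /G; case: ifP; rewrite ?normr0 // ler_norml; have /andP[? ?] := f01 z => _; apply/andP; split; lra.
set c := A * T%:R ^+ k.+1.
have ic (h : V -> R) : measurable_fun setT h -> (forall z, `|h z| <= 1) ->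
    sigma.-integrable setT (EFin \o (fun z => h z * Kminus chi T z x)).
  move=> mh h1; apply: (surface_integrable hs (c := c)); first exact: measurable_funM.
  by move=> z sz; rewrite normrM; apply: le_trans (hA T0 sz sx); rewrite ler_piMl.
have mo := @measurable_oppv R k.
pose H z := G z * Kminus chi T z x.
have mH : measurable_fun setT H by exact: measurable_funM.
have iH := ic _ mG G1.
have H2 : \int[sigma]_z H (- z) = \int[sigma]_z H z by exact: (surface_Rintegral_opp hs).
have mHN : measurable_fun setT (fun z : V => H (- z)) by exact: (measurableT_comp mH mo).
have KN z : sphere z -> Kminus chi T (- z) x = - Kminus chi T z x.
  by move=> sz; rewrite Kminus_sym KminusN // Kminus_sym.
have iHN : sigma.-integrable setT (EFin \o (fun z : V => H (- z))).
  apply: (surface_integrable hs (c := c)) => // z sz; rewrite /H KN // normrM normrN.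
  by apply: le_trans (hA T0 sz sx); rewrite ler_piMl.
have i1 : sigma.-integrable setT (EFin \o (fun z => 1 * Kminus chi T z x)).
  by apply: (ic (fun=> 1)) => // z; rewrite normr1.
have if_ : sigma.-integrable setT (EFin \o (fun z => f z * Kminus chi T z x)).
  by apply: ic => // z; have /andP[h1 h2] := f01 z; rewrite ger0_norm.
have K0 : \int[sigma]_z (1 * Kminus chi T z x) = 0.
  have m1K : measurable_fun setT (fun z => 1 * Kminus chi T z x) by exact: measurable_funM.
  have h1 : \int[sigma]_z (1 * Kminus chi T (- z) x) = \int[sigma]_z (1 * Kminus chi T z x).
    exact: (surface_Rintegral_opp hs m1K).
  have h2 : \int[sigma]_z (1 * Kminus chi T (- z) x) = -1 * \int[sigma]_z (1 * Kminus chi T z x).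
    rewrite -RintegralZl //; apply: (eq_surface_Rintegral hs).
    - exact: (measurableT_comp m1K mo).
    - exact: measurable_funM.
    - by move=> z sz _; rewrite KN //; ring.
  by move: h1; rewrite h2; set I := \int[sigma]_z _ => h1; lra.
have HH : \int[sigma]_z H z + \int[sigma]_z H (- z) =
    2 * \int[sigma]_z (f z * Kminus chi T z x) - \int[sigma]_z (1 * Kminus chi T z x).
  have i2f : sigma.-integrable setT (EFin \o (fun z => 2 * (f z * Kminus chi T z x))).
    by have := integrableZl measurableT 2 if_; apply: eq_integrable => // z _.
  rewrite -RintegralD // -RintegralZl // -RintegralB //.
  apply: (eq_surface_Rintegral hs).
  - exact: measurable_funD.
  - by apply: measurable_funB; apply: measurable_funM => //; exact: measurable_funM.
  move=> z sz z0; rewrite /H KN // /G -/f.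
  have -> : first (- z) = - first z by rewrite /first mxE.
  have -> : f (- z) = 1 - f z by exact: RfunN.
  by rewrite oppr_ge0; case: ltgtP z0 => //= _ _; ring.
by move: HH; rewrite H2 K0 /H; set I := \int[sigma]_z _; set J := \int[sigma]_z _ => HH; lra.
Qed.

(** With weight 1 in place of [fX / max (fX, t)] the mean would be exactly the smoothed odd part. On
    H+ the weight differs from 1 only on [trim_set], and there by at most 1. *)
Lemma psi_mean_bias i x : sphere x -> first x != 0 ->
  `|\int[P]_w psi x (Z i false w, Z i true w) + 1 / 2 - Rfun sigma fbeta x
    - (sphere_bias x - sphere_bias (- x)) / 2| <= trim_bias x.
Proof.
move=> sx x0; rewrite psi_mean //; set f := Rfun sigma fbeta.
pose G z := if 0 <= first z then 2 * f z - 1 else 0.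
have f01 z : 0 <= f z <= 1 := Rfun_ge0_le1 hM z.
have mG : measurable_fun setT G.
  apply: measurable_fun_ifT => //; first by apply: measurable_fun_ler => //; exact: measurable_first.
  by apply: measurable_funB => //; exact: measurable_funM.
have G1 z : `|G z| <= 1.
  by rewrite /G; case: ifP; rewrite ?normr0 // ler_norml; have /andP[? ?] := f01 z => _; apply/andP; split; lra.
pose wt z := fX z / trim_max z.
have mwt : measurable_fun setT wt by apply: measurable_funM => //; exact: measurable_trim_maxV.
have wt0 z : 0 <= wt z by rewrite mulr_ge0 // trim_maxV_ge0.
have wt1 z : wt z <= 1 by exact: fX_trim_max.
set c := A * T%:R ^+ k.+1.
have -> : \int[sigma]_z ((2 * rfun sigma fbeta z - 1) * (Kminus chi T z x / trim_max z) * fX z) =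
    \int[sigma]_z (G z * Kminus chi T z x * wt z).
  apply: (eq_surface_Rintegral hs).
  - apply: measurable_funM => //; apply: measurable_funM; last exact: mu_.
    by apply: measurable_funB => //; apply: measurable_funM => //; exact: (measurable_rfun hs hM).
  - by apply: measurable_funM => //; exact: measurable_funM.
  move=> z sz z0; rewrite /G /wt /f /Rfun; have [h|h] := boolP (0 <= first z); first by ring.
  have -> : fX z = 0.
    by case: hM => _ _ _ _ [_ N0]; apply: N0 => //; rewrite ltNge.
  by rewrite !(mul0r, mulr0).
have -> : \int[sigma]_z (G z * Kminus chi T z x * wt z) + 1 / 2 - f x - (sphere_bias x - sphere_bias (- x)) / 2 =
    \int[sigma]_z (G z * Kminus chi T z x * (wt z - 1)).
  have hb := Kminus_smooth sx; rewrite -half_sphere // -/f -/G in hb.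
  have fN : f (- x) = 1 - f x by exact: RfunN.
  have iH (h : V -> R) : measurable_fun setT h -> (forall z, `|h z| <= 1) ->
      sigma.-integrable setT (EFin \o (fun z => G z * Kminus chi T z x * h z)).
    move=> mh h1; apply: (surface_integrable hs (c := c)); first by apply: measurable_funM => //; exact: measurable_funM.
    move=> z sz; apply: le_trans (hA T0 sz sx).
    rewrite normrM -[leRHS]mulr1 ler_pM // normrM ler_piMl //.
  have -> : \int[sigma]_z (G z * Kminus chi T z x * (wt z - 1)) =
     \int[sigma]_z (G z * Kminus chi T z x * wt z) - \int[sigma]_z (G z * Kminus chi T z x * 1).
    rewrite -RintegralB //; first by apply: eq_Rintegral => z _; ring.
      by apply: iH => // z; rewrite ger0_norm.
    by apply: (iH (fun=> 1)) => // z; rewrite normr1.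
  have -> : \int[sigma]_z (G z * Kminus chi T z x * 1) = \int[sigma]_z (G z * Kminus chi T z x).
    by apply: eq_Rintegral => z _; rewrite mulr1.
  by rewrite hb fN; field.
rewrite -lee_fin trim_biasE //; apply: (le_normr_surface_Rintegral hs (c := c)).
- by apply: measurable_funM => //; [exact: measurable_funM|exact: measurable_funB].
- exact: (measurableT_comp mtb (measurable_pair1 x)).
- move=> z sz; apply: le_trans (hA T0 sz sx).
  rewrite normrM -[leRHS]mulr1 ler_pM // ?normrM ?ler_piMl // ler_norml.
  by have h0 := wt0 z; have h1 := wt1 z; apply/andP; split; lra.
- by move=> z; rewrite mulr_ge0.
move=> z sz z0; rewrite indicE; case: (boolP (z \in trim_set)) => hz.
  rewrite mul1r normrM -[leRHS]mulr1 ler_pM // ?normrM ?ler_piMl // ler_norml.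
  by have h0 := wt0 z; have h1 := wt1 z; apply/andP; split; lra.
rewrite mul0r; suff -> : G z * Kminus chi T z x * (wt z - 1) = 0 by rewrite normr0.
rewrite /G; case: ifPn => hf; last by rewrite !mul0r.
suff -> : wt z = 1 by rewrite subrr mulr0.
have hX : t <= fX z.
  by rewrite leNgt; apply/negP => hX; move/negP: hz; apply; rewrite inE.
by rewrite /wt /trim_max max_l // divff // gt_eqF // (lt_le_trans t0).
Qed.

End TrimmedKernel.

(** * Deviations uniform over the sphere *)

Section SphereNet.
Variables (R : realType) (k : nat).
Notation V := (Vec R k).

Lemma sphere_coord (x : V) i : sphere x -> -1 <= x ord0 i <= 1.
Proof.
rewrite /sphere /= => hx; rewrite -ler_norml -(ler_pXn2r (n := 2)) ?nnegrE // expr1n.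
rewrite real_normK ?num_real // -hx /dotv (bigD1 i) //= -expr2 lerDl.
by apply: sumr_ge0 => j _; rewrite -expr2 sqr_ge0.
Qed.

Lemma sphere_nonempty : exists e : V, sphere e.
Proof.
exists (delta_mx ord0 ord0); rewrite /sphere /= /dotv (bigD1 ord0) //= big1 ?addr0 => [|i i0].
  by rewrite !mxE !eqxx mulr1.
by rewrite !mxE (negbTE i0) andbF mulr0.
Qed.

Lemma enorm_le (x : V) (c : R) : 0 <= c -> (forall i, `|x ord0 i| <= c) -> enorm x <= (dimd k)%:R * c.
Proof.
move=> c0 h; have dc : 0 <= (dimd k)%:R * c by rewrite mulr_ge0.
rewrite /enorm -[leRHS]ger0_norm // -sqrtr_sqr ler_wsqrtr //.
apply: (@le_trans _ _ (\sum_(i < dimd k) c ^+ 2)).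
  apply: ler_sum => i _; rewrite -expr2 -[x _ _ ^+ 2]real_normK ?num_real //.
  by rewrite lerXn2r ?nnegrE.
rewrite sumr_const card_ord exprMn -[leLHS]mulr_natl ler_wpM2r ?sqr_ge0 //.
by rewrite -natrX ler_nat expnS expn1 leq_pmulr.
Qed.

Lemma enorm_ge0 (x : V) : 0 <= enorm x.
Proof. exact: sqrtr_ge0. Qed.

(** Grid points need not lie on the sphere, so each cell meeting the sphere is represented by one of
    its own points on the sphere. *)
Lemma sphere_net (m : nat) : (0 < m)%N ->
  exists pts : {ffun 'I_(dimd k) -> 'I_m.+1} -> V, (forall c, sphere (pts c)) /\
   forall x, sphere x -> exists c, enorm (x - pts c) <= (dimd k)%:R * (2 / m%:R).
Proof.
move=> m0; have mR : 0 < m%:R :> R by rewrite ltr0n.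
pose s (x : V) i : R := (x ord0 i + 1) / 2 * m%:R.
(* Coordinates in [-1, 1] have been rescaled to [0, m] and are truncated; the value m, reached at
   coordinate 1, requires m + 1 indices. *)
pose cell (x : V) : {ffun 'I_(dimd k) -> 'I_m.+1} := [ffun i => inord (Num.truncn (s x i))].
have [e he] := sphere_nonempty.
(* Cells missing the sphere receive the default point [e]. *)
pose pts c : V := match pselect (exists y : V, sphere y /\ cell y = c) with
  | left h => projT1 (cid h) | right _ => e end.
have ptsP c : sphere (pts c).
  by rewrite /pts; case: pselect => // h; case: (cid h) => y [].
exists pts; split => // x sx; exists (cell x).
have [sy cy] : sphere (pts (cell x)) /\ cell (pts (cell x)) = cell x.
  rewrite /pts; case: pselect => [h|]; first by case: (cid h) => y [].
  by case; exists x.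
apply: enorm_le => [|i]; first by rewrite divr_ge0.
have s0 (z : V) : sphere z -> 0 <= s z i.
  move=> /(sphere_coord i)/andP[h _]; rewrite /s mulr_ge0 // divr_ge0 //; lra.
have sm (z : V) : sphere z -> s z i <= m%:R.
  move=> /(sphere_coord i)/andP[_ h]; rewrite /s ler_piMl // ler_pdivrMr //; lra.
have tm (z : V) : sphere z -> (Num.truncn (s z i) < m.+1)%N.
  by move=> sz; rewrite ltnS -(ler_nat R); apply: le_trans (sm _ sz); rewrite truncn_le // s0.
have e1 : Num.truncn (s (pts (cell x)) i) = Num.truncn (s x i).
  have := congr1 (fun f : {ffun 'I_(dimd k) -> 'I_m.+1} => nat_of_ord (f i)) cy.
  by rewrite !ffunE !inordK ?tm.
have := truncn_itv (s0 _ sx); have := truncn_itv (s0 _ sy); rewrite e1.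
set y := pts (cell x); move=> /andP[h1 h2] /andP[h3 h4].
rewrite !mxE ler_norml.
have hs' : -1 <= s x i - s y i <= 1.
  move: h1 h2 h3 h4; rewrite -!nat1r => h1 h2 h3 h4; apply/andP; split; lra.
have xy : x ord0 i - y ord0 i = (s x i - s y i) * (2 / m%:R).
  by rewrite /s; field; rewrite gt_eqF.
rewrite xy; have c0 : 0 <= 2 / m%:R :> R by rewrite divr_ge0.
move: hs' => /andP[g1 g2]; apply/andP; split.
  by rewrite -[leLHS]mulN1r ler_wpM2r.
by rewrite -[leRHS]mul1r ler_wpM2r.
Qed.
End SphereNet.

Lemma measure_bigsetU_le (R : realType) d (T : measurableType d) (mu : {measure set T -> \bar R})
  (I : Type) (s : seq I) (E : I -> set T) : (forall i, measurable (E i)) ->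
  (mu (\big[setU/set0]_(i <- s) E i) <= \sum_(i <- s) mu (E i))%E.
Proof.
move=> mE; elim: s => [|i s IH]; first by rewrite !big_nil measure0.
rewrite !big_cons; apply: le_trans (measureU2 _ (mE i) _) _; first exact: bigsetU_measurable.
exact: leeD2l.
Qed.

(** * Empirical means indexed by the points of the sphere *)

Section UniformDeviation.
Variables (R : realType) (k : nat).
Notation V := (Vec R k).
Context (dO : measure_display) (Omega : measurableType dO).
Variable P : probability Omega R.
Variable Z : nat -> bool -> Omega -> V.
Hypothesis mZ : forall i b, measurable_fun setT (Z i b).
Hypothesis hZ : mutually_independent P (fun ib : nat * bool => Z ib.1 ib.2).
Variables (phi : V -> V * V -> R) (m : V -> R) (b v L : R).
Hypothesis mphi : measurable_fun setT (fun xp : V * (V * V) => phi xp.1 xp.2).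
Hypothesis mm : measurable_fun setT m.
Hypothesis phi_b : forall i w x, sphere x -> `|phi x (Z i false w, Z i true w)| <= b.
Hypothesis phi_v : forall i x, sphere x -> (\int[P]_w (phi x (Z i false w, Z i true w) ^+ 2)%:E <= v%:E)%E.
Hypothesis phi_L : forall i w x y, sphere x -> sphere y ->
  `|phi x (Z i false w, Z i true w) - phi y (Z i false w, Z i true w)| <= L * enorm (x - y).
Hypothesis phi_m : forall i x, sphere x -> \int[P]_w phi x (Z i false w, Z i true w) = m x.

Definition dev (N : nat) (w : Omega) (x : V) : R :=
  N%:R^-1 * \sum_(i < N) phi x (Z i false w, Z i true w) - m x.

Let W i w := (Z i false w, Z i true w).
Let mW i : measurable_fun setT (W i). Proof. exact: measurable_fun_pair. Qed.
Let mphix x : measurable_fun setT (phi x).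
Proof. exact: (measurableT_comp mphi (measurable_pair1 x)). Qed.
Let mphiW x i : measurable_fun setT (fun w => phi x (W i w)).
Proof. exact: (measurableT_comp (mphix x) (mW i)). Qed.

Let P_integrable (Y : Omega -> R) (c : R) : measurable_fun setT Y -> (forall w, `|Y w| <= c) ->
  P.-integrable setT (EFin \o Y).
Proof.
move=> mY Yc; apply: measurable_bounded_integrable => //.
  exact: le_lt_trans (probability_le1 P measurableT) (ltry _).
exists c; split; first exact: num_real.
by move=> x cx w _ /=; apply: le_trans (Yc w) (ltW _).
Qed.

Let P_cst (c : R) : \int[P]_w c = c.
Proof. by rewrite /Rintegral integral_cst_prob. Qed.

Let P_icst (c : R) : P.-integrable setT (EFin \o (fun _ : Omega => c)).
Proof. exact: (@P_integrable _ `|c|). Qed.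

Lemma measurable_dev N : measurable_fun setT (fun wx : Omega * V => dev N wx.1 wx.2).
Proof.
apply: measurable_funB; last exact: (measurableT_comp mm).
apply: measurable_funM => //; apply: measurable_sum => i.
have h : measurable_fun setT (fun wx : Omega * V => (wx.2, W i wx.1)).
  by apply: measurable_fun_pair => //; exact: (measurableT_comp (mW i)).
exact: (measurableT_comp mphi h).
Qed.

Let b0 : 0 <= b.
Proof.
by have [e he] := @sphere_nonempty R k; exact: le_trans (normr_ge0 _) (phi_b 0%N point he).
Qed.

Let intphi x i : sphere x -> P.-integrable setT (EFin \o (fun w => phi x (W i w))).
Proof. by move=> sx; apply: (@P_integrable _ b) => // w; exact: phi_b. Qed.

Let m_le x : sphere x -> `|m x| <= b.
Proof.
move=> sx; rewrite -(phi_m 0 sx); apply: le_trans (le_normr_Rintegral _ (intphi 0 sx)) _ => //.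
rewrite -[leRHS]P_cst; apply: le_Rintegral => //.
- apply: (@P_integrable _ b); first exact: measurableT_comp.
  by move=> w; rewrite normr_id; exact: phi_b.
- by move=> w _; exact: phi_b.
Qed.

Lemma mean_lip x y : sphere x -> sphere y -> `|m x - m y| <= L * enorm (x - y).
Proof.
move=> sx sy; rewrite -(phi_m 0 sx) -(phi_m 0 sy) -RintegralB //; [|exact: intphi|exact: intphi].
have ib : P.-integrable setT (EFin \o (fun w => phi x (W 0 w) - phi y (W 0 w))).
  apply: (@P_integrable _ (L * enorm (x - y))); first exact: measurable_funB.
  by move=> w; exact: phi_L.
apply: le_trans (le_normr_Rintegral _ ib) _ => //.
rewrite -[leRHS]P_cst; apply: le_Rintegral => //.
- apply: (@P_integrable _ (L * enorm (x - y))); first by apply: measurableT_comp => //; exact: measurable_funB.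
  by move=> w; rewrite normr_id; exact: phi_L.
- by move=> w _; exact: phi_L.
Qed.

Let phic x p := phi x p - m x.
Let mphic x : measurable_fun setT (phic x).
Proof. exact: measurable_funB. Qed.

(** Centring at most doubles the sup bound, whence the constraint [l * (2 * b) <= 1 / 2] below. *)
Let phic_b x : sphere x -> forall i w, `|phic x (Z i false w, Z i true w)| <= 2 * b.
Proof.
move=> sx i w; rewrite mulr_natl mulr2n; apply: le_trans (ler_normB _ _) _.
by apply: lerD; [exact: phi_b|exact: m_le].
Qed.

Let phic_0 x : sphere x -> forall i, (\int[P]_w (phic x (Z i false w, Z i true w))%:E = 0)%E.
Proof.
move=> sx i; have iphi := intphi i sx.
have : \int[P]_w phic x (Z i false w, Z i true w) = 0.
  by rewrite /phic RintegralB // phi_m // P_cst subrr.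
move=> h; rewrite -[0%E]/(0%:E) -h /Rintegral fineK //; apply: integrable_fin_num => //.
apply: (@P_integrable _ (2 * b)); last by move=> w; exact: phic_b.
exact: (measurableT_comp (mphic x) (mW i)).
Qed.

Let phic_v x : sphere x -> forall i, (\int[P]_w (phic x (Z i false w, Z i true w) ^+ 2)%:E <= v%:E)%E.
Proof.
move=> sx i; have iphi := intphi i sx.
have ip2 : P.-integrable setT (EFin \o (fun w => phi x (W i w) ^+ 2)).
  apply: (@P_integrable _ (b ^+ 2)); first exact: measurable_funX.
  by move=> w; rewrite normrX lerXn2r ?nnegrE //; exact: phi_b.
have im : P.-integrable setT (EFin \o (fun w => 2 * m x * phi x (W i w))).
  by have := integrableZl measurableT (2 * m x) iphi; apply: eq_integrable.
have im2 : P.-integrable setT (EFin \o (fun w => 2 * m x * phi x (W i w) - m x ^+ 2)).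
  by have := integrableB measurableT im (P_icst (m x ^+ 2)); apply: eq_integrable.
have e : \int[P]_w (phic x (W i w) ^+ 2) = \int[P]_w (phi x (W i w) ^+ 2) - m x ^+ 2.
  transitivity (\int[P]_w (phi x (W i w) ^+ 2 - (2 * m x * phi x (W i w) - m x ^+ 2))).
    by apply: eq_Rintegral => w _; rewrite /phic; ring.
  rewrite (RintegralB measurableT ip2 im2) (RintegralB measurableT im (P_icst (m x ^+ 2))).
  by rewrite RintegralZl // phi_m // P_cst; ring.
have fin1 : (\int[P]_w (phic x (W i w) ^+ 2)%:E)%E \is a fin_num.
  apply: integrable_fin_num => //; apply: (@P_integrable _ ((2 * b) ^+ 2)).
    by apply: measurable_funX; exact: (measurableT_comp (mphic x) (mW i)).
  by move=> w; rewrite normrX lerXn2r ?nnegrE ?mulr_ge0 //; exact: phic_b.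
rewrite -(fineK fin1) lee_fin -/(Rintegral _ _ _) e.
apply: (@le_trans _ _ (\int[P]_w (phi x (W i w) ^+ 2))); first by rewrite gerBl sqr_ge0.
by rewrite -lee_fin /Rintegral fineK; [exact: phi_v|exact: integrable_fin_num].
Qed.

Let dev_sum N w x : (0 < N)%N -> dev N w x = N%:R^-1 * sample_sum Z (phic x) N w.
Proof.
move=> N0; rewrite /dev /sample_sum /phic sumrB sumr_const card_ord mulrBr -[m x *+ N]mulr_natl mulKf //.
by rewrite pnatr_eq0 -lt0n.
Qed.

Lemma dev_tail (l s : R) x N : (0 < N)%N -> sphere x -> 0 <= l -> l * (2 * b) <= 1 / 2 ->
  (P [set w | (s <= `|dev N w x|)%R] <= (2 * expR (2 * l ^+ 2 * v * N%:R - l * (N%:R * s)))%:E)%E.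
Proof.
move=> N0 sx l0 lb; have NR : 0 < N%:R :> R by rewrite ltr0n.
rewrite (_ : [set w | _] = [set w | (N%:R * s <= `|sample_sum Z (phic x) N w|)%R]).
  exact: (sample_sum_tail mZ hZ (mphic x) (phic_b sx) (phic_0 sx) (phic_v sx)).
apply/seteqP; split => w /=; rewrite dev_sum // normrM gtr0_norm ?invr_gt0 //;
  by rewrite ler_pdivlMl.
Qed.

Lemma dev_sqr (l : R) x N : (0 < N)%N -> sphere x -> 0 < l -> l * (2 * b) <= 1 / 2 ->
  (\int[P]_w (dev N w x ^+ 2)%:E <= (8 / (l * N%:R) ^+ 2 * expR (2 * l ^+ 2 * v * N%:R))%:E)%E.
Proof.
move=> N0 sx l0 lb; have NR : 0 < N%:R :> R by rewrite ltr0n.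
under eq_integral do rewrite dev_sum // exprMn EFinM.
rewrite ge0_integralZl_EFin //; last 2 first.
- by move=> w _; rewrite lee_fin sqr_ge0.
- by apply/measurable_EFinP; apply: measurable_funX; exact: measurable_sample_sum.
apply: le_trans (lee_wpmul2l _ (sample_sum_sqr mZ hZ (mphic x) (phic_b sx) (phic_0 sx) (phic_v sx) N l0 lb)) _.
  by rewrite lee_fin sqr_ge0.
rewrite -EFinM lee_fin mulrA ler_wpM2r ?expR_ge0 // le_eqVlt; apply/orP; left; apply/eqP.
by field; rewrite !gt_eqF.
Qed.

Lemma dev_lip N w x y : (0 < N)%N -> sphere x -> sphere y ->
  `|dev N w x - dev N w y| <= 2 * (L * enorm (x - y)).
Proof.
move=> N0 sx sy; have NR : 0 < N%:R :> R by rewrite ltr0n.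
have -> : dev N w x - dev N w y =
   N%:R^-1 * \sum_(i < N) (phi x (W i w) - phi y (W i w)) - (m x - m y).
  by rewrite /dev sumrB; ring.
rewrite mulr_natl mulr2n; apply: le_trans (ler_normB _ _) _; apply: lerD; last exact: mean_lip.
rewrite normrM gtr0_norm ?invr_gt0 // mulrC ler_pdivrMr //.
apply: le_trans (ler_norm_sum _ _ _) _; rewrite mulr_natr -[X in _ *+ X]card_ord -sumr_const.
by apply: ler_sum => i _; exact: phi_L.
Qed.

(** Union bound over the net, then the Lipschitz bound between a point and its representative. The
    event is an explicit finite union, so measurability of the supremum over the sphere never
    arises. *)
Lemma dev_sup_event (l s : R) (g N : nat) : (0 < g)%N -> (0 < N)%N -> 0 <= L -> 0 <= l -> l * (2 * b) <= 1 / 2 ->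
  exists E : set Omega, [/\ measurable E,
    (P E <= ((g.+1 ^ dimd k)%N%:R * (2 * expR (2 * l ^+ 2 * v * N%:R - l * (N%:R * s))))%:E)%E &
    forall w, ~ E w -> forall x, sphere x -> `|dev N w x| <= s + 2 * (L * ((dimd k)%:R * (2 / g%:R)))].
Proof.
move=> g0 N0 L0 l0 lb; have [pts [spts hpts]] := @sphere_net R k g g0.
pose E c := [set w | (s <= `|dev N w (pts c)|)%R].
have mE c : measurable (E c).
  have md : measurable_fun setT (fun w => `|dev N w (pts c)|).
    apply: measurableT_comp => //.
    exact: (measurableT_comp (measurable_dev N) (measurable_pair2 (pts c))).
  rewrite (_ : E c = (fun w => `|dev N w (pts c)|) @^-1` `[s, +oo[%classic).
    by rewrite -[X in measurable X]setTI; exact: md.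
  by apply/seteqP; split => w /=; rewrite in_itv /= andbT.
exists (\big[setU/set0]_(c : {ffun 'I_(dimd k) -> 'I_g.+1}) E c); split.
- exact: bigsetU_measurable.
- apply: le_trans (measure_bigsetU_le P _ mE) _.
  apply: (@le_trans _ _ (\sum_(c : {ffun 'I_(dimd k) -> 'I_g.+1})
     (2 * expR (2 * l ^+ 2 * v * N%:R - l * (N%:R * s)))%:E)%E).
    by apply: lee_sum => c _; exact: dev_tail.
  by rewrite sumEFin lee_fin sumr_const card_ffun !card_ord -[leLHS]mulr_natl.
move=> w hw x sx; have [c hc] := hpts x sx.
have hE : ~ E c w.
  by move=> h; apply: hw; rewrite (bigD1 c) //=; left.
have h1 : `|dev N w (pts c)| < s by rewrite ltNge; apply/negP.
have h2 := dev_lip w N0 sx (spts c).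
have h3 : `|dev N w x| <= `|dev N w (pts c)| + `|dev N w x - dev N w (pts c)|.
  by rewrite -{1}(subrK (dev N w (pts c)) (dev N w x)) addrC; exact: ler_normD.
apply: le_trans h3 _; apply: lerD; first exact: ltW.
by apply: le_trans h2 _; rewrite ler_wpM2l // ler_wpM2l.
Qed.

Variable sigma : {measure set V -> \bar R}.
Hypothesis hs : is_surface_measure sigma.

(** Tonelli moves the expectation under the integral over the sphere, where the pointwise second
    moment applies; Markov's inequality concludes. *)
Lemma dev_L2_event (l c : R) (N : nat) : (0 < N)%N -> 0 < l -> l * (2 * b) <= 1 / 2 -> 0 < c ->
  exists E : set Omega, [/\ measurable E,
    (P E <= (8 / (l * N%:R) ^+ 2 * expR (2 * l ^+ 2 * v * N%:R) * surf_area R (dimd k) / c)%:E)%E &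
    forall w, ~ E w -> (\int[sigma]_x (dev N w x ^+ 2)%:E <= c%:E)%E].
Proof.
move=> N0 l0 lb c0; set K := 8 / _ * _.
have mD : measurable_fun setT (fun wx : Omega * V => (dev N wx.1 wx.2 ^+ 2)%:E).
  by apply/measurable_EFinP; apply: measurable_funX; exact: measurable_dev.
have D0 (wx : Omega * V) : (0 <= (dev N wx.1 wx.2 ^+ 2)%:E)%E by rewrite lee_fin sqr_ge0.
pose I w := (\int[sigma]_x (dev N w x ^+ 2)%:E)%E.
have mI : measurable_fun setT I by exact: (measurable_surface_integral hs mD D0).
have I0 w : (0 <= I w)%E by apply: integral_ge0 => x _; rewrite lee_fin sqr_ge0.
have mE : measurable [set w | (c%:E <= I w)%E].
  rewrite (_ : [set w | _] = I @^-1` `[c%:E, +oo[%classic).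
    by rewrite -[X in measurable X]setTI; apply: mI => //; exact: emeasurable_itv.
  by apply/seteqP; split => w /=; rewrite in_itv /= andbT.
exists [set w | (c%:E <= I w)%E]; split => //; last first.
  by move=> w /= /negP; rewrite -ltNge => /ltW.
have II : (\int[P]_w I w <= (K * surf_area R (dimd k))%:E)%E.
  rewrite /I (surface_tonelli hs _ mD D0) /= -(surface_integral_cst hs).
  apply: (le_surface_integral hs).
  - have mD' : measurable_fun setT (fun xw : V * Omega => (dev N xw.2 xw.1 ^+ 2)%:E).
      exact: (measurableT_comp mD (@measurable_swap _ _ _ _)).
    by apply: (@measurable_fun_fubini_tonelli_F _ _ _ _ _ P _ mD') => z; rewrite lee_fin sqr_ge0.
  - exact: measurable_cst.
  - by move=> x; apply: integral_ge0 => w _; rewrite lee_fin sqr_ge0.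
  - by move=> x; rewrite lee_fin /K mulr_ge0 ?expR_ge0 // divr_ge0 ?sqr_ge0.
  - by move=> x sx _; exact: dev_sqr.
have h : (c%:E * P [set w | (c%:E <= I w)%E] <= (K * surf_area R (dimd k))%:E)%E.
  apply: le_trans II; rewrite -(setIT [set w | _]) -(integral_indic P measurableT mE).
  have c0' := ltW c0; rewrite -ge0_integralZl_EFin //; last by apply/measurable_EFinP; exact: measurable_indic.
  apply: ge0_le_integral => //.
  - by move=> w _; rewrite mule_ge0 // lee_fin.
  - by apply: measurable_funeM; apply/measurable_EFinP; exact: measurable_indic.
  - move=> w _; rewrite indicE; case: (boolP (w \in _)) => [|_].
      by rewrite inE /= mule1.
    by rewrite mule0.
have fE : P [set w | (c%:E <= I w)%E] \is a fin_num by exact: fin_num_measure.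
rewrite -(fineK fE) -EFinM !lee_fin in h *.
by rewrite ler_pdivlMr // mulrC.
Qed.

End UniformDeviation.

(** * Rates *)

Section Rates.
Variable R : realType.

Lemma powRDgt0 (x a b : R) : 0 < x -> x `^ (a + b) = x `^ a * x `^ b.
Proof. by move=> x0; rewrite powRD //; apply/implyP => _; rewrite gt_eqF. Qed.

Lemma powR_ge1 (x a : R) : 1 <= x -> 0 <= a -> 1 <= x `^ a.
Proof. by move=> x1 a0; rewrite -(powRr0 x) ler_powR. Qed.

Lemma powR_le1 (x a : R) : 1 <= x -> a <= 0 -> x `^ a <= 1.
Proof. by move=> x1 a0; rewrite -(powRr0 x) ler_powR. Qed.

Lemma ln_nat_ge1 : \forall N \near \oo, 1 <= ln (N%:R : R).
Proof.
near=> N; have h : expR 1 <= (N%:R : R) by near: N; exact: nbhs_infty_ger.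
have e0 := expR_gt0 (1 : R).
by rewrite -[leLHS](@expRK R) ler_ln // posrE // (lt_le_trans e0).
Unshelve. all: by end_near. Qed.

Lemma powR_nat_near (b c : R) : 0 < b -> \forall N \near \oo, c <= (N%:R : R) `^ b.
Proof.
move=> b0; near=> N.
have h : `|c| `^ b^-1 <= (N%:R : R) by near: N; exact: nbhs_infty_ger.
apply: le_trans (ler_norm c) _.
have -> : `|c| = (`|c| `^ b^-1) `^ b by rewrite -powRrM mulVf ?gt_eqF // powRr1.
by apply: ge0_ler_powR; rewrite ?nnegrE ?powR_ge0 // ltW.
Unshelve. all: by end_near. Qed.

Lemma powR_ln_near (a b c : R) : 0 < b -> \forall N \near \oo,
  c * ln (N%:R : R) `^ a <= (N%:R : R) `^ b.
Proof.
move=> b0; pose A := `|a| + 1; have A0 : 0 < A by rewrite ltr_pwDr.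
(* From ln x <= x at x = N^g one gets ln N <= N^g / g. This [g] makes the power A cost only N^(b/2);
   the other half absorbs the constants. *)
pose g := b / (2 * A); have g0 : 0 < g by rewrite divr_gt0 // mulr_gt0.
near=> N; have L1 : 1 <= ln (N%:R : R) by near: N; exact: ln_nat_ge1.
have N1 : 1 <= (N%:R : R) by near: N; exact: nbhs_infty_ger.
have N0 : 0 < (N%:R : R) by exact: lt_le_trans N1.
have hc : `|c| * g `^ (- A) <= (N%:R : R) `^ (b / 2) by near: N; apply: powR_nat_near; rewrite divr_gt0.
have hL : ln (N%:R : R) <= N%:R `^ g / g.
  by rewrite ler_pdivlMr // mulrC -ln_powR ltW // ln_sublinear // powR_gt0.
apply: (@le_trans _ _ (`|c| * ln N%:R `^ A)).
  apply: (@le_trans _ _ (`|c| * ln N%:R `^ a)); first by rewrite ler_wpM2r ?powR_ge0 // ler_norm.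
  by rewrite ler_wpM2l // ler_powR // /A; apply: le_trans (ler_norm a) _; rewrite lerDl.
apply: (@le_trans _ _ (`|c| * (N%:R `^ g / g) `^ A)).
  rewrite ler_wpM2l // ge0_ler_powR ?nnegrE ?(ltW A0) //; first exact: le_trans L1.
  by rewrite divr_ge0 ?powR_ge0 // ltW.
rewrite powRM ?powR_ge0 ?invr_ge0 ?(ltW g0) // -powR_inv1 ?(ltW g0) // -!powRrM mulN1r.
have -> : g * A = b / 2 by rewrite /g; field; rewrite gt_eqF.
rewrite mulrCA; apply: le_trans (ler_wpM2l (powR_ge0 _ _) hc) _.
by rewrite -powRDgt0 // -splitr.
Unshelve. all: by end_near. Qed.

Variables (k : nat) (tau kap : R).
Hypothesis tau0 : 0 < tau.
Hypothesis kap0 : 0 <= kap.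
Let d1 := dm1 R k.
Let D := 2 * tau + d1.

Lemma dm1E : dm1 R k = k.+1%:R.
Proof. by rewrite /dm1 /dimd -[k.+2]addn1 natrD addrK. Qed.

Lemma rate_den_gt1 : 1 < 2 * tau + dm1 R k.
Proof. by rewrite dm1E -[ltLHS]add0r ltr_leD ?mulr_gt0 // ler1n. Qed.

Lemma base_near : \forall N \near \oo, 1 <= base kap N <= (N%:R : R).
Proof.
near=> N; have L1 : 1 <= ln (N%:R : R) by near: N; exact: ln_nat_ge1.
have N1 : 1 <= (N%:R : R) by near: N; exact: nbhs_infty_ger.
have N0 : 0 < (N%:R : R) by exact: lt_le_trans N1.
have L0 : 0 < ln (N%:R : R) by exact: lt_le_trans L1.
have Lk : 1 <= ln (N%:R : R) `^ kap by exact: powR_ge1.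
have h : 1 * ln (N%:R : R) `^ kap <= N%:R `^ 1 by near: N; exact: powR_ln_near.
rewrite mul1r powRr1 ?(ltW N0) // in h.
rewrite /base ler_pdivlMr ?powR_gt0 // mul1r h /= ler_pdivrMr ?powR_gt0 //.
by rewrite ler_peMr // ltW.
Unshelve. all: by end_near. Qed.

(** The balance that defines the rate: the right-hand side is T^(d-1) (log N)^kappa for T equal to
    base^(1/D). *)
Lemma rate_sqr N : 0 < (N%:R : R) -> 0 < ln (N%:R : R) ->
  (base kap N `^ (- (tau / D))) ^+ 2 * N%:R = base kap N `^ (d1 / D) * ln N%:R `^ kap.
Proof.
move=> N0 L0; have be : 0 < base kap N by rewrite divr_gt0 ?powR_gt0.
have D0 : 0 < D by apply: lt_trans rate_den_gt1.
have e : base kap N * ln N%:R `^ kap = N%:R by rewrite divfK // gt_eqF // powR_gt0.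
rewrite -{1}e mulrA; congr (_ * _).
rewrite -powR_mulrn ?powR_ge0 // -powRrM -{2}[base _ _]powRr1 ?(ltW be) // -powRDgt0 //.
by congr (_ `^ _); rewrite /D; field; rewrite gt_eqF.
Qed.

Lemma rate_ge N : 1 <= base kap N <= (N%:R : R) -> N%:R^-1 <= base kap N `^ (- (tau / D)).
Proof.
move=> /andP[b1 bN]; have be : 0 < base kap N by exact: lt_le_trans b1.
have D1 := rate_den_gt1; have D0 : 0 < D by apply: lt_trans D1.
have h : tau / D <= 1 by rewrite ler_pdivrMr // mul1r /D /d1 dm1E; have := ler0n R k.+1; have := tau0; lra.
rewrite powRN lef_pV2 ?posrE ?powR_gt0 //; last exact: lt_le_trans bN.
by apply: le_trans bN; apply: ler1_powR.
Qed.

(** T^(d-1) log N is negligible against N because (d-1) / (2 tau + d - 1) < 1; this gives room in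
    the constraint on the exponential parameter. *)
Lemma rate_dim_near (c : R) : 0 <= c -> \forall N \near \oo,
  c * (base kap N `^ (d1 / D) * ln (N%:R : R)) <= N%:R.
Proof.
move=> c0; have D1 := rate_den_gt1; have D0 : 0 < D by apply: lt_trans D1.
have g0 : 0 < 1 - d1 / D.
  by rewrite subr_gt0 ltr_pdivrMr // mul1r /D; have := tau0; lra.
near=> N; have L1 : 1 <= ln (N%:R : R) by near: N; exact: ln_nat_ge1.
have N1 : 1 <= (N%:R : R) by near: N; exact: nbhs_infty_ger.
have N0 : 0 < (N%:R : R) by exact: lt_le_trans N1.
have L0 : 0 < ln (N%:R : R) by exact: lt_le_trans L1.
have /andP[b1 bN] : 1 <= base kap N <= N%:R by near: N; exact: base_near.
have h : c * ln (N%:R : R) `^ 1 <= N%:R `^ (1 - d1 / D) by near: N; exact: powR_ln_near.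
rewrite powRr1 ?(ltW L0) // in h.
have h2 : base kap N `^ (d1 / D) <= N%:R `^ (d1 / D).
  apply: ge0_ler_powR; rewrite ?nnegrE ?(ltW N0) // ?(le_trans ler01 b1) //.
  by rewrite /d1 dm1E divr_ge0 // ltW.
apply: (@le_trans _ _ (N%:R `^ (d1 / D) * N%:R `^ (1 - d1 / D))).
  by rewrite mulrCA; apply: ler_pM => //; rewrite ?powR_ge0 ?mulr_ge0 // ltW.
by rewrite -powRDgt0 // subrKC powRr1 // ltW.
Unshelve. all: by end_near. Qed.

(** Lipschitz constants grow polynomially in T and logarithmically in N, so a mesh N^(-e) with fixed
    [e] makes the discretisation error at most 1/N; [x] stands for 2 T_N. *)
Lemma mesh_near (C c a r : R) : 0 <= C -> 0 <= c -> 0 <= a -> 0 <= r ->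
  exists2 e : nat, (0 < e)%N & \forall N \near \oo, forall x : R, 0 <= x <= c * N%:R ->
    C * (x `^ a * ln (N%:R : R) `^ r) / (N ^ e)%N%:R <= N%:R^-1.
Proof.
(* a + r for the powers of x and log N, 1 for the constants and 1 for the target 1/N. *)
move=> C0 c0 a0 r0; pose e := Num.bound (a + r + 2).
have he : a + r + 2 <= e%:R by rewrite ltW // archi_boundP // !addr_ge0.
exists e; first by rewrite -(ltr0n R); apply: lt_le_trans he; rewrite ltr_wpDl ?addr_ge0.
near=> N => x /andP[x0 xc].
have L1 : 1 <= ln (N%:R : R) by near: N; exact: ln_nat_ge1.
have N1 : 1 <= (N%:R : R) by near: N; exact: nbhs_infty_ger.
have N0 : 0 < (N%:R : R) by exact: lt_le_trans N1.
have L0 : 0 < ln (N%:R : R) by exact: lt_le_trans L1.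
have h : C * c `^ a <= N%:R `^ 1 by near: N; exact: powR_nat_near.
have hx : x `^ a <= c `^ a * N%:R `^ a.
  by rewrite -powRM ?(ltW N0) //; apply: ge0_ler_powR; rewrite ?nnegrE ?mulr_ge0 // ltW.
have hl : ln (N%:R : R) `^ r <= N%:R `^ r.
  by apply: ge0_ler_powR; rewrite ?nnegrE ?(ltW N0) ?(ltW L0) // ltW // ln_sublinear.
rewrite natrX -powR_mulrn ?(ltW N0) // -powR_inv1 ?powR_ge0 // -powRrM -[leRHS]powR_inv1 ?(ltW N0) //.
apply: (@le_trans _ _ (N%:R `^ (1 + (a + r)) * N%:R `^ (e%:R * -1))).
  rewrite ler_wpM2r ?powR_ge0 // !powRDgt0 //.
  apply: (@le_trans _ _ (C * (c `^ a * N%:R `^ a * N%:R `^ r))).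
    by rewrite ler_wpM2l // ler_pM ?powR_ge0.
  by rewrite -mulrA mulrA ler_wpM2r // mulr_ge0 ?powR_ge0.
by rewrite -powRDgt0 // ler_powR //; lra.
Unshelve. all: by end_near. Qed.

End Rates.

(** * Choice of the exponential parameter *)

Section Fluctuation.
Variables (R : realType) (k : nat).
Notation V := (Vec R k).
Variable sigma : {measure set V -> \bar R}.
Hypothesis hs : is_surface_measure sigma.
Context (dO : measure_display) (Omega : measurableType dO).
Variable P : probability Omega R.
Variable Z : nat -> bool -> Omega -> V.
Hypothesis mZ : forall i b, measurable_fun setT (Z i b).
Hypothesis hZ : mutually_independent P (fun ib : nat * bool => Z ib.1 ib.2).
Variables (phi : V -> V * V -> R) (m : V -> R) (b v L : R).
Hypothesis mphi : measurable_fun setT (fun xp : V * (V * V) => phi xp.1 xp.2).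
Hypothesis mm : measurable_fun setT m.
Hypothesis phi_b : forall i w x, sphere x -> `|phi x (Z i false w, Z i true w)| <= b.
Hypothesis phi_v : forall i x, sphere x -> (\int[P]_w (phi x (Z i false w, Z i true w) ^+ 2)%:E <= v%:E)%E.
Hypothesis phi_L : forall i w x y, sphere x -> sphere y ->
  `|phi x (Z i false w, Z i true w) - phi y (Z i false w, Z i true w)| <= L * enorm (x - y).
Hypothesis phi_m : forall i x, sphere x -> \int[P]_w phi x (Z i false w, Z i true w) = m x.
Variable N : nat.
Hypothesis N0 : (0 < N)%N.
Hypothesis v0 : 0 < v.
Local Notation dev := (dev Z phi m).

Let NR : 0 < N%:R :> R. Proof. by rewrite ltr0n. Qed.

(** With l = [scale u] the exponent 2 l^2 v N equals 2u, and a deviation a (v u / N)^(1/2)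
    contributes -a u. *)
Let scale (u : R) := Num.sqrt (u / (v * N%:R)).

Let scale_sqr u : 0 <= u -> scale u ^+ 2 = u / (v * N%:R).
Proof. by move=> u0; rewrite sqr_sqrtr // divr_ge0 // ltW // mulr_gt0. Qed.

(** Squaring the constraint on the exponential parameter gives 16 b^2 u <= v N. *)
Let scale_b u : 0 <= u -> 16 * b ^+ 2 * u <= v * N%:R -> scale u * (2 * b) <= 1 / 2.
Proof.
move=> u0 h; apply: le_trans (ler_norm _) _.
rewrite -[leRHS]ger0_norm // -ler_sqr ?nnegrE // !real_normK ?num_real //.
rewrite exprMn scale_sqr // mulrAC ler_pdivrMr ?mulr_gt0 //.
by move: h; set x := v * _; lra.
Qed.

Lemma dev_sup_fluct (a u : R) (g : nat) : (0 < g)%N -> 0 <= L -> 0 <= u -> 16 * b ^+ 2 * u <= v * N%:R ->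
  exists E : set Omega, [/\ measurable E,
    (P E <= ((g.+1 ^ dimd k)%N%:R * (2 * expR ((2 - a) * u)))%:E)%E &
    forall w, ~ E w -> forall x, sphere x ->
      `|dev N w x| <= a * Num.sqrt (v * u / N%:R) + 2 * (L * ((dimd k)%:R * (2 / g%:R)))].
Proof.
move=> g0 L0 u0 hb; have l0 : 0 <= scale u by exact: sqrtr_ge0.
have [E [mE PE hE]] := dev_sup_event mZ hZ mphi mm phi_b phi_v phi_L phi_m
  (a * Num.sqrt (v * u / N%:R)) g0 N0 L0 l0 (scale_b u0 hb).
exists E; split => //; apply: le_trans PE _; rewrite lee_fin le_eqVlt; apply/orP; left; apply/eqP.
congr (_ * (_ * expR _)); rewrite scale_sqr //.
have -> : scale u * (N%:R * (a * Num.sqrt (v * u / N%:R))) =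
    a * (N%:R * (scale u * Num.sqrt (v * u / N%:R))) by ring.
rewrite /scale -sqrtrM ?(divr_ge0, mulr_ge0, ltW NR, ltW v0) //.
have -> : u / (v * N%:R) * (v * u / N%:R) = (u / N%:R) ^+ 2 by field; rewrite !gt_eqF.
by rewrite sqrtr_sqr ger0_norm ?divr_ge0 ?(ltW NR) //; field; rewrite !gt_eqF.
Qed.

Lemma dev_L2_fluct (c : R) : 16 * b ^+ 2 <= v * N%:R -> 0 < c ->
  exists E : set Omega, [/\ measurable E,
    (P E <= (8 * expR 2 * (v / N%:R) * surf_area R (dimd k) / c)%:E)%E &
    forall w, ~ E w -> (\int[sigma]_x (dev N w x ^+ 2)%:E <= c%:E)%E].
Proof.
move=> hb c0; have l0 : 0 < scale 1 by rewrite sqrtr_gt0 divr_gt0 // mulr_gt0.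
have hb1 : 16 * b ^+ 2 * 1 <= v * N%:R by rewrite mulr1.
have [E [mE PE hE]] := dev_L2_event mZ hZ mphi mm phi_b phi_v phi_m hs N0 l0 (scale_b ler01 hb1) c0.
exists E; split => //; apply: le_trans PE _; rewrite lee_fin le_eqVlt; apply/orP; left; apply/eqP.
rewrite exprMn scale_sqr //.
have -> : 2 * (1 / (v * N%:R)) * v * N%:R = 2 by field; rewrite !gt_eqF.
by field; rewrite !gt_eqF.
Qed.

End Fluctuation.

(** * Interpolation of norms at the target rate *)

Section RateNorms.
Variables (R : realType) (k : nat).
Notation V := (Vec R k).
Variable sigma : {measure set V -> \bar R}.
Hypothesis hs : is_surface_measure sigma.
Variable q : \bar R.
Hypothesis q1 : (1 <= q)%E.
Local Notation S := (surf_area R (dimd k)).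

Definition fluct_const (a c : R) : R :=
  match q with
  | p%:E => if 2 <= p then (a `^ (p - 2) * c) `^ p^-1 else 1 + S + c
  | _ => a * (1 + S)
  end.

Lemma kappa_bounds (r : R) : 0 <= r -> 2 * r <= kappa q r <= 2 * r + 1.
Proof.
move=> r0; case: q q1 => [p| |] //=; last by rewrite lerDl ler01 lexx.
rewrite lee_fin => p1; case: ifPn => p2; last by rewrite addr0 lexx lerDl ler01.
have p0 : 0 < p by exact: lt_le_trans p1.
have h1 : 0 <= 2 / p by rewrite divr_ge0 // ltW.
have h2 : 2 / p <= 1 by rewrite ler_pdivrMr // mul1r.
by apply/andP; split; lra.
Qed.

(** For p >= 2 the logarithm enters the integral of |f|^p with exponent (p-2)(2r+1-kappa)/2 +
    (2r-kappa), which vanishes exactly for kappa = 2r + 1 - 2/p. For p < 2 the L^2 bound, and for p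
    = oo the sup bound, has no logarithm left. *)
Lemma fluct_Lnorm (f : V -> R) (r rho l a c : R) : measurable_fun setT f ->
  0 < rho -> 0 < l -> 0 <= a -> 0 <= c ->
  (forall x, sphere x -> `|f x| <= a * (rho * l `^ ((2 * r + 1 - kappa q r) / 2))) ->
  (\int[sigma]_x (f x ^+ 2)%:E <= (c * (rho ^+ 2 * l `^ (2 * r - kappa q r)))%:E)%E ->
  (Lnorm sigma q (fun x => (f x)%:E) <= (fluct_const a c * rho)%:E)%E.
Proof.
move=> mf rho0 l0 a0 c0; rewrite /fluct_const; case: q q1 => [p| |] //=; last first.
  move=> _ fa _; rewrite [_ * rho]mulrAC; apply: (surface_Lnorm_sup hs) => //; first exact: leey.
    by rewrite mulr_ge0 // ltW.
  by move=> x sx _; apply: le_trans (fa x sx) _; rewrite subrr mul0r powRr0 mulr1.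
rewrite lee_fin => p1; have p0 : 0 < p by exact: lt_le_trans p1.
case: ifPn => p2 fa fc; last first.
  rewrite mulrC; apply: (surface_Lnorm_lt2 hs) => //; first by rewrite ltW // ltNge.
  by apply: le_trans fc _; rewrite addr0 subrr powRr0 mulr1.
have h1 : (2 * r + 1 - (2 * r + (1 - 2 / p))) / 2 = p^-1 by field; rewrite gt_eqF.
have h2 : 2 * r - (2 * r + (1 - 2 / p)) = - ((p - 2) * p^-1) by field; rewrite gt_eqF.
rewrite h1 in fa; rewrite h2 in fc.
have lp := powR_gt0 p^-1 l0.
have hp2 : 2%:R <= p by [].
have fc' : (\int[sigma]_x (`|f x| ^+ 2)%:E <= (c * (rho ^+ 2 * l `^ (- ((p - 2) / p))))%:E)%E.
  by apply: le_trans fc; rewrite le_eqVlt; apply/orP; left; apply/eqP; apply: eq_integral => x _; rewrite real_normK ?num_real.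
have s0 : 0 <= a * (rho * l `^ p^-1) by rewrite !mulr_ge0 // ltW.
have e0 : 0 <= c * (rho ^+ 2 * l `^ (- ((p - 2) / p))) by rewrite mulr_ge0 // mulr_ge0 ?sqr_ge0 ?powR_ge0.
apply: le_trans (surface_Lnorm_interp hs mf p1 hp2 s0 e0 fa fc') _.
rewrite lee_fin le_eqVlt; apply/orP; left; apply/eqP.
have -> : (a * (rho * l `^ p^-1)) `^ (p - 2%:R) * (c * (rho ^+ 2 * l `^ (- ((p - 2) / p)))) =
    (a `^ (p - 2) * c) * rho `^ p.
  rewrite !powRM ?mulr_ge0 ?(ltW rho0) ?(ltW lp) //.
  rewrite -powRrM (mulrC p^-1) powRN -(powR_mulrn 2 (ltW rho0)).
  have -> : rho `^ p = rho `^ (p - 2) * rho `^ 2%:R by rewrite -powRDgt0 // subrK.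
  by field; rewrite gt_eqF // powR_gt0.
rewrite powRM ?mulr_ge0 ?powR_ge0 //; congr (_ * _).
by rewrite -powRrM divff ?gt_eqF // powRr1 // ltW.
Qed.

Definition trim_const (a c : R) : R :=
  match q with
  | p%:E => (a `^ (p - 1) * c) `^ p^-1
  | _ => a * (1 + S)
  end.

(** The sup bound carries the kernel growth base^(d1/D) and the L^1 bound does not. In delta^p
    base^(d1 (p-1)/D) the term d1 (1 - 1/p) of the exponent of delta cancels that growth and leaves
    base^(-p tau / D); this is the origin of the exponent in (T-a). *)
Lemma trim_Lnorm (f : V -> R) (be tau d1 D a c : R) : measurable_fun setT f ->
  0 < be -> 0 <= a -> 0 <= c ->
  let delta := be `^ (- ((tau + d1 * (1 - inv_q q)) / D)) in
  (forall x, sphere x -> `|f x| <= a * (delta * be `^ (d1 / D))) ->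
  (\int[sigma]_x (`|f x| ^+ 1)%:E <= (c * delta)%:E)%E ->
  (Lnorm sigma q (fun x => (f x)%:E) <= (trim_const a c * be `^ (- (tau / D)))%:E)%E.
Proof.
move=> mf be0 a0 c0 /=; rewrite /trim_const; case: q q1 => [p| |] //=; last first.
  move=> _ fa _; rewrite [_ * be `^ _]mulrAC; apply: (surface_Lnorm_sup hs) => //; first exact: leey.
    by rewrite mulr_ge0 // powR_ge0.
  move=> x sx _; apply: le_trans (fa x sx) _; rewrite -powRDgt0 // subr0 mulr1.
  by rewrite mulrDl opprD subrK.
rewrite lee_fin => p1; have p0 : 0 < p by exact: lt_le_trans p1.
have alg (x y z e : R) : 0 < e -> x * (z / e * y) * (c * e) = x * c * (z * y).
  by move=> e0; field; rewrite gt_eqF.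
set delta := be `^ _ => fa fc; have d0 : 0 < delta by exact: powR_gt0.
have T0 : 0 < be `^ (d1 / D) by exact: powR_gt0.
have s0 : 0 <= a * (delta * be `^ (d1 / D)) by rewrite !mulr_ge0 // ltW.
have e0 : 0 <= c * delta by rewrite mulr_ge0 // ltW.
have hp1 : 1%:R <= p by [].
apply: le_trans (surface_Lnorm_interp hs mf p1 hp1 s0 e0 fa fc) _.
rewrite lee_fin le_eqVlt; apply/orP; left; apply/eqP.
have -> : (a * (delta * be `^ (d1 / D))) `^ (p - 1%:R) * (c * delta) =
    (a `^ (p - 1) * c) * (be `^ (- (tau / D))) `^ p.
  rewrite !powRM ?mulr_ge0 ?(ltW d0) ?(ltW T0) //.
  have -> : delta `^ (p - 1%:R) = delta `^ p / delta.
    by rewrite powRDgt0 // powRN powRr1 // ltW.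
  have -> : (be `^ (- (tau / D))) `^ p = delta `^ p * (be `^ (d1 / D)) `^ (p - 1%:R).
    rewrite /delta -!powRrM -powRDgt0 //; congr (_ `^ _).
    by move: (D^-1) => Di; field; rewrite gt_eqF.
  exact: alg.
rewrite powRM ?mulr_ge0 ?powR_ge0 //; congr (_ * _).
by rewrite -powRrM divff ?gt_eqF // powRr1 // powR_ge0.
Qed.

End RateNorms.

(** * Outer probability and limits superior *)

Section OuterProbability.
Context (R : realType) (d : measure_display) (T : measurableType d) (P : probability T R).

Lemma outer_leW (A A' : set T) (a a' : R) : A `<=` A' -> a' <= a -> outer_le P A' a' -> outer_le P A a.
Proof.
move=> AA aa [E [mE A'E PE]]; exists E; split => //; first exact: subset_trans A'E.
by apply: le_trans PE _; rewrite lee_fin.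
Qed.

Lemma outer_leU (A A' : set T) (a a' : R) : outer_le P A a -> outer_le P A' a' ->
  outer_le P (A `|` A') (a + a').
Proof.
move=> [E [mE AE PE]] [E' [mE' AE' PE']]; exists (E `|` E'); split.
- exact: measurableU.
- exact: setUSS.
by apply: le_trans (measureU2 _ mE mE') _; rewrite EFinD leeD.
Qed.

Lemma borel_cantelli_sqr (E : nat -> set T) (c : R) : (forall N, measurable (E N)) -> 0 <= c ->
  (forall N, (0 < N)%N -> (P (E N) <= (c / N%:R ^+ 2)%:E)%E) ->
  {ae P, forall w, \forall N \near \oo, ~ E N w}.
Proof.
move=> mE c0 PE; exists (lim_sup_set E); split.
- by apply: bigcap_measurable => // n _; exact: bigcup_measurable.
- apply: lim_sup_set_cvg0 => //; apply: (@le_lt_trans _ _ (1 + 2 * c)%:E); last exact: ltry.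
  apply: lime_le; first exact: is_cvg_nneseries.
  (* Telescoping through 1/(x+1)^2 <= 2 (1/x - 1/(x+1)); the leading 1 covers index 0, where only P
     <= 1 is available. *)
  have h n : (\sum_(0 <= i < n.+1) P (E i) <= (1 + 2 * c * (1 - n.+1%:R^-1))%:E)%E.
    elim: n => [|n IH]; first by rewrite big_nat1 invr1 subrr mulr0 addr0; exact: probability_le1.
    rewrite big_nat_recr //=; apply: le_trans (leeD IH (PE n.+1 isT)) _.
    rewrite -EFinD lee_fin -[n.+2%:R]natr1.
    have : 1 <= n.+1%:R :> R by rewrite ler1n.
    move: (n.+1%:R : R) => x x1; have x0 : 0 < x by exact: lt_le_trans x1.
    have -> : 1 + 2 * c * (1 - (x + 1)^-1) = 1 + 2 * c * (1 - x^-1) + c * (2 / (x * (x + 1))).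
      by field; rewrite !gt_eqF // ltr_wpDr.
    rewrite lerD2l ler_wpM2l // ler_pdivlMr ?mulr_gt0 ?ltr_wpDr //.
    by rewrite mulrC ler_pdivrMr ?exprn_gt0 // expr2; nra.
  apply: nearW => -[|n]; first by rewrite big_nil lee_fin addr_ge0 // mulr_ge0.
  by apply: le_trans (h n) _; rewrite lee_fin lerD2l ler_piMr ?mulr_ge0.
move=> w hw n _; apply: contrapT => hn; apply: hw.
by exists n => // N /= nN EN; apply: hn; exists N.
Qed.

End OuterProbability.

Section LimnEsup.
Context (R : realType).
Implicit Type u : nat -> \bar R.

Lemma limn_esup_near_le u (c : R) : (\forall N \near \oo, (u N <= c%:E)%E) -> (limn_esup u <= c%:E)%E.
Proof.
move=> h; rewrite /limn_esup /limf_esup.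
apply: (@le_trans _ _ (ereal_sup (u @` [set N | (u N <= c%:E)%E]))).
  by apply: ereal_inf_lbound; exists [set N | (u N <= c%:E)%E].
by apply: ge_ereal_sup => _ [N hN <-].
Qed.

(** The margin [e] is there because the infimum over tails defining the limit superior may not be
    attained. *)
Lemma limn_esup_le_near u (c e : R) : 0 < e -> (limn_esup u <= c%:E)%E ->
  \forall N \near \oo, (u N <= (c + e)%:E)%E.
Proof.
move=> e0 h; have : (limn_esup u < (c + e)%:E)%E.
  by apply: le_lt_trans h _; rewrite lte_fin ltrDl.
move=> /ereal_inf_lt[_ [V VF <-] hV].
by apply: filterS VF => N VN; apply: le_trans (ltW hV); apply: ereal_sup_ubound; exists N.
Qed.

End LimnEsup.

(** * The estimator *)

Section Estimator.
Variables (R : realType) (k : nat).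
Notation V := (Vec R k).
Variable sigma : {measure set V -> \bar R}.
Hypothesis hs : is_surface_measure sigma.
Context (dO : measure_display) (Omega : measurableType dO).
Variable P : probability Omega R.
Variable Z : nat -> bool -> Omega -> V.
Variables fbeta fX : V -> R.
Hypothesis hM : model_M P sigma Z fbeta fX.
Variables (chi : nat -> nat -> R).
Hypothesis chi01 : forall n T, 0 <= chi n T <= 1.
Variables Bf B A C2 al : R.
Hypotheses (Bf0 : 0 <= Bf) (B0 : 0 <= B) (A0 : 0 < A) (C20 : 0 <= C2) (al0 : 0 <= al).
Hypothesis fXB : forall x, sphere x -> fX x <= Bf.
Hypothesis hK1 : forall T (x : V), sphere x -> (\int[sigma]_y (`|Kker chi T x y|)%:E <= B%:E)%E.
Hypothesis hK2 : forall (x y z : V) (T : nat), (0 < T)%N -> sphere x -> sphere y -> sphere z ->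
  `|Kker chi T z x - Kker chi T z y| <= C2 * enorm (x - y) * T%:R `^ al.
Hypothesis hA : forall T (x y : V), (0 < T)%N -> sphere x -> sphere y ->
  `|Kminus chi T x y| <= A * T%:R ^+ k.+1.

Let mfX : measurable_fun setT fX. Proof. by case: hM => [_ _ [_ ? _ _]]. Qed.
Let fX0 x : 0 <= fX x. Proof. by case: hM => [_ _ [_ _ _ h] _ _]; exact: h. Qed.

Lemma Kminus_lip (T : nat) (x y z : V) : (0 < T)%N -> sphere x -> sphere y -> sphere z ->
  `|Kminus chi T z x - Kminus chi T z y| <= C2 * enorm (x - y) * (2 * T)%N%:R `^ al.
Proof.
move=> T0 sx sy sz; rewrite !Kminus_odd //.
have T20 : (0 < 2 * T)%N by rewrite muln_gt0.
have h1 := hK2 T20 sx sy sz; have := hK2 T20 (sphereN sx) (sphereN sy) sz.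
have -> : enorm (- x - - y : V) = enorm (x - y).
  by rewrite -opprD /enorm dotvNl dotvNr opprK.
move: h1; set c := C2 * _ * _; rewrite !ler_norml => /andP[? ?] /andP[? ?].
by apply/andP; split; lra.
Qed.

Section SignedSummand.
Variables (T : nat) (t : R) (sgn : bool).
Hypotheses (T0 : (0 < T)%N) (t0 : 0 < t).

(** [sgn = true] selects |psi|, whose empirical mean multiplies [MN]; [sgn = false] selects psi
    itself. Both obey the same bounds, so the deviation estimates are run once. *)
Definition summand (x : V) (p : V * V) : R :=
  if sgn then `|psi fX chi T t x p| else psi fX chi T t x p.

Definition summand_mean (x : V) : R :=
  if sgn then \int[sigma]_z (`|Kminus chi T z x| / trim_max fX t z * fX z)
  else \int[sigma]_z ((2 * rfun sigma fbeta z - 1) * (Kminus chi T z x / trim_max fX t z) * fX z).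

Lemma measurable_summand : measurable_fun setT (fun xp : V * (V * V) => summand xp.1 xp.2).
Proof.
have := measurable_psi hM chi T t0.
by rewrite /summand; case: sgn => // h; exact: measurableT_comp.
Qed.

Lemma measurable_summand_mean : measurable_fun setT summand_mean.
Proof.
have mV := measurable_trim_maxV hM t0.
have mV2 : measurable_fun setT (fun p : V * V => (trim_max fX t p.2)^-1) by exact: (measurableT_comp mV).
have mX2 : measurable_fun setT (fun p : V * V => fX p.2) by exact: (measurableT_comp mfX).
have mK : measurable_fun setT (fun p : V * V => Kminus chi T p.2 p.1) by exact: measurable_Kminus.
rewrite /summand_mean; case: sgn.
  apply: (measurable_surface_Rintegral hs (f := fun p : V * V => `|Kminus chi T p.2 p.1| / trim_max fX t p.2 * fX p.2)).
  by apply: measurable_funM => //; apply: measurable_funM => //; exact: measurableT_comp.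
apply: (measurable_surface_Rintegral hs (f := fun p : V * V =>
  (2 * rfun sigma fbeta p.2 - 1) * (Kminus chi T p.2 p.1 / trim_max fX t p.2) * fX p.2)).
apply: measurable_funM => //; apply: measurable_funM; last exact: measurable_funM.
apply: measurable_funB => //; apply: measurable_funM => //.
exact: (measurableT_comp (measurable_rfun hs hM)).
Qed.

Lemma summand_le i w x : sphere x -> `|summand x (Z i false w, Z i true w)| <= A * T%:R ^+ k.+1 / t.
Proof.
move=> sx; have h := psi_le fX hA T0 t0 sx (sample_sphere hM i false w : sphere (Z i false w, Z i true w).1).
by rewrite /summand; case: sgn; rewrite ?normr_id.
Qed.

Lemma summand_var i x : sphere x ->
  (\int[P]_w (summand x (Z i false w, Z i true w) ^+ 2)%:E <= (A * T%:R ^+ k.+1 * Bf * B / t ^+ 2)%:E)%E.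
Proof.
move=> sx; apply: le_trans (psi_var hs hM fXB hK1 hA T0 t0 i sx).
rewrite le_eqVlt; apply/orP; left; apply/eqP; apply: eq_integral => w _.
by rewrite /summand; case: sgn; rewrite ?real_normK ?num_real.
Qed.

Lemma summand_lip i w x y : sphere x -> sphere y ->
  `|summand x (Z i false w, Z i true w) - summand y (Z i false w, Z i true w)| <=
  C2 * (2 * T)%N%:R `^ al / t * enorm (x - y).
Proof.
move=> sx sy; set p := (Z i false w, Z i true w).
have h : `|psi fX chi T t x p - psi fX chi T t y p| <= C2 * (2 * T)%N%:R `^ al / t * enorm (x - y).
  have -> : psi fX chi T t x p - psi fX chi T t y p =
      (2 * (0 <= dotv p.1 p.2)%R%:R - 1) * ((Kminus chi T p.1 x - Kminus chi T p.1 y) * (trim_max fX t p.1)^-1).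
    by rewrite /psi; ring.
  rewrite normrM; have -> : `|2 * (0 <= dotv p.1 p.2)%R%:R - 1| = 1 :> R.
    by case: (0 <= _); rewrite ?mulr1 ?mulr0 ?sub0r ?normrN ?normr1 // -[X in X - 1]/(1 + 1) addrK normr1.
  rewrite mul1r normrM.
  have -> : C2 * (2 * T)%N%:R `^ al / t * enorm (x - y) = C2 * enorm (x - y) * (2 * T)%N%:R `^ al * t^-1 by ring.
  apply: ler_pM => //; first exact: (Kminus_lip T0 sx sy (sample_sphere hM i false w)).
  by rewrite ger0_norm ?trim_maxV_ge0 //; exact: trim_maxV_le.
by rewrite /summand; case: sgn; [exact: le_trans (ler_dist_dist _ _) h|exact: h].
Qed.

Lemma summand_meanE i x : sphere x ->
  \int[P]_w summand x (Z i false w, Z i true w) = summand_mean x.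
Proof.
move=> sx; rewrite /summand /summand_mean; case: sgn; last exact: (psi_mean hs hM fXB hA T0 t0).
rewrite /Rintegral; congr fine.
under eq_integral do rewrite (psi_abs fX chi T t0).
apply: (integral_sample_X hs hM i (u := fun z => `|Kminus chi T z x| / trim_max fX t z)).
  apply: measurable_funM; last exact: (measurable_trim_maxV hM t0).
  by apply: measurableT_comp => //; exact: measurable_Kminus.
by move=> z; rewrite mulr_ge0 // trim_maxV_ge0.
Qed.

End SignedSummand.

Lemma summand_mean_abs T t x : (0 < T)%N -> 0 < t -> sphere x -> `|summand_mean T t true x| <= B.
Proof.
move=> T0 t0 sx; have := psi_mean_abs hs hM hK1 T t0 0 sx.
rewrite -(summand_meanE true T0 t0 0 sx) /summand /Rintegral.
set I := (\int[P]_w _)%E => hI.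
have I0 : (0 <= I)%E by apply: integral_ge0.
have fI : I \is a fin_num by rewrite ge0_fin_numE //; exact: le_lt_trans hI (ltry _).
by rewrite ger0_norm ?fine_ge0 // -lee_fin fineK.
Qed.

Variables (r tau : R) (q : \bar R) (TN : nat -> nat) (c1 c2 : R).
Hypotheses (r0 : 0 < r) (tau0 : 0 < tau) (q1 : (1 <= q)%E) (c10 : 0 < c1) (c20 : 0 < c2).
Local Notation D := (2 * tau + dm1 R k).
Local Notation kap := (kappa q r).
Local Notation be := (base kap).
Local Notation l N := (ln (N%:R : R)).
Local Notation rho N := (be N `^ (- (tau / D))).
Hypothesis hT : \forall N \near \oo, c1 * be N `^ (1 / D) <= (TN N)%:R <= c2 * be N `^ (1 / D).

Lemma kappa_ge0 : 0 <= kap.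
Proof. by have /andP[h _] := kappa_bounds q1 (ltW r0); apply: le_trans h; rewrite mulr_ge0 // ltW. Qed.

(** Collects what a single large N must satisfy, so that most later estimates concern one N and only
    their assembly is asymptotic. *)
Definition admissible (N : nat) := [/\ (0 < N)%N, 1 <= l N, 1 <= be N <= N%:R, (0 < TN N)%N &
  c1 * be N `^ (1 / D) <= (TN N)%:R <= c2 * be N `^ (1 / D)].

Lemma admissible_near : \forall N \near \oo, admissible N.
Proof.
near=> N.
have h1 : c1 * be N `^ (1 / D) <= (TN N)%:R <= c2 * be N `^ (1 / D) by near: N; exact: hT.
have h2 : 1 <= be N <= N%:R by near: N; apply: base_near; exact: kappa_ge0.
split => //; first by near: N; exact: nbhs_infty_gt.
  by near: N; exact: ln_nat_ge1.
have /andP[h3 _] := h1; have /andP[h4 _] := h2.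
rewrite -(ltr0n R); apply: lt_le_trans h3.
by rewrite mulr_gt0 // powR_gt0 // (lt_le_trans ltr01).
Unshelve. all: by end_near. Qed.

Let D0 : 0 < D. Proof. by apply: lt_trans (rate_den_gt1 _ _). Qed.

Lemma resolution_le N : admissible N -> (TN N)%:R ^+ k.+1 <= c2 ^+ k.+1 * be N `^ (dm1 R k / D).
Proof.
move=> [N0 l1 /andP[b1 bN] T0 /andP[_ h]].
apply: (@le_trans _ _ ((c2 * be N `^ (1 / D)) ^+ k.+1)).
  by rewrite lerXn2r // nnegrE ?ler0n // mulr_ge0 ?powR_ge0 // ltW.
rewrite exprMn -(powR_mulrn k.+1 (powR_ge0 _ _)) -powRrM dm1E.
by rewrite mulrAC mul1r.
Qed.

Lemma resolution_leN N : admissible N -> (2 * TN N)%N%:R <= 2 * c2 * N%:R :> R.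
Proof.
move=> [N0 l1 /andP[b1 bN] T0 /andP[_ h]]; rewrite natrM -mulrA ler_wpM2l //.
apply: le_trans h _; rewrite ler_wpM2l ?(ltW c20) //; apply: le_trans bN.
by apply: ler1_powR => //; rewrite ler_pdivrMr // mul1r ltW // rate_den_gt1.
Qed.

Lemma trim_gt0 N : admissible N -> 0 < trim r N.
Proof. by move=> [_ l1 _ _ _]; rewrite powR_gt0 // (lt_le_trans ltr01). Qed.

Lemma trimV N : admissible N -> (trim r N)^-1 = l N `^ r.
Proof. by move=> [_ l1 _ _ _]; rewrite /trim powRN invrK. Qed.

(** The 1 keeps the constant positive even when the bounds on density or kernel are 0, since the
    exponential parameter is obtained by dividing by the variance proxy [v]. *)
Let G := c2 ^+ k.+1 * (A * Bf * B + 1).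
Let G0 : 0 < G.
Proof. by rewrite mulr_gt0 ?exprn_gt0 // ltr_wpDl // !mulr_ge0 // ltW. Qed.

Let v N := G * (be N `^ (dm1 R k / D) * l N `^ (2 * r)).

Let v_rate N : admissible N -> v N / N%:R = G * (rho N ^+ 2 * l N `^ (2 * r - kap)).
Proof.
move=> hN; have [N0 l1 /andP[b1 bN] T0 _] := hN.
have NR : 0 < N%:R :> R by rewrite ltr0n.
have l0 : 0 < l N by exact: lt_le_trans l1.
have := @rate_sqr R k tau kap tau0 N NR l0 => e.
have -> : rho N ^+ 2 = be N `^ (dm1 R k / D) * l N `^ kap / N%:R by rewrite -e mulfK // gt_eqF.
rewrite /v powRDgt0 // powRN; move: (be N `^ _) => x; field.
by rewrite !gt_eqF // powR_gt0.
Qed.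

Let v_gt0 N : admissible N -> 0 < v N.
Proof.
by move=> [_ l1 /andP[b1 bN] _ _]; rewrite mulr_gt0 // mulr_gt0 // powR_gt0 // (lt_le_trans ltr01).
Qed.

Let v_ge N : admissible N -> A * (TN N)%:R ^+ k.+1 * Bf * B / trim r N ^+ 2 <= v N.
Proof.
move=> hN; have [N0 l1 /andP[b1 bN] T0 _] := hN.
rewrite -exprVn trimV // -(powR_mulrn 2 (powR_ge0 _ _)) -powRrM (mulrC r) /v /G.
have h := resolution_le hN; set x := l N `^ _; have x0 : 0 <= x by exact: powR_ge0.
apply: (@le_trans _ _ (A * (c2 ^+ k.+1 * be N `^ (dm1 R k / D)) * Bf * B * x)).
  by rewrite ler_wpM2r // ler_wpM2r // ler_wpM2r // ler_wpM2l // ltW.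
set y := c2 ^+ _; set z := be N `^ _.
have yz : 0 <= y * z * x by rewrite !mulr_ge0 ?powR_ge0 ?exprn_ge0 // ltW.
by rewrite -subr_ge0; set d := (X in 0 <= X); have -> : d = y * z * x by rewrite /d; ring.
Qed.

(** The constraint on the exponential parameter at u = log N. Both sides carry (log N)^(2r), which
    leaves T^(d-1) log N against N. *)
Let b_le : \forall N \near \oo,
  16 * (A * (TN N)%:R ^+ k.+1 / trim r N) ^+ 2 * l N <= v N * N%:R.
Proof.
pose c := 16 * A ^+ 2 * (c2 ^+ k.+1) ^+ 2 / G.
have c0 : 0 <= c by rewrite divr_ge0 ?(ltW G0) // !mulr_ge0 ?exprn_ge0 ?(ltW c20) ?(ltW A0).
near=> N; have hN : admissible N by near: N; exact: admissible_near.
have h : c * (be N `^ (dm1 R k / D) * l N) <= N%:R by near: N; apply: rate_dim_near => //; exact: kappa_ge0.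
have [N0 l1 /andP[b1 bN] T0 _] := hN; have hT' := resolution_le hN.
have l0 : 0 <= l N by apply: le_trans l1.
rewrite trimV // exprMn exprMn -(powR_mulrn 2 (powR_ge0 (l N) _)) -powRrM (mulrC r) /v.
set x := l N `^ _; set y := be N `^ _ in h hT' *.
have x0 : 0 <= x by exact: powR_ge0. have y0 : 0 <= y by exact: powR_ge0.
apply: (@le_trans _ _ (16 * (A ^+ 2 * (c2 ^+ k.+1 * y) ^+ 2 * x) * l N)).
  rewrite ler_wpM2r // ler_wpM2l // ler_wpM2r // ler_wpM2l ?sqr_ge0 //.
  by rewrite lerXn2r // nnegrE ?exprn_ge0 // mulr_ge0 // exprn_ge0 // ltW.
have -> : 16 * (A ^+ 2 * (c2 ^+ k.+1 * y) ^+ 2 * x) * l N = G * (y * x) * (c * (y * l N)).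
  by rewrite /c; field; rewrite gt_eqF.
by rewrite ler_wpM2l // mulr_ge0 ?(ltW G0) // mulr_ge0.
Unshelve. all: by end_near. Qed.

Definition summand_dev (sgn : bool) (N : nat) : Omega -> V -> R :=
  dev Z (summand (TN N) (trim r N) sgn) (summand_mean (TN N) (trim r N) sgn) N.

Lemma measurable_summand_dev sgn N : admissible N ->
  measurable_fun setT (fun wx : Omega * V => summand_dev sgn N wx.1 wx.2).
Proof.
move=> hN; apply: (measurable_dev (sample_measurable hM)).
  exact: (measurable_summand _ _ (trim_gt0 hN)).
exact: (measurable_summand_mean _ _ (trim_gt0 hN)).
Qed.

(** The tail bound at u = log N gives deviations of order (v log N / N)^(1/2); the probability of
    order N^(-2) is summable, as the almost sure statement needs. *)
Lemma summand_dev_sup : exists2 a : R, 0 <= a & \forall N \near \oo, forall sgn,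
  exists E : set Omega, [/\ measurable E, (P E <= (2 ^+ (dimd k).+1 / N%:R ^+ 2)%:E)%E &
    forall w, ~ E w -> forall x, sphere x ->
      `|summand_dev sgn N w x| <= a * (rho N * l N `^ ((2 * r + 1 - kap) / 2))].
Proof.
have [e e0 he] := @mesh_near R (4 * (dimd k)%:R * C2) (2 * c2) al r
  (mulr_ge0 (mulr_ge0 (ler0n _ _) (ler0n _ _)) C20) (mulr_ge0 (ler0n _ _) (ltW c20)) al0 (ltW r0).
(* The union bound over a grid with (N^e + 1)^d points must still leave a factor N^-2. *)
pose a0 : R := (e * dimd k + 4)%N%:R.
(* The extra 1 pays for the discretisation error, at most 1/N and hence at most the rate. *)
exists (a0 * Num.sqrt G + 1); first by rewrite addr_ge0 // mulr_ge0 // sqrtr_ge0.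
near=> N => sgn; have hN : admissible N by near: N; exact: admissible_near.
have [N0 l1 bb T0 _] := hN; have /andP[b1 bN] := bb.
have t0 := trim_gt0 hN; have NR : 0 < N%:R :> R by rewrite ltr0n.
have l0 : 0 < l N by exact: lt_le_trans l1.
have hb : 16 * (A * (TN N)%:R ^+ k.+1 / trim r N) ^+ 2 * l N <= v N * N%:R by near: N; exact: b_le.
have hm : forall x : R, 0 <= x <= 2 * c2 * N%:R ->
    4 * (dimd k)%:R * C2 * (x `^ al * l N `^ r) / (N ^ e)%N%:R <= N%:R^-1 by near: N; exact: he.
have g0 : (0 < N ^ e)%N by rewrite expn_gt0 N0.
pose Lc := C2 * (2 * TN N)%N%:R `^ al / trim r N.
have L0 : 0 <= Lc by rewrite divr_ge0 ?mulr_ge0 ?powR_ge0 // ltW.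
have hv i x : sphere x -> (\int[P]_w (summand (TN N) (trim r N) sgn x (Z i false w, Z i true w) ^+ 2)%:E <= (v N)%:E)%E.
  by move=> sx; apply: le_trans (summand_var sgn T0 t0 i sx) _; rewrite lee_fin; exact: v_ge.
have hZ : mutually_independent P (fun ib : nat * bool => Z ib.1 ib.2) by case: hM.
have [E [mE PE hE]] := dev_sup_fluct (sample_measurable hM) hZ (measurable_summand (TN N) sgn t0)
  (measurable_summand_mean (TN N) sgn t0) (fun i w x => @summand_le _ _ sgn T0 t0 i w x) hv
  (fun i w x y => @summand_lip _ _ sgn T0 t0 i w x y) (fun i x => @summand_meanE _ _ sgn T0 t0 i x)
  N0 (v_gt0 hN) a0 g0 L0 (ltW l0) hb.
exists E; split => //.
  apply: le_trans PE _; rewrite lee_fin.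
  (* (N^e + 1)^d <= 2^d N^(e d) is offset by a0 - 2 = e d + 2, leaving 2^(d+1) / N^2. *)
  have -> : expR ((2 - a0) * l N) = ((N%:R : R) ^+ (e * dimd k + 2)) ^-1.
    have -> : (2 - a0) * l N = - (l N * (e * dimd k + 2)%N%:R) by rewrite /a0 !natrD; ring.
    by rewrite expRN expRM lnK ?posrE // powR_mulrn // ltW.
  have hg : ((N ^ e).+1 ^ dimd k)%N%:R <= 2 ^+ dimd k * N%:R ^+ (e * dimd k) :> R.
    rewrite exprM -exprMn natrX lerXn2r ?nnegrE ?mulr_ge0 ?exprn_ge0 //.
    by rewrite -natr1 natrX mulr_natl mulr2n lerD2l -natrX ler1n.
  apply: le_trans (ler_wpM2r _ hg) _; first by rewrite mulr_ge0 // invr_ge0 exprn_ge0.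
  rewrite le_eqVlt; apply/orP; left; apply/eqP; rewrite exprD (exprS _ (dimd k)).
  have := exprn_gt0 (e * dimd k) NR; move: (2 ^+ dimd k) (_ ^+ (e * _)) => x y y0.
  by field; rewrite !gt_eqF.
move=> w Ew x sx; apply: le_trans (hE w Ew x sx) _.
set h := (2 * r + 1 - kap) / 2.
have lh : 1 <= l N `^ h.
  by apply: powR_ge1 => //; rewrite divr_ge0 // subr_ge0; have /andP[] := kappa_bounds q1 (ltW r0).
have rh : 0 < rho N by rewrite powR_gt0 // (lt_le_trans ltr01).
rewrite [leRHS]mulrDl mul1r; apply: lerD.
  have -> : v N * l N / N%:R = G * (rho N * l N `^ h) ^+ 2.
    rewrite mulrAC v_rate // exprMn -(powR_mulrn 2 (powR_ge0 (l N) _)) -powRrM.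
    have -> : h * 2%:R = (2 * r - kap) + 1 by rewrite /h; field.
    by rewrite (@powRDgt0 _ _ (2 * r - kap)) // powRr1 ?(ltW l0) // -!mulrA.
  rewrite sqrtrM ?(ltW G0) // sqrtr_sqr ger0_norm ?mulr_ge0 ?powR_ge0 //.
  by rewrite -[leRHS]mulrA.
apply: (@le_trans _ _ (N%:R^-1)).
  have := hm (2 * TN N)%N%:R; rewrite ler0n resolution_leN // => /(_ isT); apply: le_trans.
  by rewrite /Lc trimV // le_eqVlt; apply/orP; left; apply/eqP; ring.
apply: (@le_trans _ _ (rho N)); first exact: rate_ge.
by rewrite ler_peMr // ltW.
Unshelve. all: by end_near. Qed.

Lemma summand_dev_L2 (eps : R) : 0 < eps -> exists2 c : R, 0 <= c & \forall N \near \oo, forall sgn,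
  exists E : set Omega, [/\ measurable E, (P E <= eps%:E)%E &
    forall w, ~ E w ->
      (\int[sigma]_x (summand_dev sgn N w x ^+ 2)%:E <= (c * (rho N ^+ 2 * l N `^ (2 * r - kap)))%:E)%E].
Proof.
move=> eps0; have S0 := surface_ge0 hs.
pose c0 := 8 * expR 2 * G * surf_area R (dimd k).
have c0_ge0 : 0 <= c0 by rewrite mulr_ge0 // mulr_ge0 ?(ltW G0) // mulr_ge0 ?expR_ge0.
(* Markov's bound is c0 / c, which this choice makes at most eps. *)
pose c := c0 / eps + 1; have cp : 0 < c by rewrite ltr_wpDl // divr_ge0 // ltW.
exists c; first exact: ltW.
near=> N => sgn; have hN : admissible N by near: N; exact: admissible_near.
have [N0 l1 bb T0 _] := hN; have /andP[b1 bN] := bb.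
have t0 := trim_gt0 hN; have NR : 0 < N%:R :> R by rewrite ltr0n.
have l0 : 0 < l N by exact: lt_le_trans l1.
have rh : 0 < rho N by rewrite powR_gt0 // (lt_le_trans ltr01).
have hb : 16 * (A * (TN N)%:R ^+ k.+1 / trim r N) ^+ 2 * l N <= v N * N%:R by near: N; exact: b_le.
have hb1 : 16 * (A * (TN N)%:R ^+ k.+1 / trim r N) ^+ 2 <= v N * N%:R.
  by apply: le_trans hb; rewrite ler_peMr // mulr_ge0 ?sqr_ge0.
have hv i x : sphere x -> (\int[P]_w (summand (TN N) (trim r N) sgn x (Z i false w, Z i true w) ^+ 2)%:E <= (v N)%:E)%E.
  by move=> sx; apply: le_trans (summand_var sgn T0 t0 i sx) _; rewrite lee_fin; exact: v_ge.
have hZ : mutually_independent P (fun ib : nat * bool => Z ib.1 ib.2) by case: hM.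
set rr := rho N ^+ 2 * l N `^ (2 * r - kap).
have rr0 : 0 < rr by rewrite mulr_gt0 ?exprn_gt0 // powR_gt0.
have [E [mE PE hE]] := dev_L2_fluct hs (sample_measurable hM) hZ (measurable_summand (TN N) sgn t0)
  (measurable_summand_mean (TN N) sgn t0) (fun i w x => @summand_le _ _ sgn T0 t0 i w x) hv
  (fun i x => @summand_meanE _ _ sgn T0 t0 i x) N0 (v_gt0 hN) hb1 (mulr_gt0 cp rr0).
exists E; split => //; apply: le_trans PE _; rewrite lee_fin v_rate // -/rr.
have -> : 8 * expR 2 * (G * rr) * surf_area R (dimd k) / (c * rr) = c0 / c.
  by rewrite /c0; field; rewrite !gt_eqF.
by rewrite ler_pdivrMr // /c mulrDr mulr1 mulrC divfK ?gt_eqF // lerDl ltW.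
Unshelve. all: by end_near. Qed.

(** Ensures that [MN], once of the order of the rate, is at most 1, so that its product with a
    fluctuation is no larger than the fluctuation. *)
Lemma rate_le_near (M : R) : 0 <= M -> \forall N \near \oo, M * rho N <= 1.
Proof.
move=> M0; have td : 0 < tau / D by rewrite divr_gt0.
near=> N; have hN : admissible N by near: N; exact: admissible_near.
have [N0 l1 /andP[b1 bN] T0 _] := hN.
have NR : 0 < N%:R :> R by rewrite ltr0n.
have l0 : 0 < l N by exact: lt_le_trans l1.
have b0 : 0 < be N by exact: lt_le_trans b1.
have h1 : 1 * l N `^ kap <= N%:R `^ 2^-1 by near: N; apply: powR_ln_near; rewrite invr_gt0.
have h2 : M <= N%:R `^ (2^-1 * (tau / D)) by near: N; apply: powR_nat_near; apply: mulr_gt0 td; rewrite invr_gt0.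
have hb : N%:R `^ 2^-1 <= be N.
  rewrite /base ler_pdivlMr ?powR_gt0 //.
  have e : N%:R `^ 2^-1 * N%:R `^ 2^-1 = N%:R :> R.
    by rewrite -powRDgt0 // -[2^-1]mul1r -splitr powRr1 // ltW.
  by rewrite -[leRHS]e ler_wpM2l ?powR_ge0 // -[leLHS]mul1r.
rewrite powRN ler_pdivrMr ?powR_gt0 // mul1r; apply: le_trans h2 _.
rewrite (powRrM _ 2^-1 (tau / D)); apply: ge0_ler_powR; rewrite ?nnegrE ?powR_ge0 //; exact: ltW.
Unshelve. all: by end_near. Qed.

Variable g0 : V -> R.
Hypothesis hW : sobolev sigma q tau (Rfun sigma fbeta) g0.
Hypothesis hK3 : K3 sigma chi q tau.
Hypothesis hTa : \forall N \near \oo,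
  (sigma [set x | sphere x /\ (0 < fX x < trim r N)%R] <=
    (be N `^ (- ((tau + dm1 R k * (1 - inv_q q)) / D)))%:E)%E.
Local Notation f := (Rfun sigma fbeta).
Local Notation S := (surf_area R (dimd k)).
Local Notation norm h := (Lnorm sigma q (fun x => (h x)%:E)).
Let S0 : 0 <= S := surface_ge0 hs.

Let mf : measurable_fun setT f. Proof. by case: hW => [[]]. Qed.

Let sbias N := sphere_bias sigma fbeta chi (TN N).
Let tbias N := trim_bias sigma fX chi (TN N) (trim r N).

Let measurable_sbias N : measurable_fun setT (sbias N).
Proof.
apply: measurable_funB => //.
apply: (measurable_surface_Rintegral hs (f := fun p : V * V => Kker chi (2 * TN N) p.1 p.2 * f p.2)).
by apply: measurable_funM; [exact: measurable_Kker|exact: (measurableT_comp mf)].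
Qed.

(** (K3) is applied at resolution 2 T_N, and the lower bound on T_N turns (2 T_N)^(-tau) into the
    rate. *)
Lemma sphere_bias_rate : exists2 c : R, 0 <= c & forall N, admissible N -> (norm (sbias N) <= (c * rho N)%:E)%E.
Proof.
have [C hC] := hK3; have [[_ nf] [_ ng] _] := hW.
have nf0 := Lnorm_ge0 sigma q (fun x => (f x)%:E); have ng0 := Lnorm_ge0 sigma q (fun x => (g0 x)%:E).
pose s := fine (sobnorm sigma q f g0).
have sE : sobnorm sigma q f g0 = s%:E.
  by rewrite /s fineK // ge0_fin_numE /sobnorm ?adde_ge0 // lte_add_pinfty.
have s0 : 0 <= s by rewrite fine_ge0 // adde_ge0.
exists (`|C| * c1 `^ (- tau) * s); first by rewrite !mulr_ge0 // powR_ge0.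
move=> N hN; have [N0 l1 /andP[b1 bN] T0 /andP[hT1 _]] := hN.
have T20 : (0 < 2 * TN N)%N by rewrite muln_gt0.
apply: (@le_trans _ _ (norm (fun x => f x - Kop sigma chi (2 * TN N) f x))).
  apply: (surface_Lnorm_le hs) => //.
    rewrite (_ : (fun x => _) = (fun x => - sbias N x)); first exact: measurableT_comp.
    by apply/funext => x; rewrite /sbias /sphere_bias opprB.
  by move=> x _ _; rewrite /sbias /sphere_bias distrC.
apply: le_trans (hC _ T20 _ _ hW) _; rewrite sE -EFinM lee_fin.
have b0 : 0 < be N by exact: lt_le_trans b1.
have hT2 : (2 * TN N)%N%:R `^ (- tau) <= c1 `^ (- tau) * rho N :> R.
  have -> : rho N = (be N `^ (1 / D)) `^ (- tau).
    by rewrite -powRrM; congr (_ `^ _); ring.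
  have cb : 0 < c1 * be N `^ (1 / D) by rewrite mulr_gt0 // powR_gt0.
  rewrite -powRM ?(ltW c10) ?powR_ge0 // !powRN lef_pV2 ?posrE ?powR_gt0 ?ltr0n //.
  apply: ge0_ler_powR; rewrite ?nnegrE ?(ltW tau0) ?(ltW cb) ?ler0n //.
  by apply: le_trans hT1 _; rewrite ler_nat leq_pmull.
rewrite [leRHS]mulrAC ler_wpM2r // -mulrA.
apply: le_trans (ler_wpM2l (normr_ge0 C) hT2).
by rewrite ler_wpM2r ?powR_ge0 // ler_norm.
Qed.

Lemma trim_bias_rate : exists2 c : R, 0 <= c & \forall N \near \oo, (norm (tbias N) <= (c * rho N)%:E)%E.
Proof.
pose a := A * c2 ^+ k.+1; have a0 : 0 <= a by rewrite mulr_ge0 ?exprn_ge0 ?(ltW A0) ?(ltW c20).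
exists (trim_const k q a B).
  by rewrite /trim_const; case: q => [p| |]; rewrite ?powR_ge0 // mulr_ge0 // addr_ge0.
near=> N; have hN : admissible N by near: N; exact: admissible_near.
have hta : (sigma [set x | sphere x /\ (0 < fX x < trim r N)%R] <=
    (be N `^ (- ((tau + dm1 R k * (1 - inv_q q)) / D)))%:E)%E by near: N; exact: hTa.
have [N0 l1 /andP[b1 bN] T0 _] := hN.
have b0 : 0 < be N by exact: lt_le_trans b1.
have hd := le_trans (trim_set_measure hM (trim r N)) hta.
apply: (trim_Lnorm hs q1 (d1 := dm1 R k) _ b0 a0 B0).
- exact: (measurable_trim_bias hs hM).
- move=> x sx; apply: le_trans (trim_bias_sup hs hM hK1 hA T0 sx hd) _.
  rewrite [leRHS]mulrCA ler_wpM2l ?powR_ge0 // /a -[leRHS]mulrA ler_wpM2l ?(ltW A0) //.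
  exact: resolution_le.
rewrite mulrC; exact: (trim_bias_L1 hs hM hK1).
Unshelve. all: by end_near. Qed.

Variable fhat : nat -> seq (bool * V) -> V -> R.
Local Notation Rh := (Rhat Z fhat r chi TN).
Local Notation M := (MN Z fX fhat r).

Lemma MN_ge0 N w : 0 <= M N w.
Proof. exact: bigmax_ge_id. Qed.

(** [fhat] enters only through the maximal relative error [MN] of the trimmed densities. It
    multiplies the empirical mean of |psi|, which is an expectation of size at most B plus a
    deviation. *)
Lemma Rhat_pointwise N w x : admissible N -> sphere x -> first x != 0 ->
  `|Rh N w x - f x| <= M N w * `|summand_dev true N w x| + M N w * B + `|summand_dev false N w x|
    + `|tbias N x| + `|sbias N x| + `|sbias N (- x)|.
Proof.
move=> hN sx x0; have [N0 l1 /andP[b1 bN] T0 _] := hN; have t0 := trim_gt0 hN.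
have NR : 0 < N%:R :> R by rewrite ltr0n.
pose W i : V * V := (Z i false w, Z i true w).
pose ps := psi fX chi (TN N) (trim r N) x.
pose ratio i := Num.max (fX (xdat Z i w)) (trim r N) / Num.max (fhat N (data Z N w) (xdat Z i w)) (trim r N).
(* Exchanging the denominators multiplies each summand by [ratio i], so the difference carries
   [ratio i - 1]. *)
have hps : Rh N w x - 1 / 2 - N%:R^-1 * \sum_(i < N) ps (W i) = N%:R^-1 * \sum_(i < N) ps (W i) * (ratio i - 1).
  rewrite /Rhat [1 / 2 + _]addrC addrK -mulrBr -sumrB; congr (_ * _); apply: eq_bigr => i _.
  rewrite /ps /psi /ratio /trim_max /= /xdat /ydat.
  have := trim_max_gt0 fX t0 (Z i false w); rewrite /trim_max.
  by move: (Num.max (fX _) _) => y y0; rewrite mulrBr mulr1 mulrA divfK // gt_eqF.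
have h1 : `|Rh N w x - 1 / 2 - N%:R^-1 * \sum_(i < N) ps (W i)| <= M N w * (N%:R^-1 * \sum_(i < N) `|ps (W i)|).
  rewrite hps normrM gtr0_norm ?invr_gt0 // mulrCA ler_wpM2l ?invr_ge0 ?(ltW NR) //.
  apply: le_trans (ler_norm_sum _ _ _) _; rewrite mulr_sumr; apply: ler_sum => i _.
  rewrite normrM mulrC ler_wpM2r //.
  exact: (le_bigmax 0 (fun i : 'I_N => `|ratio i - 1|)).
have h2 : N%:R^-1 * \sum_(i < N) `|ps (W i)| <= `|summand_dev true N w x| + B.
  have -> : N%:R^-1 * \sum_(i < N) `|ps (W i)| =
      summand_dev true N w x + summand_mean (TN N) (trim r N) true x by rewrite /summand_dev /dev subrK.
  apply: lerD; first exact: ler_norm.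
  by apply: le_trans (ler_norm _) _; exact: summand_mean_abs.
have h3 : N%:R^-1 * \sum_(i < N) ps (W i) =
    summand_dev false N w x + summand_mean (TN N) (trim r N) false x by rewrite /summand_dev /dev subrK.
have h4 := psi_mean_bias hs hM chi01 fXB hK1 hA T0 t0 mf 0 sx x0.
rewrite (psi_mean hs hM fXB hA T0 t0 0 sx) in h4.
rewrite -/(summand_mean (TN N) (trim r N) false x) -/(tbias N x) -/(sbias N x) -/(sbias N (- x)) in h4.
have h5 : `|Rh N w x - 1 / 2 - N%:R^-1 * \sum_(i < N) ps (W i)| <= M N w * `|summand_dev true N w x| + M N w * B.
  by apply: le_trans h1 _; rewrite -mulrDr ler_wpM2l // MN_ge0.
move: h5; rewrite h3.
move: h4 (ler_norm (tbias N x)) (ler_norm (sbias N x)) (ler_norm (- sbias N x)) (ler_norm (sbias N (- x))) (ler_norm (- sbias N (- x)))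
  (ler_norm (summand_dev false N w x)) (ler_norm (- summand_dev false N w x)) (normr_ge0 (sbias N x)) (normr_ge0 (sbias N (- x))).
rewrite !normrN.
move: (summand_mean _ _ _ _) (`|tbias N x|) (tbias N x) (`|sbias N x|) (sbias N x) (`|sbias N (- x)|) (sbias N (- x)).
move: (`|summand_dev false N w x|) (summand_dev false N w x) (M N w * `|summand_dev true N w x|) (M N w * B) (Rh N w x) (f x).
move=> a1 a2 a3 a4 a5 a6 a7 a8 a9 a10 a11 a12 a13; rewrite !ler_norml => /andP[u1 u2] u3 u4 u5 u6 u7 u8 u9 u10 u11 /andP[u12 u13].
by apply/andP; split; lra.
Qed.

(** Deterministic once [MN] and both deviations are small. The condition [m * e <= 1] absorbs the
    product of [MN] with the deviation of |psi|; [c'] occurs twice, for the smoothing bias at x and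
    at -x. *)
Lemma Rhat_Lnorm N w (m F c c' e : R) : admissible N -> 0 <= e -> 0 <= m -> m * e <= 1 ->
  M N w <= m * e ->
  (forall sgn, norm (summand_dev sgn N w) <= (F * e)%:E)%E ->
  (norm (tbias N) <= (c * e)%:E)%E -> (norm (sbias N) <= (c' * e)%:E)%E ->
  (Lnorm sigma q (fun x => (Rh N w x - f x)%:E) <=
    ((F + m * B * (1 + S) + F + c + c' + c') * e)%:E)%E.
Proof.
move=> hN e0 m0 m1 hm hF hc hc'; have M0 := MN_ge0 N w; have t0 := trim_gt0 hN.
have md sgn : measurable_fun setT (fun x => `|summand_dev sgn N w x|).
  apply: measurableT_comp => //.
  exact: (measurableT_comp (measurable_summand_dev sgn hN) (measurable_pair1 w)).
have mt : measurable_fun setT (fun x => `|tbias N x|).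
  by apply: measurableT_comp => //; exact: (measurable_trim_bias hs hM).
have ms : measurable_fun setT (fun x => `|sbias N x|) by exact: measurableT_comp.
have mo : measurable_fun setT (fun x : V => `|sbias N (- x)|).
  by apply: (measurableT_comp ms); exact: measurable_oppv.
have nabs (h : V -> R) : norm (fun x => `|h x|) = norm h by rewrite -[RHS]Lnorm_abse.
have h m' : m' = m * e -> (norm (fun x => `|summand_dev true N w x| + m' * B +
   `|summand_dev false N w x| + `|tbias N x| + `|sbias N x| + `|sbias N (- x)|)
   <= (F * e)%:E + (m * B * (1 + S) * e)%:E + (F * e)%:E + (c * e)%:E + (c' * e)%:E + (c' * e)%:E)%E.
  move=> m'E.
  pose bd (u : V -> R) (b : \bar R) := measurable_fun setT u /\ (norm u <= b)%E.
  have step u u' b b' : bd u b -> bd u' b' -> bd (fun x => u x + u' x) (b + b')%E.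
    move=> [mu ub] [mu' ub']; split; first exact: measurable_funD.
    by apply: le_trans (surface_LnormD sigma q1 mu mu') _; exact: leeD.
  have b1 sgn : bd (fun x => `|summand_dev sgn N w x|) (F * e)%:E by split; rewrite ?nabs.
  have b2 : bd (fun=> m' * B) (m * B * (1 + S) * e)%:E.
    split => //; apply: le_trans (surface_Lnorm_sup hs q1 (c := m' * B) _ _ _) _ => //.
    - by rewrite m'E !mulr_ge0.
    - by move=> x _ _; rewrite ger0_norm // m'E !mulr_ge0.
    by rewrite lee_fin m'E le_eqVlt; apply/orP; left; apply/eqP; ring.
  have b3 : bd (fun x => `|tbias N x|) (c * e)%:E by split; rewrite ?nabs.
  have b4 : bd (fun x => `|sbias N x|) (c' * e)%:E by split; [exact: ms|rewrite nabs; exact: hc'].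
  have b5 : bd (fun x => `|sbias N (- x)|) (c' * e)%:E.
    split => //; rewrite (nabs (fun x => sbias N (- x))).
    by apply: le_trans hc'; apply: (surface_Lnorm_opp hs).
  by have [] := step _ _ _ _ (step _ _ _ _ (step _ _ _ _ (step _ _ _ _ (step _ _ _ _ (b1 true) b2) (b1 false)) b3) b4) b5.
rewrite !mulrDl !EFinD; apply: le_trans (h _ erefl).
apply: (surface_Lnorm_le hs) => //.
- apply: measurable_funB => //; apply: measurable_funD => //; apply: measurable_funM => //.
  apply: measurable_sum => i; apply: measurable_funM => //; apply: measurable_funM => //.
  by apply: measurable_Kminus.
- have mD (u u' : V -> R) : measurable_fun setT u -> measurable_fun setT u' -> measurable_fun setT (fun x => u x + u' x).
    exact: measurable_funD.
  exact: (mD _ _ (mD _ _ (mD _ _ (mD _ _ (mD _ _ (md true) (measurable_cst _)) (md false)) mt) ms) mo).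
move=> x sx x0; rewrite [leRHS]ger0_norm; last by rewrite !addr_ge0 // !mulr_ge0.
apply: le_trans (Rhat_pointwise w hN sx x0) _; rewrite !lerD2r; apply: lerD.
  by rewrite ler_piMl // (le_trans hm).
by rewrite ler_wpM2r.
Qed.

(** Two events for each value of [sgn], one for the supremum and one for the L^2 size, each of
    probability at most eps/4. *)
Lemma fluct_outer (eps : R) : 0 < eps -> exists2 F : R, 0 <= F & \forall N \near \oo,
  outer_le P [set w | ~ forall sgn, (norm (summand_dev sgn N w) <= (F * rho N)%:E)%E] eps.
Proof.
move=> eps0; have e40 : 0 < eps / 4 by rewrite divr_gt0.
have [a a0 ha] := summand_dev_sup; have [c c0 hc] := summand_dev_L2 e40.
exists (fluct_const k q a c).
  rewrite /fluct_const; case: q => [p| |]; [|by rewrite mulr_ge0 // addr_ge0|by rewrite mulr_ge0 // addr_ge0].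
  by case: ifP => _; rewrite ?powR_ge0 // !addr_ge0.
near=> N; have hN : admissible N by near: N; exact: admissible_near.
have [N0 l1 /andP[b1 bN] T0 _] := hN.
have NR : 0 < N%:R :> R by rewrite ltr0n.
have l0 : 0 < l N by exact: lt_le_trans l1.
have rh : 0 < rho N by rewrite powR_gt0 // (lt_le_trans ltr01).
have haN : forall sgn, exists E : set Omega, [/\ measurable E, (P E <= (2 ^+ (dimd k).+1 / N%:R ^+ 2)%:E)%E &
    forall w, ~ E w -> forall x, sphere x ->
      `|summand_dev sgn N w x| <= a * (rho N * l N `^ ((2 * r + 1 - kap) / 2))] by near: N.
have hcN : forall sgn, exists E : set Omega, [/\ measurable E, (P E <= (eps / 4)%:E)%E &
    forall w, ~ E w ->
      (\int[sigma]_x (summand_dev sgn N w x ^+ 2)%:E <= (c * (rho N ^+ 2 * l N `^ (2 * r - kap)))%:E)%E] by near: N.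
have hn : 2 ^+ (dimd k).+1 / N%:R ^+ 2 <= eps / 4.
  have : 2 ^+ (dimd k).+1 / (eps / 4) <= (N%:R : R) `^ 2 by near: N; exact: powR_nat_near.
  by rewrite powR_mulrn ?(ltW NR) // !ler_pdivrMr ?exprn_gt0 // mulrC.
have one sgn : outer_le P [set w | ~ (norm (summand_dev sgn N w) <= (fluct_const k q a c * rho N)%:E)%E] (eps / 2).
  have [E [mE PE hE]] := haN sgn; have [E' [mE' PE' hE']] := hcN sgn.
  exists (E `|` E'); split; first exact: measurableU.
    move=> w /= hw; apply: contrapT => /not_orP[hw1 hw2]; apply: hw.
    apply: (fluct_Lnorm hs q1 _ rh l0 a0 c0 (hE w hw1) (hE' w hw2)).
    exact: (measurableT_comp (measurable_summand_dev sgn hN) (measurable_pair1 w)).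
  apply: le_trans (measureU2 _ mE mE') _.
  have -> : eps / 2 = eps / 4 + eps / 4 by field.
  by rewrite EFinD; apply: leeD => //; apply: le_trans PE _; rewrite lee_fin.
have e2 : eps = eps / 2 + eps / 2 by exact: splitr.
rewrite [X in outer_le _ _ X]e2; apply: outer_leW (outer_leU (one true) (one false)) => // w /= hw.
apply: contrapT => /not_orP[/contrapT h1 /contrapT h2]; apply: hw.
by case.
Unshelve. all: by end_near. Qed.

Lemma MN_rate N w (m : R) : admissible N ->
  be N `^ (tau / D) * l N `^ r * M N w <= m -> M N w <= m * rho N.
Proof.
move=> [N0 l1 /andP[b1 bN] T0 _] h.
have bt : 0 < be N `^ (tau / D) by rewrite powR_gt0 // (lt_le_trans ltr01).
rewrite powRN ler_pdivlMr //; apply: le_trans h; rewrite mulrC ler_wpM2r ?MN_ge0 //.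
by rewrite ler_peMr ?(ltW bt) // powR_ge1 // ltW.
Qed.

Lemma rate_in_probability : T_b P Z fX fhat r q tau ->
  Op P (fun N w => Lnorm sigma q (fun x => (Rh N w x - f x)%:E)) (fun N => rho N).
Proof.
move=> hTb eps eps0; have e20 : 0 < eps / 2 by rewrite divr_gt0.
have [m [m0 [N1 hm]]] := hTb _ e20; have [F F0 hF] := fluct_outer e20.
have [c c0 hc] := trim_bias_rate; have [c' c'0 hc'] := sphere_bias_rate.
pose C := F + m * B * (1 + S) + F + c + c' + c' + 1.
have C0 : 0 < C by rewrite ltr_wpDl // !addr_ge0 // !mulr_ge0 ?addr_ge0 // ltW.
exists C; split => //.
suff : \forall N \near \oo, outer_le P [set w | ((C * rho N)%:E < Lnorm sigma q (fun x => (Rh N w x - f x)%:E))%E] eps.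
  by move=> [N2 _ h]; exists N2 => N N2N; exact: h.
near=> N; have hN : admissible N by near: N; exact: admissible_near.
have hmN : outer_le P [set w | ((m * 1)%:E < (be N `^ (tau / D) * l N `^ r * M N w)%:E)%E] (eps / 2).
  by apply: hm; near: N; exact: nbhs_infty_ge.
have hFN : outer_le P [set w | ~ forall sgn, (norm (summand_dev sgn N w) <= (F * rho N)%:E)%E] (eps / 2) by near: N.
have hcN : (norm (tbias N) <= (c * rho N)%:E)%E by near: N.
have hr : m * rho N <= 1 by near: N; apply: rate_le_near; exact: ltW.
have e2 : eps = eps / 2 + eps / 2 by exact: splitr.
rewrite [X in outer_le _ _ X]e2; apply: outer_leW (outer_leU hmN hFN) => // w /= hw.
apply: contrapT => /not_orP[h1 /contrapT h2].
have hM' : M N w <= m * rho N.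
  by apply: MN_rate => //; rewrite leNgt; apply/negP => h3; apply: h1; rewrite mulr1 lte_fin.
have := Rhat_Lnorm hN (powR_ge0 _ _) (ltW m0) hr hM' h2 hcN (hc' _ hN).
move=> /(lt_le_trans hw); rewrite lte_fin ltNge => /negP; apply.
by rewrite ler_wpM2r ?powR_ge0 // /C lerDl.
Unshelve. all: by end_near. Qed.

(** For q = oo the supremum bound alone controls the norm, and kappa = 2r + 1 leaves no logarithm in
    it; its exceptional events are summable. *)
Lemma rate_almost_sure : q = +oo%E -> T_c P Z fX fhat r tau -> exists C : R, {ae P, forall w,
  (limn_esup (fun N => (powR (base (2 * r + 1) N) (tau / D))%:E
     * Lnorm sigma +oo%E (fun x => (Rh N w x - f x)%:E)) <= C%:E)%E}.
Proof.
move=> qy [m0 hTc]; have ky : kap = 2 * r + 1 by rewrite qy.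
(* The margin 1 turns the limit superior in (T-c) into an eventual bound. *)
pose m := `|m0| + 1; have m1 : 0 <= m by rewrite addr_ge0.
have [a a0 ha] := summand_dev_sup.
have [c c0 hc] := trim_bias_rate; have [c' c'0 hc'] := sphere_bias_rate.
pose F := a * (1 + S); pose C := F + m * B * (1 + S) + F + c + c' + c'.
have c2p : 0 <= 2 * 2 ^+ (dimd k).+1 :> R by apply: mulr_ge0 => //; exact: exprn_ge0.
have /choice[E hE] : forall N, exists E : set Omega, [/\ measurable E,
    ((0 < N)%N -> (P E <= ((2 * 2 ^+ (dimd k).+1) / N%:R ^+ 2)%:E)%E) &
    (admissible N /\ forall sgn, exists E : set Omega, [/\ measurable E, (P E <= (2 ^+ (dimd k).+1 / N%:R ^+ 2)%:E)%E &
    forall w, ~ E w -> forall x, sphere x ->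
      `|summand_dev sgn N w x| <= a * (rho N * l N `^ ((2 * r + 1 - kap) / 2))]) ->
    forall w, ~ E w -> forall sgn, (norm (summand_dev sgn N w) <= (F * rho N)%:E)%E].
  move=> N; set Q := _ /\ _; have [hQ|nQ] := pselect Q; last first.
    exists set0; split => // _; rewrite measure0 lee_fin; apply: divr_ge0; last exact: exprn_ge0.
    exact: c2p.
  have [hN /(fun h => (h true, h false))[[E1 [mE1 PE1 hE1]] [E2 [mE2 PE2 hE2]]]] := hQ.
  exists (E1 `|` E2); split; first exact: measurableU.
    move=> N0; apply: le_trans (measureU2 _ mE1 mE2) _.
    by rewrite -mulrA mulr_natl mulr2n EFinD leeD.
  move=> _ w /not_orP[w1 w2] sgn.
  have hw : forall x, sphere x -> `|summand_dev sgn N w x| <= a * rho N.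
    have e1 : l N `^ ((2 * r + 1 - kap) / 2) = 1 by rewrite ky subrr mul0r powRr0.
    move=> x sx; have := hE1 w w1 x sx; have := hE2 w w2 x sx.
    by rewrite e1 mulr1; case: sgn.
  rewrite /F [_ * rho N]mulrAC; apply: (surface_Lnorm_sup hs q1) => //.
  - exact: (measurableT_comp (measurable_summand_dev sgn hN) (measurable_pair1 w)).
  - by rewrite mulr_ge0 // powR_ge0.
  by move=> x sx _; exact: hw.
have hE1 N : measurable (E N) by have [] := hE N.
have hBC := borel_cantelli_sqr hE1 c2p (fun N => let: And3 _ h _ := hE N in h).
exists C; apply: filterS2 hBC hTc => w hw1 hw2.
have hw3 := limn_esup_le_near ltr01 hw2.
apply: limn_esup_near_le; near=> N.
have hN : admissible N by near: N; exact: admissible_near.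
have haN : forall sgn, exists E : set Omega, [/\ measurable E, (P E <= (2 ^+ (dimd k).+1 / N%:R ^+ 2)%:E)%E &
    forall w, ~ E w -> forall x, sphere x ->
      `|summand_dev sgn N w x| <= a * (rho N * l N `^ ((2 * r + 1 - kap) / 2))] by near: N.
have nE : ~ E N w by near: N.
have hcN : (norm (tbias N) <= (c * rho N)%:E)%E by near: N.
have hr : m * rho N <= 1 by near: N; exact: rate_le_near.
have hmN : ((be N `^ (tau / D) * l N `^ r * M N w)%:E <= (m0 + 1)%:E)%E.
  by rewrite ky; near: N.
have hM' : M N w <= m * rho N.
  by apply: MN_rate => //; rewrite lee_fin in hmN; apply: le_trans hmN _; rewrite lerD2r ler_norm.
have [_ _ hEN] := hE N.
have := Rhat_Lnorm hN (powR_ge0 _ _) m1 hr hM' (hEN (conj hN haN) w nE) hcN (hc' _ hN).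
have [N0 l1 /andP[b1 bN] T0 _] := hN.
have bt : 0 < be N `^ (tau / D) by rewrite powR_gt0 // (lt_le_trans ltr01).
rewrite -ky {1}qy -/C => hL.
apply: le_trans (lee_wpmul2l _ hL) _; first by rewrite lee_fin ltW.
by rewrite -EFinM lee_fin powRN mulrCA divff ?mulr1 // gt_eqF.
Unshelve. all: by end_near. Qed.

End Estimator.

(** The constants of (K2) may be negative; for T >= 1, replacing them by their absolute values only
    weakens the bound. *)
Lemma K2_nonneg (R : realType) (k : nat) (chi : nat -> nat -> R) : K2 k chi ->
  exists C al : R, [/\ 0 <= C, 0 <= al & forall (x y z : Vec R k) (T : nat), (0 < T)%N ->
    sphere x -> sphere y -> sphere z ->
    `|Kker chi T z x - Kker chi T z y| <= C * enorm (x - y) * T%:R `^ al].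
Proof.
move=> [C [al hC]]; exists `|C|, `|al|; split => // x y z T T0 sx sy sz.
apply: le_trans (hC x y z T sx sy sz) _.
apply: (@le_trans _ _ (`|C| * enorm (x - y) * T%:R `^ al)).
  by rewrite ler_wpM2r ?powR_ge0 // ler_wpM2r ?enorm_ge0 // ler_norm.
by rewrite ler_wpM2l ?mulr_ge0 ?enorm_ge0 // ler_powR ?ler1n // ler_norm.
Qed.

(** (T-a) bounds [fX] on H+, and (M) makes it vanish on the rest of the sphere. *)
Lemma density_bound (R : realType) (k : nat) (sigma : {measure set Vec R k -> \bar R})
  (dO : measure_display) (Omega : measurableType dO) (P : probability Omega R)
  (Z : nat -> bool -> Omega -> Vec R k) (fbeta fX : Vec R k -> R) (r : R) (q : \bar R) (tau : R) :
  model_M P sigma Z fbeta fX -> T_a sigma fX r q tau ->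
  exists2 Bf : R, 0 <= Bf & forall x, sphere x -> fX x <= Bf.
Proof.
move=> [_ _ _ _ [_ fX0]] [[B hB] _]; exists `|B| => // x sx.
have [h|h] := leP 0 (first x); first by apply: le_trans (hB x (conj sx h)) _; exact: ler_norm.
by rewrite fX0.
Qed.

Unset Implicit Arguments.

(* Dimension d = dimd k = k.+2 >= 2.  Z i true = beta_i, Z i false = X_i. *)
Theorem theorem4p2 (R : realType) (k : nat)
  (sigma : {measure set Vec R k -> \bar R})
  (dO : measure_display) (Omega : measurableType dO) (P : probability Omega R)
  (Z : nat -> bool -> Omega -> Vec R k) (fbeta fX : Vec R k -> R)
  (fhat : nat -> seq (bool * Vec R k) -> Vec R k -> R)
  (r : R) (TN : nat -> nat) (chi : nat -> nat -> R) (q : \bar R) (tau : R) :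
  is_surface_measure sigma ->
  (1 <= q)%E -> 0 < tau -> 0 < r ->
  model_M P sigma Z fbeta fX ->
  K1 sigma chi -> K2 k chi -> K4 chi -> K3 sigma chi q tau ->
  (exists g, sobolev sigma q tau (Rfun sigma fbeta) g) ->
  rate_T k TN (kappa q r) tau ->
  (T_a sigma fX r q tau -> T_b P Z fX fhat r q tau ->
     Op P (fun N w => Lnorm sigma q
                        (fun x => (Rhat Z fhat r chi TN N w x - Rfun sigma fbeta x)%:E))
          (fun N => powR (base (kappa q r) N) (- (tau / (2 * tau + dm1 R k)))))
  /\
  (q = +oo%E -> T_a sigma fX r q tau -> T_c P Z fX fhat r tau ->
     exists C : R, {ae P, forall w,
       (limn_esup (fun N => (powR (base (2 * r + 1) N) (tau / (2 * tau + dm1 R k)))%:E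
          * Lnorm sigma +oo%E
              (fun x => (Rhat Z fhat r chi TN N w x - Rfun sigma fbeta x)%:E))
        <= C%:E)%E}).

Proof.
move=> hs q1 tau0 r0 hM [B0 hK1] /K2_nonneg[C2 [al [C20 al0 hK2]]] [chi01 _] hK3 [g0 hW].
move=> [c1 [c2 [c10 c20 [NT hT0]]]].
have [A A0 hA0] := @Kminus_le R k.
have hA T (x y : Vec R k) : (0 < T)%N -> sphere x -> sphere y ->
    `|Kminus chi T x y| <= A * T%:R ^+ k.+1 by exact: hA0.
have hB T (x : Vec R k) : sphere x -> (\int[sigma]_y (`|Kker chi T x y|)%:E <= `|B0|%:E)%E.
  by move=> sx; apply: le_trans (hK1 T x sx) _; rewrite lee_fin ler_norm.
have hT : \forall N \near \oo, c1 * base (kappa q r) N `^ (1 / (2 * tau + dm1 R k)) <= (TN N)%:R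
    <= c2 * base (kappa q r) N `^ (1 / (2 * tau + dm1 R k)) by exists NT.
have trim_set_small : T_a sigma fX r q tau -> \forall N \near \oo,
    (sigma [set x | sphere x /\ (0 < fX x < trim r N)%R] <=
    (base (kappa q r) N `^ (- ((tau + dm1 R k * (1 - inv_q q)) / (2 * tau + dm1 R k))))%:E)%E.
  by move=> [_ /(_ 1 ltr01)[N0 h]]; exists N0 => // N /h; rewrite mul1r.
split=> [hTa hTb|qy hTa hTc]; have [Bf Bf0 hBf] := density_bound hM hTa.
  exact: (rate_in_probability hs hM chi01 Bf0 (normr_ge0 B0) A0 C20 al0 hBf hB hK2 hA
    r0 tau0 q1 c10 c20 hT hW hK3 (trim_set_small hTa) hTb).
exact: (rate_almost_sure hs hM chi01 Bf0 (normr_ge0 B0) A0 C20 al0 hBf hB hK2 hA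
    r0 tau0 q1 c10 c20 hT hW hK3 (trim_set_small hTa) qy hTc).
Qed.
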